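(* Let $M \in \overline{\mathbb{S}}_+^{\,n;1}$. In $\mathrm{O}(n^4)$ operations, Algorithm III (described in the context) will either compute an optimal solution of the quadratic program $$\text{(QP)}\qquad \underset{0 \leq x \leq u}{\text{minimize}} \ \ q^{\top} x + \tfrac12\, x^{\top} M x$$ or determine that this problem has no finite optimal solution.
   Context: Here $q\in\mathbb{R}^n$ and $0<u_i\le\infty$ for $i\in[n]=\{1,\dots,n\}$; $u_i=\infty$ means that $x_i$ has no upper bound. $\mathbb{S}^m$ (resp. $\mathbb{S}^m_+$) is the set of real symmetric (resp. symmetric positive semidefinite) $m\times m$ matrices. The comparison matrix $\overline{A}$ of $A\in\mathbb{S}^m$ has entries $\overline{A}_{ii}=a_{ii}$ and $\overline{A}_{ij}=-|a_{ij}|$ for $i\neq j$. The class $\overline{\mathbb{S}}_+^{\,m}$ consists of all $A\in\mathbb{S}^m$ with $\overline{A}$ positive semidefinite. The class $\overline{\mathbb{S}}_+^{\,n;1}$ consists of all $M\in\mathbb{S}^n_+$ all of whose principal submatrices of order $n-1$ belong to $\overline{\mathbb{S}}_+^{\,n-1}$. $M_{\alpha\beta}$ is the submatrix with rows $\alpha$ and columns $\beta$, and for nonsingular $M_{\alpha\alpha}$ with $\bar\alpha=[n]\setminus\alpha$, $(M/M_{\alpha\alpha})=M_{\bar\alpha\bar\alpha}-M_{\bar\alpha\alpha}M_{\alpha\alpha}^{-1}M_{\alpha\bar\alpha}$ is the Schur complement. **Subproblems.** For $i\in[n]$, $x^{-i},u^{-i},q^{-i}$ are $x,u,q$ with the $i$th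 component removed (other components keep their indices), and $M^{-i}$ is $M$ with row and column $i$ removed. $\mathrm{QP}_i^{\rm lb}$: minimize $(q^{-i})^\top x^{-i}+\frac12 (x^{-i})^\top M^{-i}x^{-i}$ over $0\le x^{-i}\le u^{-i}$. $\mathrm{QP}_i^{\rm ub}$ (if $u_i<\infty$): minimize $(q^{-i;\rm ub})^\top x^{-i}+\frac12 (x^{-i})^\top M^{-i}x^{-i}$ over $0\le x^{-i}\le u^{-i}$, where $q^{-i;\rm ub}_j=q_j+m_{ji}u_i$ for $j\neq i$. **Algorithm III.** For every $i\in[n]$: (1) Apply the PPPA (below) to $\mathrm{QP}_i^{\rm lb}$. If it has no finite optimal solution, then neither does (QP); stop. Otherwise let $x^{-i;\rm lb}$ be the computed solution. If $q_i+\sum_{j\ne i}m_{ij}x_j^{-i;\rm lb}\ge 0$, then $(0,x^{-i;\rm lb})$ ($i$th component $0$) is a desired solution of (QP); stop. Otherwise continue. (2) If $u_i<\infty$, apply the PPPA to $\mathrm{QP}_i^{\rm ub}$. If it has no finite optimal solution, then neither does (QP); stop. Otherwise let $x^{-i;\rm ub}$ be the computed solution. If $q_i+\sum_{j\ne i}m_{ij}x_j^{-i;\rm ub}\le 0$, then $(u_i,x^{-i;\rm ub})$ ($i$th component $u_i$) is a desired solution of (QP); stop. Otherwise continue. (3) If the algorithm has not stopped for any $i$, take $M$ irreducible (as one may, since otherwise $M$ is block diagonal up to simultaneous row and column permutation and (QP) decomposes), choose any $\alpha\subset[n]$ with $|\alpha|=n-2$, let $\beta=[n]\setminus\alpha$,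 and check, say by Fourier–Motzkin elimination, the feasibility of the system in the two variables $x_\beta$: $$0=(q_\beta-M_{\beta\alpha}M_{\alpha\alpha}^{-1}q_\alpha)+(M/M_{\alpha\alpha})x_\beta,\quad 0\le x_\beta\le u_\beta,\quad 0\le -M_{\alpha\alpha}^{-1}[q_\alpha+M_{\alpha\beta}x_\beta]\le u_\alpha .$$ If it is infeasible, (QP) has no finite optimal solution; otherwise a solution is obtained, with $x_\alpha=-M_{\alpha\alpha}^{-1}[q_\alpha+M_{\alpha\beta}x_\beta]$. **The PPPA (parametric principal pivoting algorithm)**, for minimizing $q^\top x+\frac12x^\top Mx$ over $0\le x\le u$ with $M\in\overline{\mathbb{S}}_+^{\,m}$ (here $M,q,u$ denote the data of the problem being solved). *Preparation.* Decompose $M$ into irreducible diagonal blocks and treat each block separately ($1\times1$ zero blocks by inspection). For an irreducible block, again called $M$, take $d>0$ with $\overline Md\ge 0$ (the solution of $\overline Md=0$ with last component $1$ if it exists, otherwise $\overline M^{-1}r$ for any $r>0$) and set $p=\frac12(M+\overline M)d$, which is nonnegative. If $p_i=0$ and $q_i<0$ for some $i$, reduce the problem and repeat: if $u_i=\infty$, eliminate $x_i=-\frac{1}{m_{ii}}[q_i+\sum_{k\ne i}m_{ik}x_k]$, which gives the problem in $x^{-i}$ with bounds $0\le x^{-i}\le u^{-i}$, matrix $(M/m_{ii})$ and linear term $q_j-\frac{m_{ji}}{m_{ii}}q_i$ ($j\ne i$); if $u_i<\infty$, substitute $x_i=u_i-z_i$ and keep only $z_i\ge0$ as bound on $z_i$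 (the other bounds being unchanged), which gives linear term $q_j+m_{ji}u_i$ for $j\neq i$ and $-(q_i+m_{ii}u_i)$ for $j=i$, and the matrix obtained from $M$ by changing the sign of the off-diagonal entries of row and column $i$. Continue until $q+\tau_0p\ge0$ for some $\tau_0>0$. *Pivoting.* Start with $\alpha=\gamma=\emptyset$ and $\beta$ the set of all indices ($\alpha$: variables between bounds; $\beta$: at $0$; $\gamma$: at upper bound). At each iteration solve $M_{\alpha\alpha}(\bar q_\alpha,\bar p_\alpha)=(q_\alpha+M_{\alpha\gamma}u_\gamma,\,p_\alpha)$ and, for $\delta\in\{\beta,\gamma\}$, set $(\bar q_\delta,\bar p_\delta)=(q_\delta+M_{\delta\gamma}u_\gamma,\,p_\delta)-M_{\delta\alpha}(\bar q_\alpha,\bar p_\alpha)$. Let $\tau_{\rm new}=\max\{\rho_0,\rho_u,0\}$ with $\rho_0=\max\{-\bar q_i/\bar p_i: i\in\beta,\ \bar p_i>0\}$ and $\rho_u=\max\{-(u_i+\bar q_i)/\bar p_i: i\in\alpha,\ \bar p_i>0,\ u_i<\infty\}$ (the maximum over the empty set is $-\infty$). If $\tau_{\rm new}=0$, stop with the optimal solution $(x_\alpha,x_\beta,x_\gamma)=(-\bar q_\alpha,0,u_\gamma)$. Otherwise let $\bar i$ be a maximizing index. If $\bar i\in\alpha$, move $\bar i$ from $\alpha$ to $\gamma$. If $\bar i\in\beta$ and $(M/M_{\alpha\alpha})_{\bar i\bar i}>0$, move $\bar i$ from $\beta$ to $\alpha$. If $\bar i\in\beta$ and $(M/M_{\alpha\alpha})_{\bar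 i\bar i}=0$, let $\hat m_{j\bar i}$ ($j\in\alpha$) be the components of $M_{\alpha\alpha}^{-1}M_{\alpha\bar i}$ and let $\rho_{\min}$ be the minimum of the ratios $(-\bar q_j-\tau_{\rm new}\bar p_j)/\hat m_{j\bar i}$ ($j\in\alpha$, $\hat m_{j\bar i}>0$), the ratios $(u_j+\bar q_j+\tau_{\rm new}\bar p_j)/(-\hat m_{j\bar i})$ ($j\in\alpha$, $u_j<\infty$, $\hat m_{j\bar i}<0$), and $u_{\bar i}$ if finite; if $\rho_{\min}=\infty$ (no candidate), stop: the problem is unbounded below; if $\rho_{\min}=u_{\bar i}$, move $\bar i$ from $\beta$ to $\gamma$; if $\rho_{\min}$ is a ratio of the first kind attained at $\bar j$, move $\bar i$ from $\beta$ to $\alpha$ and $\bar j$ from $\alpha$ to $\beta$; if of the second kind attained at $\bar j$, move $\bar i$ from $\beta$ to $\alpha$ and $\bar j$ from $\alpha$ to $\gamma$. Then iterate. Linear systems are handled by updating $M_{\alpha\alpha}^{-1}$ from one iteration to the next.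
   Formalization: The test in step (2) is corrected to q_i + m_ii u_i + sum_{j≠i} m_ij x_j^{-i;ub} ≤ 0 (as printed it fails for M=I, q=(-1,-1), u=(5,5)); when the PPPA preparation repeats, the restriction of the earlier d is reused; step (3) runs on each irreducible block. *)

(* Defs.v *)
From HB Require Import structures.
From mathcomp Require Import all_boot all_order all_algebra.
From mathcomp Require Import reals constructive_ereal.

Set Implicit Arguments.
Unset Strict Implicit.
Unset Printing Implicit Defensive.
Import Order.TTheory GRing.Theory Num.Theory.
Local Open Scope ring_scope.

(** * Matrix classes and the quadratic program *)

Definition psdmx (R : realType) m (A : 'M[R]_m) : Prop :=
  A^T = A /\ forall x : 'cV[R]_m, 0 <= (x^T *m A *m x) 0 0.

Definition cmpmx (R : realType) m (A : 'M[R]_m) : 'M[R]_m :=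
  \matrix_(i, j) (if i == j then A i i else - `|A i j|).

Definition Sbar (R : realType) m (A : 'M[R]_m) : Prop :=
  A^T = A /\ psdmx (cmpmx A).

(* [row' i (col' i M)] is M without its i-th row and column; these are all the
   principal submatrices of order n - 1. *)
Definition Sbar1 (R : realType) n (M : 'M[R]_n) : Prop :=
  psdmx M /\ forall i : 'I_n, Sbar (row' i (col' i M)).

Definition feasible (R : realType) n (u : 'I_n -> \bar R) (x : 'cV[R]_n) :=
  forall i, 0 <= x i 0 /\ ((x i 0)%:E <= u i)%E.

Definition objective (R : realType) n (M : 'M[R]_n) (q x : 'cV[R]_n) : R :=
  (q^T *m x) 0 0 + 2^-1 * (x^T *m M *m x) 0 0.

Definition optimal (R : realType) n (M : 'M[R]_n) (q : 'cV[R]_n)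
    (u : 'I_n -> \bar R) (x : 'cV[R]_n) : Prop :=
  feasible u x /\
  forall y, feasible u y -> objective M q x <= objective M q y.

(** * Programs with counted operations *)

(* A [prog V A] is an algorithm computing an [A] from numbers of the abstract
   type [V].  All the algorithms below are polymorphic in [V], so that they can
   produce, combine and compare numbers only through the constructors of [prog],
   each of which is charged by [all_runs].
   [Idx k] charges [k] operations on indices.  It is used for the decomposition
   into irreducible blocks, a graph search that is not written out; all other
   work on indices is at most proportional to the charged operations around it.
   [Any k] returns an arbitrary number below [k] and [AnyPos] an arbitrary
   positive number: they render the free choices of the algorithm. *)
Variant arith := Add | Sub | Mul | Div.

Inductive prog (V A : Type) : Type :=
| Ret of A
| Lit of nat & (V -> prog V A)
| Op of arith & V & V & (V -> prog V A)
| Le of V & V & (bool -> prog V A)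
| Idx of nat & prog V A
| Any of nat & (nat -> prog V A)
| AnyPos of (V -> prog V A)
| Diverge.

Arguments Ret {V A}.
Arguments Lit {V A}.
Arguments Op {V A}.
Arguments Le {V A}.
Arguments Idx {V A}.
Arguments Any {V A}.
Arguments AnyPos {V A}.
Arguments Diverge {V A}.

Definition arith_eval (R : realType) (o : arith) (x y : R) : R :=
  match o with Add => x + y | Sub => x - y | Mul => x * y | Div => x / y end.

(* [all_runs c Q]: whatever the choices made, [c] terminates without dividing by
   zero, with a result [a] and a number [t] of operations such that [Q a t]. *)
Fixpoint all_runs (R : realType) (A : Type) (c : prog R A)
    (Q : A -> nat -> Prop) : Prop :=
  match c with
  | Ret a => Q a 0%N
  | Lit k f => all_runs (f k%:R) (fun a t => Q a t.+1)
  | Op o x y f => (o = Div -> y != 0) /\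
      all_runs (f (arith_eval o x y)) (fun a t => Q a t.+1)
  | Le x y f => all_runs (f (x <= y)) (fun a t => Q a t.+1)
  | Idx k c' => all_runs c' (fun a t => Q a (k + t)%N)
  | Any k f => (0 < k)%N /\
      forall j, (j < k)%N -> all_runs (f j) (fun a t => Q a t.+1)
  | AnyPos f => forall r, 0 < r -> all_runs (f r) (fun a t => Q a t.+1)
  | Diverge => False
  end.

Fixpoint bind (V A B : Type) (c : prog V A) (k : A -> prog V B) : prog V B :=
  match c with
  | Ret a => k a
  | Lit m f => Lit m (fun v => bind (f v) k)
  | Op o x y f => Op o x y (fun v => bind (f v) k)
  | Le x y f => Le x y (fun b => bind (f b) k)
  | Idx m c' => Idx m (bind c' k)
  | Any m f => Any m (fun j => bind (f j) k)
  | AnyPos f => AnyPos (fun v => bind (f v) k)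
  | Diverge => Diverge
  end.

Declare Scope prog_scope.
Delimit Scope prog_scope with prog.
Notation "'let*' x ':=' c 'in' k" := (bind c (fun x => k))
  (at level 200, x name, c at level 100, k at level 200) : prog_scope.
Local Open Scope prog_scope.

Section Basics.
Variable V : Type.
Implicit Types x y : V.

Definition lit k : prog V V := Lit k Ret.
Definition add x y : prog V V := Op Add x y Ret.
Definition sub x y : prog V V := Op Sub x y Ret.
Definition mul x y : prog V V := Op Mul x y Ret.
Definition div x y : prog V V := Op Div x y Ret.
Definition opp x : prog V V := let* z := lit 0 in sub z x.

Definition le x y : prog V bool := Le x y Ret.
Definition lt x y : prog V bool := let* b := le y x in Ret (~~ b).
Definition eqv x y : prog V bool :=
  let* b := le x y in if b then le y x else Ret false.
Definition is0 x : prog V bool := let* z := lit 0 in eqv x z.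
Definition ge0 x : prog V bool := let* z := lit 0 in le z x.
Definition le0 x : prog V bool := let* z := lit 0 in le x z.
Definition gt0 x : prog V bool := let* z := lit 0 in lt z x.
Definition lt0 x : prog V bool := let* z := lit 0 in lt x z.

Definition abs x : prog V V := let* b := ge0 x in if b then Ret x else opp x.
Definition max x y : prog V V := let* b := le x y in Ret (if b then y else x).
Definition min x y : prog V V := let* b := le x y in Ret (if b then x else y).

(* an arbitrary element of the nonempty sequence [a :: s] *)
Definition any (T : Type) (a : T) (s : seq T) : prog V T :=
  Any (size s).+1 (fun j => Ret (nth a (a :: s) j)).

Fixpoint foldM (S T : Type) (f : S -> T -> prog V S) (z : S) (s : seq T)
    : prog V S :=
  if s is a :: s' then let* z' := f z a in foldM f z' s' else Ret z.

Definition filterM (T : Type) (f : T -> prog V bool) (s : seq T)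
    : prog V (seq T) :=
  foldM (fun r a => let* b := f a in Ret (if b then rcons r a else r)) [::] s.

Definition sum (T : Type) (s : seq T) (f : T -> prog V V) : prog V V :=
  let* z := lit 0 in foldM (fun a i => let* v := f i in add a v) z s.

Definition dot (T : Type) (s : seq T) (f g : T -> V) : prog V V :=
  sum s (fun i => mul (f i) (g i)).

(* Loops are unrolled [fuel] times and then diverge: all runs of a loop terminate
   iff [all_runs] holds for some value of [fuel]. *)
Fixpoint loop (S B : Type) (fuel : nat) (step : S -> prog V (S + B)) (s : S)
    : prog V B :=
  if fuel is fuel'.+1 then
    let* r := step s in
    match r with inl s' => loop fuel' step s' | inr b => Ret b end
  else Diverge.

End Basics.

(** * Linear algebra *)

(* Subvectors and submatrices keep the indices of the whole problem: the current
   index set is a sequence of indices, and the entries outside it are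
   irrelevant. *)
Section LinearAlgebra.
Variables (V : Type) (n : nat).
Notation I := 'I_n.
Notation vec := (I -> V).
Notation mat := (I -> I -> V).
Implicit Types (S alpha : seq I) (M N : mat).

Definition upd (T : Type) (x : I -> T) i (v : T) : I -> T :=
  fun j => if j == i then v else x j.

(* [x] on [S] and [y] elsewhere *)
Definition glue (T : Type) S (x y : I -> T) : I -> T :=
  fun j => if j \in S then x j else y j.

Definition tab S (f : I -> prog V V) : prog V vec :=
  let* z := lit V 0 in
  foldM (fun x i => let* v := f i in Ret (upd x i v)) (fun=> z) S.

Definition tab2 S S' (f : I -> I -> prog V V) : prog V mat :=
  let* z := lit V 0 in
  foldM (fun X i => let* r := tab S' (f i) in Ret (upd X i r))
    (fun _ _ => z) S.

Definition mulmv N S S' (x : vec) : prog V vec := tab S (fun i => dot S' (N i) x).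

(* the irreducible diagonal blocks of the (symmetric) matrix M_SS *)
Definition blocks M S : prog V (seq (seq I)) :=
  let* e := foldM (fun e (ij : I * I) =>
              let* b := is0 (M ij.1 ij.2) in
              Ret (if b then e else fun i j => ((i, j) == ij) || e i j))
            (fun _ _ => false) [seq (i, j) | i <- S, j <- S] in
  Idx (size S ^ 2)
    (Ret (undup [seq [seq j <- S | fingraph.connect e i j] | i <- S])).

(* If N is the inverse of the symmetric matrix M_aa (a = alpha), [schur] returns
   M_aa^{-1} M_ai and (M/M_aa)_ii, [border] the inverse for a + i, and
   [unborder] the inverse for a - j. *)
Definition schur M alpha N (i : I) : prog V (vec * V) :=
  let* c := mulmv N alpha alpha (M^~ i) in
  let* t := dot alpha (M i) c in
  let* s := sub (M i i) t in
  Ret (c, s).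

Definition border M alpha N (i : I) : prog V mat :=
  let* cs := schur M alpha N i in
  let: (c, s) := cs in
  tab2 (i :: alpha) (i :: alpha) (fun k l =>
    let* o := lit V 1 in
    if k == i then
      if l == i then div o s
      else let* t := div (c l) s in opp t
    else if l == i then let* t := div (c k) s in opp t
    else let* t := mul (c k) (c l) in
         let* t' := div t s in
         add (N k l) t').

Definition unborder alpha N (j : I) : prog V mat :=
  let alpha' := rem j alpha in
  tab2 alpha' alpha' (fun k l =>
    let* t := mul (N k j) (N j l) in
    let* t' := div t (N j j) in
    sub (N k l) t').

Definition inverse M S : prog V mat :=
  let* N0 := tab2 [::] [::] (fun i j => Ret (M i j)) in
  let* r := foldM (fun r i =>
              let* N := border M r.1 r.2 i in Ret (i :: r.1, N))
            ([::], N0) S in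
  Ret r.2.

Definition comparison M S : prog V mat :=
  tab2 S S (fun i j =>
    if i == j then Ret (M i i) else let* a := abs (M i j) in opp a).

End LinearAlgebra.

(** * The parametric principal pivoting algorithm *)

Section PPPA.
Variables (V : Type) (n : nat).
Notation I := 'I_n.
Notation vec := (I -> V).
Notation mat := (I -> I -> V).

(* the data (M, q, u); [ub i = None] stands for an infinite bound *)
Record qp := QP { mx : mat; lin : vec; ub : I -> option V }.

(* For a nonempty irreducible block B of M, a vector d > 0 with
   \overline{M} d >= 0.  As \overline{M} without its last row and column is
   nonsingular, the only candidate for a solution of \overline{M} d = 0 with last
   component 1 is found by solving all the equations but the last one. *)
Definition find_d (M : mat) (B : seq I) : prog V vec :=
  if B is i0 :: B0 then
    let l := last i0 B0 in
    let B' := belast i0 B0 in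
    let* Mb := comparison M B in
    let* N := inverse Mb B' in
    let* c := mulmv N B' B' (Mb^~ l) in
    let* d' := tab B' (fun j => opp (c j)) in
    let* o := lit V 1 in
    let d := upd d' l o in
    let* t := dot B (Mb l) d in
    let* b := is0 t in
    if b then Ret d else
    let* N' := border Mb B' N l in
    let* r := tab B (fun=> AnyPos Ret) in
    mulmv N' B B r
  else Diverge.

Definition find_p (M : mat) (d : vec) (B : seq I) : prog V vec :=
  let* Mb := comparison M B in
  let* A := tab2 B B (fun i j => add (M i j) (Mb i j)) in
  let* v := mulmv A B B d in
  let* two := lit V 2 in
  tab B (fun i => div (v i) two).

Definition upper (u : I -> option V) (S : seq I) : prog V vec :=
  tab S (fun i => if u i is Some c then Ret c else Diverge).

(* alpha, gamma and M_{alpha alpha}^{-1}; beta is the rest of the block *)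
Record pivot_state := Pivot { pa : seq I; pg : seq I; pinv : mat }.

(* what stops the increase of x_i when (M/M_aa)_ii = 0: its own upper bound, or
   a variable x_j reaching its lower or upper bound *)
Variant blocking := Own | ToLower of I | ToUpper of I.

Definition pivot_step (P : qp) (p : vec) (B : seq I) (st : pivot_state)
    : prog V (pivot_state + option vec) :=
  let: QP M q u := P in
  let: Pivot alpha gamma N := st in
  let beta := [seq i <- B | (i \notin alpha) && (i \notin gamma)] in
  let* ug := upper u gamma in
  let* g := tab B (fun i => let* t := dot gamma (M i) ug in add (q i) t) in
  let* qa := mulmv N alpha alpha g in
  let* pa := mulmv N alpha alpha p in
  let* qd := tab (beta ++ gamma) (fun i =>
               let* t := dot alpha (M i) qa in sub (g i) t) in
  let* pd := tab (beta ++ gamma) (fun i =>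
               let* t := dot alpha (M i) pa in sub (p i) t) in
  let qb := glue alpha qa qd in
  let pb := glue alpha pa pd in
  let* r0 := foldM (fun r i =>
               let* b := gt0 (pb i) in
               if b then let* t := div (qb i) (pb i) in
                         let* t' := opp t in Ret (rcons r (i, t'))
               else Ret r) [::] beta in
  let* ru := foldM (fun r i =>
               if u i is Some c then
                 let* b := gt0 (pb i) in
                 if b then let* s := add c (qb i) in
                           let* t := div s (pb i) in
                           let* t' := opp t in Ret (rcons r (i, t'))
                 else Ret r
               else Ret r) [::] alpha in
  let* z := lit V 0 in
  let* tau := foldM (fun m (r : I * V) => max m r.2) z (r0 ++ ru) in
  let* stop := is0 tau in
  if stop then
    let* xa := tab alpha (fun i => opp (qb i)) in
    Ret (inr (Some (glue alpha xa (glue gamma ug (fun=> z)))))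
  else
  let* best := filterM (fun r : I * V => eqv r.2 tau) (r0 ++ ru) in
  if best isn't r :: best' then Diverge else
  let* ib := any V r best' in
  let i := ib.1 in
  if i \in alpha then
    let* N' := unborder alpha N i in
    Ret (inl (Pivot (rem i alpha) (i :: gamma) N'))
  else
  let* cs := schur M alpha N i in
  let: (c, s) := cs in
  let* pos := gt0 s in
  if pos then
    let* N' := border M alpha N i in
    Ret (inl (Pivot (i :: alpha) gamma N'))
  else
  let* xt := tab alpha (fun j => let* t := mul tau (pb j) in add (qb j) t) in
  let* k1 := foldM (fun r j =>
               let* b := gt0 (c j) in
               if b then let* t := opp (xt j) in
                         let* t' := div t (c j) in Ret (rcons r (ToLower j, t'))
               else Ret r) [::] alpha in
  let* k2 := foldM (fun r j =>
               if u j is Some uj then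
                 let* b := lt0 (c j) in
                 if b then let* t := add uj (xt j) in
                           let* e := opp (c j) in
                           let* t' := div t e in Ret (rcons r (ToUpper j, t'))
                 else Ret r
               else Ret r) [::] alpha in
  let k3 := if u i is Some ui then [:: (Own, ui)] else [::] in
  if k3 ++ k1 ++ k2 isn't k :: ks then Ret (inr None) else
  let* rho := foldM (fun m (r : blocking * V) => min m r.2) k.2 ks in
  let* bs := filterM (fun r : blocking * V => eqv r.2 rho) (k :: ks) in
  if bs isn't b :: bs' then Diverge else
  let* jb := any V b bs' in
  match jb.1 with
  | Own => Ret (inl (Pivot alpha (i :: gamma) N))
  | ToLower j =>
      let* N1 := unborder alpha N j in
      let* N2 := border M (rem j alpha) N1 i in
      Ret (inl (Pivot (i :: rem j alpha) gamma N2))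
  | ToUpper j =>
      let* N1 := unborder alpha N j in
      let* N2 := border M (rem j alpha) N1 i in
      Ret (inl (Pivot (i :: rem j alpha) (j :: gamma) N2))
  end.

(* Programs solving a quadratic program return [None] when it has no finite
   optimal solution. *)
Definition pivoting (fuel : nat) (P : qp) (p : vec) (B : seq I)
    : prog V (option vec) :=
  let* N0 := inverse (mx P) [::] in
  loop fuel (pivot_step P p B) (Pivot [::] [::] N0).

Definition inspect1 (P : qp) (i : I) : prog V (option vec) :=
  let* z := lit V 0 in
  let* b := ge0 (lin P i) in
  if b then Ret (Some (fun=> z)) else
  if ub P i is Some c then Ret (Some (fun=> c)) else Ret None.

(* elimination of x_i; B' is the block without i *)
Definition eliminate (P : qp) (B' : seq I) (i : I) : prog V qp :=
  let: QP M q u := P in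
  let* M' := tab2 B' B' (fun j k =>
               let* t := mul (M j i) (M i k) in
               let* t' := div t (M i i) in sub (M j k) t') in
  let* q' := tab B' (fun j =>
               let* t := div (M j i) (M i i) in
               let* t' := mul t (q i) in sub (q j) t') in
  Ret (QP M' q' u).

Definition uneliminate (P : qp) (B' : seq I) (i : I) (x : vec) : prog V vec :=
  let: QP M q _ := P in
  let* s := dot B' (M i) x in
  let* s' := add (q i) s in
  let* t := div s' (M i i) in
  let* t' := opp t in
  Ret (upd x i t').

(* substitution x_i = c - z_i, where c = u_i; only z_i >= 0 is kept *)
Definition reflect (P : qp) (B : seq I) (i : I) (c : V) : prog V qp :=
  let: QP M q u := P in
  let* M' := tab2 B B (fun j k =>
               if (j == i) (+) (k == i) then opp (M j k) else Ret (M j k)) in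
  let* q' := tab B (fun j =>
               let* t := mul (M j i) c in
               let* t' := add (q j) t in
               if j == i then opp t' else Ret t') in
  Ret (QP M' q' (upd u i None)).

(* [pppa_aux fuel od P S] solves P on the index set S, block by block.  At first
   [od] is [None] and a vector d is computed for each block; when the algorithm
   is repeated on a reduced problem, the restriction of d is used again (it
   still satisfies \overline{M} d >= 0). *)
Fixpoint pppa_aux (fuel : nat) (od : option vec) (P : qp) (S : seq I)
    : prog V (option vec) :=
  if fuel isn't fuel'.+1 then Diverge else
  let solve_block (B : seq I) : prog V (option vec) :=
    let* zero := if B is [:: i] then is0 (mx P i i) else Ret false in
    if zero then if B is i :: _ then inspect1 P i else Diverge else
    let* d := if od is Some d then Ret d else find_d (mx P) B in
    let* p := find_p (mx P) d B in
    let* bad := filterM (fun i =>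
                  let* b := is0 (p i) in
                  if b then lt0 (lin P i) else Ret false) B in
    if bad isn't i0 :: bad' then pivoting fuel' P p B else
    let* i := any V i0 bad' in
    match ub P i with
    | None =>
        let B' := rem i B in
        let* P' := eliminate P B' i in
        let* y := pppa_aux fuel' (Some d) P' B' in
        if y is Some x then let* x' := uneliminate P B' i x in Ret (Some x')
        else Ret None
    | Some c =>
        let* P' := reflect P B i c in
        let* y := pppa_aux fuel' (Some d) P' B in
        if y is Some z then let* xi := sub c (z i) in Ret (Some (upd z i xi))
        else Ret None
    end in
  let* Bs := blocks (mx P) S in
  let* z := lit V 0 in
  foldM (fun acc B =>
    if acc isn't Some x then Ret None else
    let* y := solve_block B in
    Ret (if y is Some y' then Some (glue B y' x) else None))
  (Some (fun=> z)) Bs.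

Definition pppa (fuel : nat) (P : qp) (S : seq I) : prog V (option vec) :=
  pppa_aux fuel None P S.

End PPPA.

(** * Fourier-Motzkin elimination *)

Section FourierMotzkin.
Variables (V : Type) (n : nat).
Notation I := 'I_n.
Notation vec := (I -> V).

(* (a, c) is the inequality \sum_{k in vars} a_k x_k <= c *)
Notation ineq := (vec * V)%type.

(* the value in [e] for x_k forced by [e] taken as an equality, given the other
   variables *)
Definition fm_bound (vars : seq I) (k : I) (x : vec) (e : ineq) : prog V V :=
  let* s := dot vars e.1 x in
  let* t := sub e.2 s in
  div t (e.1 k).

(* [e] has a positive and [f] a negative coefficient at k *)
Definition fm_combine (vars : seq I) (k : I) (e f : ineq) : prog V ineq :=
  let* m := opp (f.1 k) in
  let comb s t := let* s' := mul m s in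
                  let* t' := mul (e.1 k) t in add s' t' in
  let* a := tab vars (fun j => comb (e.1 j) (f.1 j)) in
  let* c := comb e.2 f.2 in
  Ret (a, c).

Fixpoint fm (vars : seq I) (es : seq ineq) : prog V (option vec) :=
  let* z := lit V 0 in
  if vars isn't k :: vars' then
    let* bad := filterM (fun e : ineq => lt0 e.2) es in
    Ret (if bad is [::] then Some (fun=> z) else None)
  else
  let* pos := filterM (fun e : ineq => gt0 (e.1 k)) es in
  let* neg := filterM (fun e : ineq => lt0 (e.1 k)) es in
  let* nul := filterM (fun e : ineq => is0 (e.1 k)) es in
  let* new := foldM (fun r (ef : ineq * ineq) =>
                let* e := fm_combine vars' k ef.1 ef.2 in Ret (e :: r))
              nul [seq (e, f) | e <- pos, f <- neg] in
  let* y := fm vars' new in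
  if y isn't Some x then Ret None else
  let extremum op (e : ineq) es' :=
    let* b := fm_bound vars' k x e in
    foldM (fun m e' => let* b' := fm_bound vars' k x e' in op m b') b es' in
  let* xk := match neg, pos with
             | e :: es', _ => extremum (@max V) e es'
             | [::], e :: es' => extremum (@min V) e es'
             | [::], [::] => Ret z
             end in
  Ret (Some (upd x k xk)).

End FourierMotzkin.

(** * Algorithm III *)

Section AlgorithmIII.
Variables (V : Type) (n : nat).
Notation I := 'I_n.
Notation vec := (I -> V).

(* an arbitrary subset with two elements of the set B (B itself if it has fewer) *)
Definition any_pair (B : seq I) : prog V (seq I) :=
  if B isn't i0 :: B0 then Ret [::] else
  let* i := any V i0 B0 in
  if rem i B isn't j0 :: B1 then Ret [:: i] else
  let* j := any V j0 B1 in
  Ret [:: i; j].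

(* the inequalities 0 <= a + \sum_{k in beta} w_k x_k and, if the bound is
   finite, a + \sum_{k in beta} w_k x_k <= b *)
Definition box (beta : seq I) (a : V) (w : vec) (b : option V)
    : prog V (seq (vec * V)) :=
  let* w' := tab beta (fun k => opp (w k)) in
  if b is Some c then
    let* t := sub c a in Ret [:: (w', a); (w, t)]
  else Ret [:: (w', a)].

(* x_alpha = h + G x_beta, and 0 = e + T x_beta with T = (M/M_aa) *)
Definition step3_block (P : qp V n) (B : seq I) : prog V (option vec) :=
  let: QP M q u := P in
  let* beta := any_pair B in
  let alpha := [seq k <- B | k \notin beta] in
  let* N := inverse M alpha in
  let* Nq := mulmv N alpha alpha q in
  let* h := tab alpha (fun i => opp (Nq i)) in
  let* G := tab2 alpha beta (fun i l =>
              let* t := dot alpha (N i) (M^~ l) in opp t) in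
  let* e := tab beta (fun i =>
              let* t := dot alpha (M i) h in add (q i) t) in
  let* T := tab2 beta beta (fun i l =>
              let* t := dot alpha (M i) (G^~ l) in add (M i l) t) in
  let* z := lit V 0 in
  let* o := lit V 1 in
  let* E := foldM (fun r i =>
              let* es := box beta (e i) (T i) (Some z) in Ret (es ++ r))
            [::] beta in
  let* E' := foldM (fun r i =>
               let* es := box beta z (upd (fun=> z) i o) (u i) in Ret (es ++ r))
             E beta in
  let* E'' := foldM (fun r i =>
                let* es := box beta (h i) (G i) (u i) in Ret (es ++ r))
              E' alpha in
  let* y := fm beta E'' in
  if y isn't Some xb then Ret None else
  let* xa := tab alpha (fun i =>
               let* t := dot beta (G i) xb in add (h i) t) in
  Ret (Some (glue alpha xa xb)).

(* step (3); a reducible M is decomposed into its irreducible blocks *)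
Definition step3 (P : qp V n) : prog V (option vec) :=
  let* Bs := blocks (mx P) (enum 'I_n) in
  let* z := lit V 0 in
  foldM (fun acc B =>
    if acc isn't Some x then Ret None else
    let* y := step3_block P B in
    Ret (if y is Some y' then Some (glue B y' x) else None))
  (Some (fun=> z)) Bs.

(* Steps (1) and (2) for the indices in [s], then step (3).  The sign tested in
   step (2) is that of the derivative of the objective with respect to x_i at
   (u_i, x^{-i;ub}), that is q_i + m_ii u_i + \sum_{j != i} m_ij x_j^{-i;ub}: at
   x_i = u_i the term m_ii u_i must not be dropped. *)
Fixpoint steps (fuel : nat) (P : qp V n) (s : seq I) : prog V (option vec) :=
  if s isn't i :: s' then step3 P else
  let: QP M q u := P in
  let S := rem i (enum 'I_n) in
  let* z := lit V 0 in
  let* ylb := pppa fuel P S in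
  if ylb isn't Some x then Ret None else
  let* t := dot S (M i) x in
  let* t' := add (q i) t in
  let* stop := ge0 t' in
  if stop then Ret (Some (upd x i z)) else
  if u i isn't Some c then steps fuel P s' else
  let* q' := tab S (fun j => let* a := mul (M j i) c in add (q j) a) in
  let* yub := pppa fuel (QP M q' u) S in
  if yub isn't Some x' then Ret None else
  let* r := dot S (M i) x' in
  let* mc := mul (M i i) c in
  let* qi := add (q i) mc in
  let* r' := add qi r in
  let* stop' := le0 r' in
  if stop' then Ret (Some (upd x' i c)) else steps fuel P s'.

Definition algorithmIII (fuel : nat) (P : qp V n) : prog V (option vec) :=
  steps fuel P (enum 'I_n).

End AlgorithmIII.

Definition qp_of (R : realType) n (M : 'M[R]_n) (q : 'cV[R]_n)
    (u : 'I_n -> \bar R) : qp R n :=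
  QP (fun i j => M i j) (fun i => q i 0)
     (fun i => if u i is r%:E%E then Some r else None).

(* Main.v *)
(* Correctness is expressed by the optimality (KKT) conditions, which for a positive
   semidefinite M characterize the minimizers, and the output [None] by a recession
   direction of negative slope.

   Inside the PPPA the only invariant is a vector d > 0 with \overline{M} d >= 0.
   Where |w| / d is maximal, row i of a system M w = b can only be satisfied if the
   neighbours of i attain the maximum too; in an irreducible block the maximum is
   therefore attained everywhere or not at all.  This gives the nonsingularity of all
   proper principal submatrices, and \bar p >= 0 for p = (M + \overline{M}) d / 2 and
   every basis alpha.  So, as tau decreases, the variables of alpha increase and the
   gradients elsewhere decrease: indices only move from beta to alpha to gamma, and
   there are at most 2m pivots.  The singular case (M/M_aa)_ii = 0 never occurs: a null
   vector z would satisfy 0 = z^T p = z_i \bar p_i although \bar p_i > 0.  Finally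
   p_i = 0 forces m_ij <= 0 for all j <> i, so that x_i > 0 in every solution when
   q_i < 0; this justifies the reductions of the preparation.

   In steps (1) and (2), two solutions of a subproblem differ by a null vector of
   M^{-i}, hence by a null vector of the semidefinite matrix M; so the sign tested does
   not depend on the solution computed.  If no test succeeds, every solution of (QP)
   satisfies 0 < x < u and q + Mx = 0, which is the system of step (3). *)

From mathcomp Require Import all_boot all_order all_algebra.
From mathcomp Require Import reals constructive_ereal.
From mathcomp Require Import ring lra zify.
(* last, because MathComp has other meanings for [add], [max], [inverse] etc *)
Require Import Defs.
Set Implicit Arguments.
Unset Strict Implicit.
Unset Printing Implicit Defensive.
Import Order.TTheory GRing.Theory Num.Theory.
Local Open Scope ring_scope.
Local Open Scope prog_scope.

(** * Reasoning about results and costs *)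


(** The bound [n^4] leaves O(n^3) for each of the at most [2 n] runs of the PPPA. The search for [d]
    is a cubic inversion; repeating it after each of up to linearly many reductions would already
    cost O(n^4) per run. This is why the recursion carries [gdd] with a fixed [d] instead of the
    semidefiniteness of the comparison matrix: elimination and reflection both preserve it, so [d]
    is paid for once. Each reduction is then quadratic, and so is each pivot, since the inverse is
    updated by bordering. Step (3) has no slack either: eliminating two variables from L
    inequalities can produce on the order of L^4 of them, and L is linear in [n].

    A reduced block may fall apart, so every recursive call decomposes its matrix again. Pivoting
    always ends with a solution; the output [None] of the PPPA originates only in a zero block of
    order 1 with negative linear term and no upper bound. Its obvious ray is carried back through
    the reductions to the whole problem. *)

Section Spec.
Variable R : realType.

(** An upper bound on the cost, rather than its exact value, makes the triple monotone in [b]: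
    budgets of consecutive pieces add up, and one arithmetic comparison remains at the end of a
    program. *)
Definition spec A (c : prog R A) (P : A -> Prop) (b : nat) : Prop :=
  all_runs c (fun a t => (t <= b)%N /\ P a).

Lemma all_runs_mono A (c : prog R A) (P Q : A -> nat -> Prop) :
  (forall a t, P a t -> Q a t) -> all_runs c P -> all_runs c Q.
Proof.
elim: c P Q => [a|k f IH|o x y f IH|x y f IH|k c IH|k f IH|f IH|] P Q PQ //=.
- exact: PQ.
- by apply: IH => a t; apply: PQ.
- by case=> H1 H2; split=> //; apply: IH H2 => a t; apply: PQ.
- by apply: IH => a t; apply: PQ.
- by apply: IH => a t; apply: PQ.
- by case=> H1 H2; split=> // j /H2; apply: IH => a t; apply: PQ.
- by move=> H r /H; apply: IH => a t; apply: PQ.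
Qed.

Lemma all_runs_bind A B (c : prog R A) (k : A -> prog R B) Q :
  all_runs c (fun a t => all_runs (k a) (fun b t' => Q b (t + t')%N)) ->
  all_runs (bind c k) Q.
Proof.
elim: c Q => [a|m f IH|o x y f IH|x y f IH|m c IH|m f IH|f IH|] Q //=.
- by move=> H; apply: IH; apply: all_runs_mono H => a t /=.
- by case=> H1 H; split=> //; apply: IH; apply: all_runs_mono H => a t /=.
- by move=> H; apply: IH; apply: all_runs_mono H => a t /=.
- move=> H; apply: IH; apply: all_runs_mono H => a t /=.
  by apply: all_runs_mono => b t'; rewrite addnA.
- case=> H1 H; split=> // j jm; apply: IH.
  by apply: all_runs_mono (H j jm) => a t /=.
- by move=> H r r0; apply: IH; apply: all_runs_mono (H r r0) => a t /=.
Qed.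

Lemma spec_mono A (c : prog R A) (P Q : A -> Prop) b b' :
  spec c P b -> (b <= b')%N -> (forall a, P a -> Q a) -> spec c Q b'.
Proof.
move=> H bb' PQ; apply: all_runs_mono H => a t [tb Pa].
by split; [exact: leq_trans bb' | exact: PQ].
Qed.

Lemma spec_le A (c : prog R A) (P : A -> Prop) b b' :
  spec c P b -> (b <= b')%N -> spec c P b'.
Proof. by move=> H bb'; apply: spec_mono H bb' _. Qed.

Lemma spec_post A (c : prog R A) (P Q : A -> Prop) b :
  spec c P b -> (forall a, P a -> Q a) -> spec c Q b.
Proof. by move=> H; apply: spec_mono H (leqnn _). Qed.

Lemma spec_ret A (a : A) (P : A -> Prop) b : P a -> spec (Ret a) P b.
Proof. by []. Qed.

Lemma spec_ret0 A (a : A) (P : A -> Prop) : P a -> spec (Ret a) P 0.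
Proof. by []. Qed.

Lemma spec_bind A B (c : prog R A) (k : A -> prog R B) P Q b1 b2 :
  spec c P b1 -> (forall a, P a -> spec (k a) Q b2) ->
  spec (bind c k) Q (b1 + b2).
Proof.
move=> Hc Hk; apply: all_runs_bind; apply: all_runs_mono Hc => a t [tb1 Pa].
apply: all_runs_mono (Hk a Pa) => b t' [t'b2 Qb].
by split=> //; exact: leq_add.
Qed.

(** Adding the two budgets, rather than taking their maximum, keeps every bound a polynomial in the
    sizes. *)
Lemma spec_if A (c : bool) (p1 p2 : prog R A) Q b1 b2 :
  (c -> spec p1 Q b1) -> (~~ c -> spec p2 Q b2) ->
  spec (if c then p1 else p2) Q (b1 + b2).
Proof.
case: c => H1 H2; first by apply: spec_le (H1 isT) _; exact: leq_addr.
by apply: spec_le (H2 isT) _; exact: leq_addl.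
Qed.

Lemma spec_idx A k (c : prog R A) Q b : spec c Q b -> spec (Idx k c) Q (k + b).
Proof.
by apply: all_runs_mono => a t [tb Qa]; split=> //; rewrite leq_add2l.
Qed.

Lemma spec_lit k : spec (lit R k) (fun v => v = k%:R) 1.
Proof. by []. Qed.

Lemma spec_add x y : spec (add x y) (fun v : R => v = x + y) 1.
Proof. by []. Qed.

Lemma spec_sub x y : spec (sub x y) (fun v : R => v = x - y) 1.
Proof. by []. Qed.

Lemma spec_mul x y : spec (mul x y) (fun v : R => v = x * y) 1.
Proof. by []. Qed.

Lemma spec_div x y : y != 0 -> spec (div x y) (fun v : R => v = x / y) 1.
Proof. by []. Qed.

Lemma spec_opp x : spec (opp x) (fun v : R => v = - x) 2.
Proof. by do 2 split=> //; rewrite /= mulr0n sub0r. Qed.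

Lemma spec_eqv (x y : R) : spec (eqv x y) (fun b => b = (x == y)) 2.
Proof. by rewrite /spec /= eq_le; case: (x <= y) => /=. Qed.

Lemma spec_is0 (x : R) : spec (is0 x) (fun b => b = (x == 0)) 3.
Proof.
apply: (@spec_bind _ _ _ _ _ _ 1 2); first exact: spec_lit.
by move=> _ ->; exact: spec_eqv.
Qed.

Lemma spec_ge0 (x : R) : spec (ge0 x) (fun b => b = (0 <= x)) 2.
Proof. by []. Qed.

Lemma spec_le0 (x : R) : spec (le0 x) (fun b => b = (x <= 0)) 2.
Proof. by []. Qed.

Lemma spec_gt0 (x : R) : spec (gt0 x) (fun b => b = (0 < x)) 2.
Proof. by split=> //; rewrite ltNge. Qed.

Lemma spec_lt0 (x : R) : spec (lt0 x) (fun b => b = (x < 0)) 2.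
Proof. by split=> //; rewrite ltNge. Qed.

Lemma spec_abs (x : R) : spec (abs x) (fun v => v = `|x|) 4.
Proof.
apply: (@spec_bind _ _ _ _ _ _ 2 2); first exact: spec_ge0.
move=> _ ->; case: (lerP 0 x) => x0; first by split=> //; rewrite ger0_norm.
by apply: spec_post (spec_opp x) _ => _ ->; rewrite ltr0_norm.
Qed.

Lemma spec_max (x y : R) : spec (max x y) (fun v => v = Num.max x y) 1.
Proof. by split=> //; rewrite maxEle; case: ifP. Qed.

Lemma spec_min (x y : R) : spec (min x y) (fun v => v = Num.min x y) 1.
Proof. by split=> //; rewrite minEle; case: ifP. Qed.

Lemma spec_any (T : eqType) (a : T) s :
  spec (any R a s) (fun x => x \in a :: s) 1.
Proof. by split=> // j js; split=> //; exact: mem_nth. Qed.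

Lemma spec_AnyPos : spec (AnyPos Ret) (fun r : R => 0 < r) 1.
Proof. by []. Qed.

(** The splitting [s = t ++ a :: s'] records where the loop stands; together with uniqueness it
    shows that [a] is new, as the bordering of inverses and the gluing of blocks require. *)
Lemma spec_foldM_prefix T S (f : S -> T -> prog R S) z s
    (Inv : seq T -> S -> Prop) (w : T -> nat) :
  Inv [::] z ->
  (forall t a s' z, s = t ++ a :: s' -> Inv t z ->
     spec (f z a) (Inv (rcons t a)) (w a)) ->
  spec (foldM f z s) (Inv s) (\sum_(a <- s) w a).
Proof.
move=> Hz Hf; suff H s' t z' : s = t ++ s' -> Inv t z' ->
  spec (foldM f z' s') (Inv s) (\sum_(a <- s') w a)%N by exact: H Hz.
elim: s' t z' => [|a s' IH] t z' Es Hz' /=.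
  by rewrite cats0 in Es; rewrite Es; exact: spec_ret.
rewrite big_cons; apply: spec_bind (Hf _ _ _ _ Es Hz') _ => z'' Hz''.
by apply: IH Hz''; rewrite cat_rcons.
Qed.

Lemma spec_foldM (T : eqType) S (f : S -> T -> prog R S) z s
    (Inv : seq T -> S -> Prop) (w : T -> nat) :
  Inv [::] z ->
  (forall t a z, a \in s -> Inv t z -> spec (f z a) (Inv (rcons t a)) (w a)) ->
  spec (foldM f z s) (Inv s) (\sum_(a <- s) w a).
Proof.
move=> Hz Hf; apply: spec_foldM_prefix => // t a s' z' Es; apply: Hf.
by rewrite Es mem_cat mem_head orbT.
Qed.

Lemma spec_foldM_const (T : eqType) S (f : S -> T -> prog R S) z s
    (Inv : seq T -> S -> Prop) b :
  Inv [::] z ->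
  (forall t a z, a \in s -> Inv t z -> spec (f z a) (Inv (rcons t a)) b) ->
  spec (foldM f z s) (Inv s) (size s * b).
Proof.
move=> Hz Hf.
by have := spec_foldM Hz Hf; rewrite big_const_seq count_predT iter_addn_0 mulnC.
Qed.

Lemma spec_pmap T U (f : seq U -> T -> prog R (seq U)) (h : T -> option U) s b :
  (forall r a,
     spec (f r a) (fun r' => r' = if h a is Some v then rcons r v else r) b) ->
  spec (foldM f [::] s) (fun r => r = pmap h s) (size s * b).
Proof.
move=> Hf; apply: spec_le.
  apply: (@spec_foldM_prefix _ _ _ _ _ (fun t r => r = pmap h t) (fun=> b)) => //.
  move=> t a s' _ _ ->; apply: spec_post (Hf _ _) _ => _ ->.
  rewrite -cats1 pmap_cat /=; case: (h a) => [v|] /=; last by rewrite cats0.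
  by rewrite cats1.
by rewrite big_const_seq count_predT iter_addn_0 mulnC.
Qed.

Lemma spec_filterM T (f : T -> prog R bool) (p : pred T) s b :
  (forall a, spec (f a) (fun c => c = p a) b) ->
  spec (filterM f s) (fun r => r = filter p s) (size s * b).
Proof.
move=> Hf; have Hf' r a : spec (let* c := f a in Ret (if c then rcons r a else r))
      (fun r' => r' = if (if p a then Some a else None) is Some v
                      then rcons r v else r) b.
  rewrite -[b]addn0; apply: spec_bind (Hf a) _ => _ ->.
  by apply: spec_ret; case: (p a).
apply: spec_post (spec_pmap s Hf') _ => _ ->.
by elim: (s) => //= a t ->; case: (p a).
Qed.

Lemma spec_dot (T : eqType) s (f g : T -> R) :
  spec (dot s f g) (fun v => v = \sum_(i <- s) f i * g i) (2 * size s).+1.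
Proof.
rewrite /dot /sum -add1n; apply: spec_bind (spec_lit 0) _ => _ ->.
rewrite mulnC.
apply: (@spec_foldM_const _ _ _ _ _
          (fun t v => v = \sum_(i <- t) f i * g i)) => [|t a _ sa ->].
  by rewrite big_nil.
apply: (@spec_bind _ _ _ _ _ _ 1 1); first exact: spec_mul.
move=> _ ->; apply: spec_post (spec_add _ _) _ => _ ->.
by rewrite -cats1 big_cat big_seq1.
Qed.

(** The number [k] in [Inv k s] bounds the continuing rounds still to come; one more round is needed
    to return, whence [k.+1]. *)
Lemma spec_loop S B (step : S -> prog R (S + B)) (Inv : nat -> S -> Prop)
    (Q : B -> Prop) b k :
  (forall k s, Inv k s ->
     spec (step s) (fun r => match r with
                             | inl s' => exists2 k', (k' < k)%N & Inv k' s'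
                             | inr a => Q a end) b) ->
  forall s fuel, Inv k s -> (k < fuel)%N -> spec (loop fuel step s) Q (k.+1 * b).
Proof.
move=> Hstep; elim/ltn_ind: k => k IH s [//|fuel] Hs kf.
rewrite mulSn; apply: spec_bind (Hstep _ _ Hs) _ => -[s' [k' k'k Hs']|a Qa];
  last exact: spec_ret.
apply: spec_le (IH _ k'k _ _ Hs' _) _; first exact: leq_trans k'k _.
by rewrite leq_mul2r k'k orbT.
Qed.

Section Tab.
Variable n : nat.
Implicit Types S : seq 'I_n.

(** [P] is a relation because an entry need not be determined by its index: [find_d] fills a vector
    with arbitrary positive numbers. *)
Lemma spec_tab S (f : 'I_n -> prog R R) (P : 'I_n -> R -> Prop) b :
  (forall i, i \in S -> spec (f i) (P i) b) ->
  spec (tab S f) (fun x => forall i, i \in S -> P i (x i)) (size S * b).+1.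
Proof.
move=> Hf; rewrite /tab -add1n; apply: spec_bind (spec_lit 0) _ => z _.
apply: (@spec_foldM_const _ _ _ _ _
  (fun t x => forall i, i \in t -> P i (x i))) => // t i x iS Hx.
rewrite -[b]addn0; apply: spec_bind (Hf _ iS) _ => v Pv.
apply: spec_ret => j; rewrite mem_rcons in_cons /upd.
by case: eqP => [-> _|_ /= /Hx].
Qed.

Lemma spec_tab2 S S' (f : 'I_n -> 'I_n -> prog R R)
    (P : 'I_n -> 'I_n -> R -> Prop) b :
  (forall i j, i \in S -> j \in S' -> spec (f i j) (P i j) b) ->
  spec (tab2 S S' f)
    (fun X => forall i j, i \in S -> j \in S' -> P i j (X i j))
    (size S * (size S' * b).+1).+1.
Proof.
move=> Hf; rewrite /tab2 -add1n; apply: spec_bind (spec_lit 0) _ => z _.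
apply: (@spec_foldM_const _ _ _ _ _ (fun t X => forall i j,
  i \in t -> j \in S' -> P i j (X i j))) => // t i X iS HX.
rewrite -[_.+1]addn0.
apply: spec_bind (spec_tab (fun j jS' => Hf i j iS jS')) _ => r Pr.
apply: spec_ret => k j; rewrite mem_rcons in_cons /upd.
by case: eqP => [-> _|_ /= /HX]; [exact: Pr | apply].
Qed.

Lemma spec_mulmv (N : 'I_n -> 'I_n -> R) S S' x :
  spec (mulmv N S S' x)
    (fun y => forall i, i \in S -> y i = \sum_(j <- S') N i j * x j)
    (size S * (2 * size S').+1).+1.
Proof.
by apply: (@spec_tab _ _ (fun i v => v = _)) => i iS; exact: spec_dot.
Qed.

End Tab.
End Spec.

(** * Quadratic forms and generalized diagonal dominance *)


Section Matrices.
Variables (R : realFieldType) (I : eqType).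
Implicit Types (M N : I -> I -> R) (S T B : seq I) (x y z d W : I -> R).

Definition mv M S x i := \sum_(j <- S) M i j * x j.
Definition ip S x y := \sum_(i <- S) x i * y i.
Definition qf M S x := ip S x (mv M S x).
Definition symm M S := {in S &, forall i j, M i j = M j i}.
Definition psd M S := forall x, 0 <= qf M S x.
Definition posdef M S := forall x, qf M S x <= 0 -> {in S, forall i, x i = 0}.
Definition cmp M i j := if i == j then M i i else - `|M i j|.
(** Irreducibility as a propagation principle: [T] will be the set where a maximum is attained, or
    where a vector vanishes. *)
Definition irred M B := forall T : pred I, has T B ->
  {in B &, forall i j, T i -> ~~ T j -> M i j = 0} -> all T B.
(* Generalized diagonal dominance.  It implies that M and its comparison matrix are
   positive semidefinite, and it survives the reductions of the PPPA with the same
   [d]; this makes it the invariant of the recursion. *)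
Definition gdd M S d := {in S, forall i, 0 < d i /\ 0 <= mv (cmp M) S d i}.

Lemma sum_sub (B S : seq I) (F : I -> R) : uniq B -> uniq S -> {subset S <= B} ->
  (forall j, j \in B -> j \notin S -> F j = 0) ->
  \sum_(j <- B) F j = \sum_(j <- S) F j.
Proof.
move=> uB uS SB F0; rewrite (bigID (mem S)) /= [X in _ + X]big1_seq ?addr0; last first.
  by move=> j /andP[jS jB]; exact: F0.
rewrite -big_filter; apply: perm_big; apply: uniq_perm => //.
  exact: filter_uniq.
by move=> j; rewrite mem_filter; case jS: (j \in S); rewrite //= ?SB.
Qed.

Lemma sum_delta S (F : I -> R) i : uniq S -> i \in S ->
  \sum_(j <- S) F j * (j == i)%:R = F i.
Proof.
move=> uS iS; rewrite (bigD1_seq i) //= eqxx mulr1 big1 ?addr0 // => j /negPf ->.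
by rewrite mulr0.
Qed.

Lemma sum_rem S (F : I -> R) i : uniq S -> i \in S ->
  \sum_(j <- S) F j = F i + \sum_(j <- rem i S) F j.
Proof. by move=> uS iS; rewrite (perm_big _ (perm_to_rem iS)) big_cons. Qed.

Lemma eq_mv M N S x y i : {in S, M i =1 N i} -> {in S, x =1 y} ->
  mv M S x i = mv N S y i.
Proof. by move=> MN xy; apply: eq_big_seq => j jS; rewrite MN ?xy. Qed.

Lemma eq_ip S x y x' y' : {in S, x =1 x'} -> {in S, y =1 y'} ->
  ip S x y = ip S x' y'.
Proof. by move=> Hx Hy; apply: eq_big_seq => j jS; rewrite Hx ?Hy. Qed.

Lemma eq_qf M N S x y : {in S &, M =2 N} -> {in S, x =1 y} ->
  qf M S x = qf N S y.
Proof.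
move=> MN xy; apply: eq_ip => // i iS; apply: eq_mv => // j jS; exact: MN.
Qed.

Lemma eq_posdef M N S : {in S &, M =2 N} -> posdef M S -> posdef N S.
Proof. by move=> MN pM x; rewrite -(@eq_qf M _ _ x) //; exact: pM. Qed.

Lemma mvDZ M S x y t i :
  mv M S (fun j => x j + t * y j) i = mv M S x i + t * mv M S y i.
Proof.
by rewrite /mv mulr_sumr -big_split; apply: eq_bigr => j _ /=; ring.
Qed.

Lemma mvZ M S x t i : mv M S (fun j => t * x j) i = t * mv M S x i.
Proof. by rewrite /mv mulr_sumr; apply: eq_bigr => j _ /=; ring. Qed.

Lemma mvB M S x y i : mv M S (fun j => x j - y j) i = mv M S x i - mv M S y i.
Proof. by rewrite /mv -sumrB; apply: eq_bigr => j _ /=; ring. Qed.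

Lemma ipDr S x y z t :
  ip S z (fun j => x j + t * y j) = ip S z x + t * ip S z y.
Proof.
by rewrite /ip mulr_sumr -big_split; apply: eq_bigr => j _ /=; ring.
Qed.

Lemma ipC S x y : ip S x y = ip S y x.
Proof. by apply: eq_bigr => i _; rewrite mulrC. Qed.

Lemma ip_mv M S x y : symm M S -> ip S x (mv M S y) = ip S y (mv M S x).
Proof.
move=> sM; rewrite /ip /mv; under eq_bigr do rewrite mulr_sumr.
rewrite exchange_big /=; apply: eq_big_seq => i iS.
by rewrite mulr_sumr; apply: eq_big_seq => j jS; rewrite (sM j i) //; ring.
Qed.

Lemma qfDZ M S x y t : symm M S ->
  qf M S (fun j => x j + t * y j) =
  qf M S x + 2 * t * ip S y (mv M S x) + t ^+ 2 * qf M S y.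
Proof.
move=> sM; rewrite /qf -[LHS](@eq_ip _ (fun j => x j + t * y j)
  (fun i => mv M S x i + t * mv M S y i)) //; last by move=> i _; rewrite mvDZ.
rewrite ipDr ipC ipDr [X in _ + _ * X]ipC ipDr.
rewrite [ip S (mv M S x) x]ipC [ip S (mv M S x) y]ipC.
rewrite [ip S (mv M S y) x]ipC.
rewrite (ip_mv x y sM) [ip S (mv M S y) y]ipC; ring.
Qed.

Lemma symm_sub M S T : {subset T <= S} -> symm M S -> symm M T.
Proof. by move=> TS sM i j iT jT; apply: sM; exact: TS. Qed.

Lemma qf_sub M S T x : uniq S -> uniq T -> {subset T <= S} ->
  qf M T x = qf M S (fun i => if i \in T then x i else 0).
Proof.
move=> uS uT TS; rewrite /qf /ip [RHS](sum_sub uS uT TS); last first.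
  by move=> j _ /negPf ->; rewrite mul0r.
apply: eq_big_seq => i iT; rewrite iT; congr (_ * _).
rewrite /mv [RHS](sum_sub uS uT TS); last by move=> j _ /negPf ->; rewrite mulr0.
by apply: eq_big_seq => j ->.
Qed.

Lemma posdef_sub M S T : uniq S -> uniq T -> {subset T <= S} ->
  posdef M S -> posdef M T.
Proof.
move=> uS uT TS pM x; rewrite (qf_sub _ _ uS uT TS) => /pM H i iT.
by have := H i (TS _ iT); rewrite iT.
Qed.

Lemma psd_sub M S T : uniq S -> uniq T -> {subset T <= S} ->
  psd M S -> psd M T.
Proof. by move=> uS uT TS pM x; rewrite (qf_sub _ _ uS uT TS). Qed.

Lemma mv_delta M S i k : uniq S -> i \in S -> mv M S (fun j => (j == i)%:R) k = M k i.
Proof. by move=> uS iS; rewrite /mv sum_delta. Qed.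

Lemma psd_ker M S x : uniq S -> symm M S -> psd M S -> qf M S x <= 0 ->
  {in S, forall i, mv M S x i = 0}.
Proof.
move=> uS sM pM qx i iS; pose e j : R := (j == i)%:R.
have ipe y : ip S e y = y i.
  by rewrite ipC /ip sum_delta.
have qe : qf M S e = M i i by rewrite /qf ipe mv_delta.
have m0 : 0 <= M i i by rewrite -qe.
set b := mv M S x i; set m := M i i in m0 qe.
have m1 : 0 < m + 1 by lra.
(* The form is perturbed along the [i]th unit vector. The best step would be [- b / m]; the
   denominator [m + 1] also covers [m = 0]. *)
have := pM (fun j => x j + (- b / (m + 1)) * e j); rewrite qfDZ // ipe qe -/b => H.
have E : 2 * (- b / (m + 1)) * b + (- b / (m + 1)) ^+ 2 * m =
   - (b ^+ 2 * (m + 2)) / (m + 1) ^+ 2 by field; lra.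
have {}H : 0 <= - (b ^+ 2 * (m + 2)) / (m + 1) ^+ 2 by rewrite -E; lra.
move: H; rewrite pmulr_lge0 ?invr_gt0 ?exprn_gt0 // oppr_ge0 => H.
have : b ^+ 2 * (m + 2) == 0 by rewrite eq_le H mulr_ge0 ?sqr_ge0 //; lra.
by rewrite mulf_eq0 sqrf_eq0 => /orP[/eqP //|/eqP]; lra.
Qed.

(* AM-GM: [2 M_ij x_i x_j >= cmp_ij (d_j x_i^2 / d_i + d_i x_j^2 / d_j)], with
   equality for [i = j]. *)
Lemma gdd_psd M S d : symm M S -> gdd M S d -> psd M S.
Proof.
move=> sM gM x; pose F i j := cmp M i j * d j * (x i ^+ 2 / d i).
have F1 : 0 <= \sum_(i <- S) \sum_(j <- S) F i j.
  rewrite big_seq sumr_ge0 // => i /gM [di H].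
  by rewrite -mulr_suml mulr_ge0 ?divr_ge0 ?sqr_ge0 // ltW.
have F2 : \sum_(i <- S) \sum_(j <- S) F j i = \sum_(i <- S) \sum_(j <- S) F i j.
  by rewrite exchange_big.
suff : \sum_(i <- S) \sum_(j <- S) F i j + \sum_(i <- S) \sum_(j <- S) F j i
       <= 2 * qf M S x by rewrite F2; lra.
rewrite /qf /ip mulr_sumr -big_split /= big_seq [leRHS]big_seq.
apply: ler_sum => i iS; rewrite /mv mulr_sumr mulr_sumr -big_split /=.
rewrite big_seq [leRHS]big_seq; apply: ler_sum => j jS; rewrite /F /cmp eq_sym.
have [[di _] [dj _]] := (gM i iS, gM j jS).
case: eqVneq => [->|ij]; first by rewrite le_eqVlt; apply/orP; left; apply/eqP; field; lra.
rewrite (sM j i) //; set m := M i j.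
(* Here [s] will be the sign of [m]; the gap in the AM-GM inequality is then an explicit square. *)
have E (s : R) : s ^+ 2 = 1 -> `|m| * d j * (x i ^+ 2 / d i) + `|m| * d i * (x j ^+ 2 / d j)
   + 2 * (s * `|m| * (x i * x j)) = `|m| * (x i * d j + s * (x j * d i)) ^+ 2 / (d i * d j).
  move=> s2; transitivity (`|m| * ((x i * d j) ^+ 2 + 2 * s * x i * x j * d i * d j
    + s ^+ 2 * (x j * d i) ^+ 2) / (d i * d j)); last by congr (_ / _); ring.
  by rewrite s2; field; lra.
have G (s : R) : s ^+ 2 = 1 -> 0 <= `|m| * (x i * d j + s * (x j * d i)) ^+ 2 / (d i * d j).
  move=> _; apply: divr_ge0; last by apply: mulr_ge0; exact: ltW.
  by apply: mulr_ge0; [exact: normr_ge0 | exact: sqr_ge0].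
have [m0|m0] := lerP 0 m.
  have s2 : (1 : R) ^+ 2 = 1 by rewrite expr1n.
  by have := G _ s2; rewrite -(E _ s2) ger0_norm //; lra.
have s2 : (-1 : R) ^+ 2 = 1 by rewrite sqrrN expr1n.
by have := G _ s2; rewrite -(E _ s2) ltr0_norm //; lra.
Qed.

Lemma seq_argmax (B : seq I) (f : I -> R) : B != [::] ->
  exists2 i, i \in B & {in B, forall j, f j <= f i}.
Proof.
elim: B => // a [|b B] IH _.
  by exists a; rewrite ?mem_head // => j; rewrite mem_seq1 => /eqP ->.
have [//|i iB Hi] := IH; have [fia|fai] := lerP (f i) (f a).
  exists a; rewrite ?mem_head // => j; rewrite in_cons => /predU1P[->//|/Hi].
  by move=> H; exact: le_trans fia.
exists i; first by rewrite in_cons iB orbT.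
by move=> j; rewrite in_cons => /predU1P[->|/Hi //]; exact: ltW.
Qed.

Lemma cmp_sum M B d i : uniq B -> i \in B ->
  mv (cmp M) B d i = M i i * d i - \sum_(j <- rem i B) `|M i j| * d j.
Proof.
move=> uB iB; rewrite /mv (sum_rem _ uB iB) /cmp eqxx; congr (_ + _).
rewrite -sumrN; apply: eq_big_seq => j; rewrite mem_rem_uniq // inE eq_sym.
by case/andP => /negPf ->; rewrite mulNr.
Qed.

Lemma gdd_diag_ge0 M B d i : uniq B -> gdd M B d -> i \in B -> 0 <= M i i.
Proof.
move=> uB gM iB; have [di] := gM i iB; rewrite (cmp_sum _ _ uB iB) subr_ge0 => H.
rewrite -(pmulr_lge0 _ di); apply: le_trans H; rewrite big_seq sumr_ge0 // => j.
by move=> /mem_rem jB; have [dj _] := gM j jB; rewrite mulr_ge0 ?normr_ge0 // ltW.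
Qed.

(* Where [|W| / d] is maximal, row i of the product bounds [M_ii r d_i] by
   [\sum_(j != i) |M_ij| r d_j], so that the maximum propagates along the nonzero
   entries, hence to the whole irreducible block. *)
Lemma max_ratio M B d W r t : uniq B -> irred M B -> gdd M B d -> t < r ->
  0 < r ->
  {in B, forall j, `|W j| <= r * d j} -> (exists2 i, i \in B & `|W i| = r * d i) ->
  {in B, forall i, `|W i| = r * d i -> `|mv M B W i| <= t * mv (cmp M) B d i} ->
  {in B, forall i, `|W i| = r * d i /\ mv (cmp M) B d i = 0}.
Proof.
move=> uB iM gM tr r0 Wr [i0 i0B Wi0] HM.
pose T : pred I := fun i => `|W i| == r * d i.
have key i : i \in B -> T i -> mv (cmp M) B d i = 0 /\
    {in B, forall j, j != i -> M i j != 0 -> T j}.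
  move=> iB /eqP Ti; have := HM i iB Ti; have [di D0] := gM i iB.
  have mii := gdd_diag_ge0 uB gM iB.
  have Dc := cmp_sum M d uB iB.
  rewrite {1}/mv (sum_rem _ uB iB) => H.
  have H1 : M i i * (r * d i) <= t * mv (cmp M) B d i +
      \sum_(j <- rem i B) `|M i j| * `|W j|.
    rewrite -Ti -[M i i]ger0_norm // -normrM.
    set s := \sum_(j <- rem i B) M i j * W j in H.
    have : `|s| <= \sum_(j <- rem i B) `|M i j| * `|W j|.
      apply: le_trans (ler_norm_sum _ _ _) _.
      by apply: ler_sum => j _; rewrite normrM.
    have := ler_normB (M i i * W i + s) s.
    by rewrite addrK; lra.
  pose E j := `|M i j| * (r * d j - `|W j|).
  have E0 j : j \in rem i B -> 0 <= E j.
    by move=> /mem_rem jB; rewrite mulr_ge0 ?normr_ge0 // subr_ge0 Wr.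
  have EE : \sum_(j <- rem i B) E j = r * (\sum_(j <- rem i B) `|M i j| * d j)
      - \sum_(j <- rem i B) `|M i j| * `|W j|.
    by rewrite mulr_sumr -sumrB; apply: eq_bigr => j _; rewrite /E; ring.
  have sE0 : 0 <= \sum_(j <- rem i B) E j by rewrite big_seq sumr_ge0.
  (* Both summands are nonnegative, hence zero. The first gives equality in row i of the dominance,
     the second maximality at each neighbour of [i]. *)
  have rD : (r - t) * mv (cmp M) B d i + \sum_(j <- rem i B) E j <= 0.
    by rewrite EE; move: H1; rewrite Dc; lra.
  have D1 : 0 <= (r - t) * mv (cmp M) B d i by rewrite mulr_ge0 // subr_ge0 ltW.
  split.
    have : (r - t) * mv (cmp M) B d i == 0 by rewrite eq_le D1; lra.
    by rewrite mulf_eq0 subr_eq0 gt_eqF //= => /eqP.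
  move=> j jB ji Mij; have jr : j \in rem i B by rewrite mem_rem_uniq // inE ji.
  have : \sum_(j <- rem i B) E j == 0 by rewrite eq_le sE0; lra.
  rewrite big_seq psumr_eq0 // => /allP /(_ j jr) /implyP /(_ jr).
  by rewrite mulf_eq0 normr_eq0 (negPf Mij) subr_eq0 /= eq_sym.
have aT : all T B.
  apply: iM; first by apply/hasP; exists i0 => //; exact/eqP.
  move=> i j iB jB Ti nTj; apply: contraNeq nTj => Mij.
  have [ij|ij] := eqVneq j i; first by rewrite ij.
  by have [_ /(_ j jB ij Mij)] := key i iB Ti.
move=> i iB; have Ti := allP aT i iB; split; first exact/eqP.
by have [] := key i iB Ti.
Qed.

Lemma argmax_ratio B d W : B != [::] -> {in B, forall i, 0 < d i} ->
  exists i r, [/\ i \in B, `|W i| = r * d i, 0 <= r &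
                  {in B, forall j, `|W j| <= r * d j}].
Proof.
move=> B0 d0; have [i iB Hi] := seq_argmax (fun i => `|W i| / d i) B0.
exists i, (`|W i| / d i); split=> //.
- by rewrite divfK // gt_eqF ?d0.
- by rewrite divr_ge0 // ltW // d0.
- by move=> j jB; rewrite -ler_pdivrMr ?d0 // Hi.
Qed.

(** Semidefiniteness turns [qf M B x <= 0] into [M x = 0]. Then [max_ratio] with [W = x] and [t = 0]
    shows that a nonzero maximum of [|x| / d] is attained everywhere. *)
Lemma gdd_ker M B d x : uniq B -> symm M B -> irred M B -> gdd M B d ->
  qf M B x <= 0 -> {in B, forall i, x i = 0} \/
  {in B, forall i, [/\ x i != 0, mv M B x i = 0 & mv (cmp M) B d i = 0]}.
Proof.
move=> uB sM iM gM /(psd_ker uB sM (gdd_psd sM gM)) Mx.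
have [->|B0] := eqVneq B [::]; first by left.
have d0 i : i \in B -> 0 < d i by case/gM.
have [i [r [iB Hi r0 Hr]]] := argmax_ratio x B0 d0.
have [re|rn] := eqVneq r 0.
  by left=> j jB; apply/eqP; have := Hr j jB; rewrite re mul0r normr_le0.
have {rn} r1 : 0 < r by rewrite lt0r rn.
have maxH : {in B, forall i, `|x i| = r * d i -> `|mv M B x i| <= 0 * mv (cmp M) B d i}.
  by move=> j jB _; rewrite mul0r Mx // normr0.
have exi : exists2 i, i \in B & `|x i| = r * d i by exists i.
have all_max := max_ratio uB iM gM r1 r1 Hr exi maxH.
right=> j jB; have [Hj Dj] := all_max j jB; split=> //; last exact: Mx.
by rewrite -normr_gt0 Hj mulr_gt0 ?d0.
Qed.

(** Extended by zero, a vector on [T] vanishes at [i], which excludes the second alternative of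
    [gdd_ker]. *)
Lemma gdd_posdef M B d T i : uniq B -> symm M B -> irred M B -> gdd M B d ->
  uniq T -> {subset T <= B} -> i \in B -> i \notin T -> posdef M T.
Proof.
move=> uB sM iM gM uT TB iB iT x; rewrite (qf_sub _ _ uB uT TB) => qx j jT.
have [/(_ j (TB _ jT))|/(_ i iB)] := gdd_ker uB sM iM gM qx; first by rewrite jT.
by rewrite (negPf iT) eqxx => -[].
Qed.

(* the vector [p] of the PPPA *)
Definition ppv M B d i := (mv M B d i + mv (cmp M) B d i) / 2.

(* With [w = 2 y - d] on [T] and [w = - d] elsewhere, [M w = cmp M d] on [T];
   hence [|w| <= d]. *)
Lemma param_bounds M B d T y : uniq B -> symm M B -> irred M B -> gdd M B d ->
  uniq T -> {subset T <= B} -> posdef M T ->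
  {in T, forall i, mv M T y i = ppv M B d i} ->
  {in B, forall i, if i \in T then 0 <= y i else 0 <= ppv M B d i - mv M T y i}.
Proof.
move=> uB sM iM gM uT TB pT Hy.
have d0 i : i \in B -> 0 < d i by case/gM.
pose W i := if i \in T then 2 * y i - d i else - d i.
have MW i : i \in B -> mv M B W i = 2 * mv M T y i - mv M B d i.
  move=> iB; have E : mv M T (fun j => 2 * y j) i =
      \sum_(j <- B) M i j * (if j \in T then 2 * y j else 0).
    rewrite (sum_sub uB uT TB); first by apply: eq_big_seq => j ->.
    by move=> j _ /negPf ->; rewrite mulr0.
  rewrite -mvZ E /mv -sumrB; apply: eq_bigr => j _; rewrite /W.
  by case: ifP => _; ring.
have MW1 i : i \in T -> mv M B W i = mv (cmp M) B d i.
  by move=> iT; rewrite MW ?TB // Hy // /ppv; field.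
have Wd : {in B, forall i, `|W i| <= d i}.
  have [->//|B0] := eqVneq B [::].
  have [i [r [iB Hi r0 Hr]]] := argmax_ratio W B0 d0.
  (* Were [r > 1], the maximum could be attained only in [T], hence, by [max_ratio] with [t = 1], on
     all of [B]. Then [T] is the whole block, [M W = cmp M d = 0], and definiteness gives [W = 0], a
     contradiction. *)
  have [r1|r1] := lerP r 1.
    by move=> j jB; apply: le_trans (Hr j jB) _; rewrite ger_pMl ?d0.
  have inT j : j \in B -> `|W j| = r * d j -> j \in T.
    move=> jB; rewrite /W; case: ifP => // _; rewrite normrN gtr0_norm ?d0 // => E.
    have := d0 j jB; have : (r - 1) * d j = 0 by rewrite mulrBl -E; ring.
    by move/eqP; rewrite mulf_eq0 => /orP[/eqP|/eqP ->]; rewrite ?ltxx //; lra.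
  have all_max : {in B, forall i, `|W i| = r * d i /\ mv (cmp M) B d i = 0}.
    apply: (max_ratio (t := 1)) => //; first exact: lt_trans r1.
      by exists i.
    move=> j jB /(inT j jB) jT; rewrite mul1r MW1 // ger0_norm //.
    by have [] := gM j jB.
  have BT : {subset B <= T} by move=> j jB; apply: inT => //; case: (all_max j jB).
  have qW : qf M T W <= 0.
    rewrite (qf_sub M W uB uT TB) (@eq_qf _ M _ _ W) //; last by move=> j /BT ->.
    rewrite /qf /ip big1_seq // => j /andP[_ jB]; rewrite MW1 ?BT //.
    by have [_ ->] := all_max j jB; rewrite mulr0.
  have := pT _ qW i (BT _ iB) => W0; move: Hi; rewrite W0 normr0 => /esym/eqP.
  by rewrite mulf_eq0 !gt_eqF ?d0 //; exact: lt_trans r1.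
move=> i iB; case: ifP => iT.
  have := Wd i iB; rewrite /W iT ler_norml => /andP[H _]; lra.
have D0 : 0 <= mv (cmp M) B d i by have [] := gM i iB.
have := MW i iB; rewrite {1}/mv (sum_rem _ uB iB) {1}/W iT => E.
(* Since [W_i = - d_i] and [|W| <= d], row i of [M W] is at most minus row i of [cmp M d]. *)
have : \sum_(j <- rem i B) M i j * W j <= \sum_(j <- rem i B) `|M i j| * d j.
  rewrite big_seq [leRHS]big_seq; apply: ler_sum => j /mem_rem jB.
  apply: le_trans (ler_norm _) _; rewrite normrM.
  by rewrite ler_wpM2l ?normr_ge0 // Wd.
by have := cmp_sum M d uB iB; rewrite /ppv; lra.
Qed.

Lemma ppv_ge0 M B d i : uniq B -> symm M B -> irred M B -> gdd M B d ->
  i \in B -> 0 <= ppv M B d i.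
Proof.
move=> uB sM iM gM iB.
have := @param_bounds M B d [::] d uB sM iM gM isT.
move=> /(_ _ _ _ i iB); rewrite in_nil /mv big_nil subr0; apply => //.
Qed.

(** Dominance of row i gives [2 p_i >= \sum_(j != i) (M_ij + |M_ij|) d_j], a sum of nonnegative
    terms, which all vanish if [p_i <= 0]. *)
Lemma ppv_eq0 M B d i : uniq B -> gdd M B d -> i \in B -> ppv M B d i <= 0 ->
  {in B, forall j, j != i -> M i j <= 0}.
Proof.
move=> uB gM iB p0 j jB ji.
have jr : j \in rem i B by rewrite mem_rem_uniq // inE ji.
have [_ D0] := gM i iB; have Dc := cmp_sum M d uB iB.
have E0 k : k \in rem i B -> 0 <= (M i k + `|M i k|) * d k.
  move=> /mem_rem /gM [dk _]; apply: mulr_ge0; last exact: ltW.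
  by have := ler_norm (- M i k); rewrite normrN; lra.
have : \sum_(k <- rem i B) (M i k + `|M i k|) * d k <= 0.
  move: p0; rewrite /ppv {1}/mv (sum_rem _ uB iB).
  have -> : \sum_(k <- rem i B) (M i k + `|M i k|) * d k =
     \sum_(k <- rem i B) M i k * d k + \sum_(k <- rem i B) `|M i k| * d k.
    by rewrite -big_split; apply: eq_bigr => k _; rewrite /= mulrDl.
  lra.
move=> H; have : \sum_(k <- rem i B) (M i k + `|M i k|) * d k == 0.
  by rewrite eq_le H big_seq sumr_ge0.
rewrite big_seq psumr_eq0 // => /allP /(_ j jr) /implyP /(_ jr).
have [dj _] := gM j jB; rewrite mulf_eq0 (gt_eqF dj) orbF => /eqP.
by have := normr_ge0 (M i j); lra.
Qed.

(** A zero diagonal entry makes its whole row zero by dominance, and irreducibility then reduces the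
    block to [i]. *)
Lemma gdd_diag_gt0 M B d i : uniq B -> irred M B -> gdd M B d ->
  i \in B -> ~ (B = [:: i] /\ M i i = 0) -> 0 < M i i.
Proof.
move=> uB iM gM iB nz; rewrite lt0r (gdd_diag_ge0 uB gM iB) andbT.
apply/eqP => m0; apply: nz; split=> //.
have [di] := gM i iB; rewrite (cmp_sum _ _ uB iB) m0 mul0r sub0r oppr_ge0 => H.
have E0 k : k \in rem i B -> 0 <= `|M i k| * d k.
  by move=> /mem_rem /gM [dk _]; rewrite mulr_ge0 ?normr_ge0 // ltW.
have Mi0 j : j \in B -> j != i -> M i j = 0.
  move=> jB ji; have jr : j \in rem i B by rewrite mem_rem_uniq // inE ji.
  have : \sum_(k <- rem i B) `|M i k| * d k == 0 by rewrite eq_le H big_seq sumr_ge0.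
  rewrite big_seq psumr_eq0 // => /allP /(_ j jr) /implyP /(_ jr).
  by have [dj _] := gM j jB; rewrite mulf_eq0 (gt_eqF dj) orbF normr_eq0 => /eqP.
have /allP aB : all (pred1 i) B.
  apply: iM; first by apply/hasP; exists i => //=.
  by move=> a b aB bB /= /eqP -> bi; exact: Mi0.
have : perm_eq B [:: i].
  apply: uniq_perm => // j; rewrite mem_seq1; apply/idP/idP => [/aB//|/eqP ->//].
by move/perm_small_eq; apply.
Qed.

End Matrices.

(** * Inverses and comparison matrices *)


Section Inverse.
Variables (R : realFieldType) (I : eqType).
Implicit Types (M N : I -> I -> R) (a B : seq I) (x b c d : I -> R).

(** The symmetry of [N] turns this left inverse of a symmetric matrix into a right inverse, so that
    one product is enough. *)
Definition isinv M a N := {in a &, forall i j, N i j = N j i} /\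
  {in a &, forall i j, \sum_(k <- a) N i k * M k j = (i == j)%:R}.

Lemma isinv_l M a N x : uniq a -> isinv M a N ->
  {in a, forall i, mv N a (mv M a x) i = x i}.
Proof.
move=> ua [_ HN] i ia; rewrite /mv; under eq_bigr do rewrite mulr_sumr.
rewrite exchange_big /= -[RHS](sum_delta _ ua ia); apply: eq_big_seq => j ja.
under eq_bigr do rewrite mulrA.
by rewrite -mulr_suml HN // mulrC eq_sym.
Qed.

Lemma isinv_r M a N b : uniq a -> symm M a -> isinv M a N ->
  {in a, forall i, mv M a (mv N a b) i = b i}.
Proof.
move=> ua sM [sN HN] i ia; rewrite /mv; under eq_bigr do rewrite mulr_sumr.
rewrite exchange_big /= -[RHS](sum_delta _ ua ia); apply: eq_big_seq => j ja.
under eq_bigr do rewrite mulrA.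
rewrite -mulr_suml mulrC -HN //; congr (_ * _); apply: eq_big_seq => k ka.
by rewrite mulrC sN // sM.
Qed.

Lemma isinv_nil M N : isinv M [::] N.
Proof. by split=> i j; rewrite in_nil. Qed.

Lemma isinv_perm M a a' N : perm_eq a a' -> isinv M a N -> isinv M a' N.
Proof.
move=> aa' [sN HN]; split=> i j; rewrite -!(perm_mem aa') => ia ja.
  exact: sN.
by rewrite -(perm_big _ aa') HN.
Qed.

(** The Schur complement is the value of the form at the vector with entry 1 at [i] and [- c] on
    [a]. *)
Lemma schur_gt0 M a N i c : uniq (i :: a) -> symm M (i :: a) -> isinv M a N ->
  posdef M (i :: a) -> {in a, forall k, c k = mv N a (M^~ i) k} ->
  0 < M i i - mv M a c i.
Proof.
move=> /= /andP[ia ua] sM iN pM Hc; rewrite ltNge; apply/negP => s0.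
pose x k := if k == i then 1 else - c k.
have neq k : k \in a -> (k == i) = false.
  by move=> ka; apply/eqP => E; rewrite -E ka in ia.
have sMa := symm_sub (mem_subseq (subseq_cons a i)) sM.
have Mx k : mv M (i :: a) x k = M k i - mv M a c k.
  rewrite /mv big_cons {1}/x eqxx mulr1 -sumrN; congr (_ + _).
  by apply: eq_big_seq => j ja; rewrite /x neq // mulrN.
have : qf M (i :: a) x <= 0.
  rewrite /qf /ip big_cons Mx {1}/x eqxx mul1r big1_seq ?addr0 // => k /andP[_ ka].
  rewrite Mx (@eq_mv _ _ M M a c (mv N a (M^~ i)) k) // isinv_r // subrr.
  by rewrite mulr0.
by move=> /pM /(_ i (mem_head _ _)); rewrite /x eqxx => /eqP; rewrite oner_eq0.
Qed.

(** The block inverse formula. It rests on the two identities [c^T M_aa = M_ia] and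
    [c^T M_ai = M_ii - s]. *)
Lemma border_isinv M a N i c s N' : uniq (i :: a) -> symm M (i :: a) ->
  isinv M a N -> {in a, forall k, c k = mv N a (M^~ i) k} ->
  s = M i i - mv M a c i -> s != 0 ->
  {in i :: a &, forall k l, N' k l = if k == i then if l == i then s^-1 else - (c l / s)
     else if l == i then - (c k / s) else N k l + c k * c l / s} ->
  isinv M (i :: a) N'.
Proof.
move=> /= /andP[ia ua] sM [sN HN] Hc Es s0 HN'.
have neq k : k \in a -> (k == i) = false.
  by move=> ka; apply/eqP => E; rewrite -E ka in ia.
have inc k : k \in a -> k \in i :: a by move=> ka; rewrite in_cons ka orbT.
have i_in := mem_head i a.
have cM j : j \in a -> \sum_(l <- a) c l * M l j = M i j.
  move=> ja; transitivity (\sum_(l <- a) \sum_(m <- a) M m i * (N m l * M l j)).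
    apply: eq_big_seq => l la; rewrite Hc // mulr_suml; apply: eq_big_seq => m ma.
    by rewrite sN // mulrA (mulrC (N m l)).
  rewrite exchange_big /=; transitivity (\sum_(m <- a) M m i * (m == j)%:R).
    by apply: eq_big_seq => m ma; rewrite -mulr_sumr HN.
  by rewrite (sum_delta (M^~ i) ua ja) sM // inc.
have cMi : \sum_(l <- a) c l * M l i = M i i - s.
  rewrite Es opprB addrC subrK; apply: eq_big_seq => l la.
  by rewrite mulrC (sM l i) // inc.
have row k j : k \in a -> \sum_(l <- a) (N k l + c k * c l / s) * M l j =
    (\sum_(l <- a) N k l * M l j) + c k / s * \sum_(l <- a) c l * M l j.
  move=> ka; rewrite mulr_sumr -big_split; apply: eq_bigr => l _ /=.
  by rewrite mulrDl; congr (_ + _); ring.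
have rowi j : \sum_(l <- a) (- (c l / s)) * M l j = - s^-1 * \sum_(l <- a) c l * M l j.
  by rewrite mulr_sumr; apply: eq_bigr => l _; ring.
split=> k j.
  move=> kin jin; rewrite !HN' //; case: (eqVneq k i) => ki; case: (eqVneq j i) => ji //.
  have [ka ja] : k \in a /\ j \in a.
    by move: kin jin; rewrite !in_cons (negPf ki) (negPf ji).
  by rewrite sN // (mulrC (c k)).
move=> kin jin; rewrite big_cons HN' // eqxx.
case: (eqVneq k i) => [ki|ki].
  rewrite ki (eq_big_seq (fun l => - (c l / s) * M l j)); last first.
    by move=> l la; rewrite (HN' _ _ i_in (inc l la)) eqxx neq.
  rewrite rowi; case: (eqVneq j i) => [ji|ji].
    by rewrite ji cMi mulr1n; field.
  have ja : j \in a by move: jin; rewrite in_cons (negPf ji).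
  by rewrite cM // mulr0n; ring.
have ka : k \in a by move: kin; rewrite in_cons (negPf ki).
rewrite (eq_big_seq (fun l => (N k l + c k * c l / s) * M l j)); last first.
  by move=> l la; rewrite (HN' _ _ kin (inc l la)) !neq.
rewrite row //; case: (eqVneq j i) => [ji|ji].
  rewrite ji cMi.
  have -> : \sum_(l <- a) N k l * M l i = c k by rewrite Hc.
  by rewrite (negPf ki) mulr0n; field.
have ja : j \in a by move: jin; rewrite in_cons (negPf ji).
by rewrite cM // HN //; ring.
Qed.

(** [N_jj] is the value of the form at column j of [N], since [M] maps that column to a unit
    vector. *)
Lemma isinv_diag_gt0 M a N j : uniq a -> symm M a -> isinv M a N -> posdef M a ->
  j \in a -> 0 < N j j.
Proof.
move=> ua sM iN pM ja; rewrite ltNge; apply/negP => N0.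
pose e k : R := (k == j)%:R.
have Ne k : mv N a e k = N k j by rewrite /mv sum_delta.
have : qf M a (mv N a e) <= 0.
  rewrite /qf (@eq_ip _ _ a _ _ (N^~ j) e) //; last by move=> k ka; rewrite isinv_r.
  by rewrite /ip sum_delta.
move=> /pM H; have := isinv_r e ua sM iN ja.
rewrite {1}/mv big1_seq => [/eqP|k /andP[_ ka]]; last by rewrite H ?mulr0.
by rewrite /e eqxx eq_sym oner_eq0.
Qed.

(** The Schur complement of [N_jj] in [N] inverts the remaining part of [M]: the rank-one term
    cancels what column j contributed to the product. *)
Lemma unborder_isinv M a N j N' : uniq a -> isinv M a N -> j \in a -> N j j != 0 ->
  {in rem j a &, forall k l, N' k l = N k l - N k j * N j l / N j j} ->
  isinv M (rem j a) N'.
Proof.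
move=> ua [sN HN] ja Nj0 HN'.
have neq k : k \in rem j a -> (j == k) = false.
  by rewrite mem_rem_uniq // inE eq_sym => /andP[/negPf].
have inc k : k \in rem j a -> k \in a by exact: mem_rem.
split=> k l kin lin; have [ka la] := (inc k kin, inc l lin).
  by rewrite !HN' // (sN k l) // (sN k j) // (sN j l) // (mulrC (N j k)).
rewrite (eq_big_seq (fun m => (N k m - N k j * N j m / N j j) * M m l)); last first.
  by move=> m mr; rewrite HN'.
have E m : m \in a -> \sum_(m' <- rem j a) N m m' * M m' l = (m == l)%:R - N m j * M j l.
  by move=> ma; rewrite -(HN m l) // (sum_rem _ ua ja) addrC addKr.
transitivity ((\sum_(m <- rem j a) N k m * M m l)
    - N k j / N j j * (\sum_(m <- rem j a) N j m * M m l)).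
  rewrite mulr_sumr -sumrB; apply: eq_bigr => m _ /=.
  by rewrite mulrBl; congr (_ - _); ring.
rewrite !E // neq // mulr0n; field.
exact: Nj0.
Qed.

Lemma cmp_qf_abs M B x : qf (cmp M) B (fun i => `|x i|) <= qf (cmp M) B x.
Proof.
rewrite /qf /ip; apply: ler_sum => i _; rewrite /mv !mulr_sumr; apply: ler_sum => j _.
rewrite /cmp; case: eqVneq => [<-|_].
  rewrite (mulrC `|x i|) (mulrC (x i)) -!mulrA -!expr2.
  by rewrite real_normK ?num_real.
rewrite !mulNr !mulrN lerN2 (mulrCA (x i)) (mulrCA `|x i|) ler_wpM2l //.
by rewrite -normrM ler_norm.
Qed.

Lemma cmp_sym M B : symm M B -> symm (cmp M) B.
Proof.
by move=> sM i j iB jB; rewrite /cmp eq_sym; case: eqVneq => [->|_] //; rewrite sM.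
Qed.

(* The absolute value of a null vector is again a null vector, and for it all the
   terms of row i have the same sign. *)
Lemma psd_cmp_supp M B x : uniq B -> symm M B -> psd (cmp M) B ->
  qf (cmp M) B x <= 0 ->
  {in B &, forall i j, x i = 0 -> x j != 0 -> M i j = 0}.
Proof.
move=> uB sM pM qx i j iB jB xi xj.
have /(_ _ iB) := psd_ker uB (cmp_sym sM) pM (le_trans (cmp_qf_abs M B x) qx).
move=> /eqP; rewrite -oppr_eq0 /mv -sumrN big_seq psumr_eq0; last first.
  move=> k kB; rewrite /cmp; case: eqVneq => [<-|_]; first by rewrite xi normr0 mulr0 oppr0.
  by rewrite mulNr opprK mulr_ge0.
move=> /allP /(_ j jB) /implyP /(_ jB); rewrite oppr_eq0 mulf_eq0 normr_eq0 (negPf xj) orbF.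
rewrite /cmp; case: (eqVneq i j) => [E|_]; first by move: xj; rewrite -E xi eqxx.
by rewrite oppr_eq0 normr_eq0 => /eqP.
Qed.

(** No nonzero entry of [M] leads from a zero of [x] to a nonzero component, so irreducibility
    applies to the set of zeros. *)
Lemma psd_cmp_ker M B x : uniq B -> symm M B -> irred M B -> psd (cmp M) B ->
  qf (cmp M) B x <= 0 ->
  {in B, forall i, x i = 0} \/ {in B, forall i, x i != 0}.
Proof.
move=> uB sM iM pM qx; have [hT|nT] := boolP (has (fun i => x i == 0) B); last first.
  by right=> i iB; move/hasPn: nT => /(_ i iB).
left=> i iB; apply/eqP; move: i iB; apply/allP/iM => // i j iB jB /eqP xi xj.
exact: (psd_cmp_supp uB sM pM qx).
Qed.

Lemma psd_cmp_posdef M B T i : uniq B -> symm M B -> irred M B -> psd (cmp M) B ->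
  uniq T -> {subset T <= B} -> i \in B -> i \notin T -> posdef (cmp M) T.
Proof.
move=> uB sM iM pM uT TB iB iT x; rewrite (qf_sub _ _ uB uT TB) => qx j jT.
have [/(_ j (TB _ jT))|/(_ i iB)] := psd_cmp_ker uB sM iM pM qx; first by rewrite jT.
by rewrite (negPf iT) eqxx.
Qed.

(* [|d| - d] has a nonpositive form because [qf |d| <= qf d]. *)
Lemma cmp_neg_part M B d : uniq B -> symm M B ->
  {in B, forall i, 0 <= mv (cmp M) B d i} ->
  qf (cmp M) B (fun i => `|d i| - d i) <= 0.
Proof.
move=> uB sM Md; have sC := cmp_sym sM.
have := cmp_qf_abs M B d.
have E : {in B, (fun i => `|d i| - d i) =1 (fun i => `|d i| + (-1) * d i)}.
  by move=> i _; rewrite mulN1r.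
rewrite (eq_qf (N := cmp M) _ E) // qfDZ // (ip_mv d (fun i => `|d i|) sC) => H.
have : 0 <= ip B (fun i => `|d i|) (mv (cmp M) B d) - qf (cmp M) B d.
  rewrite /qf /ip -sumrB big_seq sumr_ge0 // => i iB; rewrite -mulrBl.
  by rewrite mulr_ge0 ?Md // subr_ge0 ler_norm.
lra.
Qed.

(** The null vector [|d| - d] vanishes at [l], hence everywhere, while [d] itself does not vanish at
    [l], hence nowhere. *)
Lemma cmp_ker_gt0 M B d l : uniq B -> symm M B -> irred M B -> psd (cmp M) B ->
  {in B, forall i, mv (cmp M) B d i = 0} -> l \in B -> 0 < d l ->
  {in B, forall i, 0 < d i}.
Proof.
move=> uB sM iM pM Md lB dl.
have qd : qf (cmp M) B d <= 0.
  by rewrite /qf /ip big1_seq // => i /andP[_ iB]; rewrite Md ?mulr0.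
have qy : qf (cmp M) B (fun i => `|d i| - d i) <= 0.
  by apply: cmp_neg_part => // i iB; rewrite Md.
have [H i iB|/(_ l lB)] := psd_cmp_ker uB sM iM pM qy; last first.
  by rewrite gtr0_norm // subrr eqxx.
have [|H'] := psd_cmp_ker uB sM iM pM qd.
  by move=> /(_ l lB) E; move: dl; rewrite E ltxx.
have := H i iB; have := H' i iB => di0 /eqP; rewrite subr_eq0 => /eqP <-.
by rewrite normr_gt0.
Qed.

(** Inverse positivity of a nonsingular M-matrix: definiteness forces [|d| = d], and [d_i = 0] would
    make row i of the product nonpositive. *)
Lemma cmp_pos_gt0 M B d : uniq B -> symm M B -> posdef (cmp M) B ->
  {in B, forall i, 0 < mv (cmp M) B d i} -> {in B, forall i, 0 < d i}.
Proof.
move=> uB sM pM Md i iB.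
have H : {in B, forall i, 0 <= d i}.
  move=> k kB; have /pM /(_ k kB) /eqP := cmp_neg_part uB sM (fun i iB => ltW (Md i iB)).
  by rewrite subr_eq0 => /eqP <-.
rewrite lt0r H // andbT; apply/eqP => di; have := Md i iB.
rewrite ltNge /mv -oppr_ge0 -sumrN big_seq sumr_ge0 // => j jB; rewrite /cmp.
case: eqVneq => [<-|_]; first by rewrite di mulr0 oppr0.
by rewrite mulNr opprK mulr_ge0 // H.
Qed.

End Inverse.

(** * Programs for linear algebra *)


Arguments bind : simpl never.
Arguments foldM : simpl never.

Section LinearPrograms.
Variables (R : realType) (n : nat).
Implicit Types (M N : 'I_n -> 'I_n -> R) (a S B : seq 'I_n) (x d p : 'I_n -> R).

Lemma spec_schur M a N i : spec (schur M a N i)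
  (fun cs => {in a, forall k, cs.1 k = mv N a (M^~ i) k} /\
             cs.2 = M i i - mv M a cs.1 i)
  (3 * ((size a).+1 * (size a).+1)).
Proof.
eapply spec_le.
  eapply spec_bind; first exact: spec_mulmv.
  move=> c Hc; eapply spec_bind; first exact: spec_dot.
  move=> _ ->; eapply spec_bind; first exact: spec_sub.
  by move=> _ ->; exact: spec_ret0.
move: (size a) => m; nia.
Qed.

Lemma spec_border M a N i : uniq (i :: a) -> symm M (i :: a) -> isinv M a N ->
  posdef M (i :: a) ->
  spec (border M a N i) (isinv M (i :: a)) (9 * ((size a).+1 * (size a).+1)).
Proof.
move=> uia sM iN pM; eapply spec_le.
  eapply spec_bind; first exact: spec_schur.
  move=> [c s] [/= Hc /= Hs].
  have s0 : s != 0 by rewrite gt_eqF // Hs; exact: schur_gt0 Hc.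
  eapply spec_post; last by move=> N'; exact: border_isinv uia sM iN Hc Hs s0.
  apply: (@spec_tab2 _ _ _ _ _ (fun k l v => v = _) 4) => k l _ _.
  apply: (@spec_bind _ _ _ _ _ _ _ 1 3); first exact: spec_lit.
  move=> _ ->; case: eqVneq => _; case: eqVneq => _.
  - by apply: spec_mono (spec_div _ s0) _ _ => // _ ->; rewrite div1r.
  - apply: (@spec_bind _ _ _ _ _ _ _ 1 2); first exact: spec_div.
    by move=> _ ->; exact: spec_opp.
  - apply: (@spec_bind _ _ _ _ _ _ _ 1 2); first exact: spec_div.
    by move=> _ ->; exact: spec_opp.
  - apply: (@spec_bind _ _ _ _ _ _ _ 1 2); first exact: spec_mul.
    move=> _ ->; apply: (@spec_bind _ _ _ _ _ _ _ 1 1); first exact: spec_div.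
    by move=> _ ->; exact: spec_add.
by rewrite /=; move: (size a) => m; lia.
Qed.

Lemma spec_unborder M a N j : uniq a -> symm M a -> isinv M a N -> posdef M a ->
  j \in a -> spec (unborder a N j) (isinv M (rem j a))
               (4 * ((size a).+1 * (size a).+1)).
Proof.
move=> ua sM iN pM ja; have Nj0 : N j j != 0.
  by rewrite gt_eqF // (isinv_diag_gt0 ua sM iN).
eapply spec_mono; last by move=> N'; exact: unborder_isinv ua iN ja Nj0.
  apply: (@spec_tab2 _ _ _ _ _ (fun k l v => v = _) 3) => k l _ _.
  apply: (@spec_bind _ _ _ _ _ _ _ 1 2); first exact: spec_mul.
  move=> _ ->; apply: (@spec_bind _ _ _ _ _ _ _ 1 1); first exact: spec_div.
  by move=> _ ->; exact: spec_sub.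
rewrite size_rem //; case: (size a) => [|s] /=; nia.
Qed.

(** One index is bordered at a time, at quadratic cost. The processed indices form the reversed
    prefix, which [isinv_perm] puts back in order. *)
Lemma spec_inverse M S : uniq S -> symm M S -> posdef M S ->
  spec (inverse M S) (isinv M S) (9 * (size S * size S * size S)).+1.
Proof.
move=> uS sM pM; rewrite /inverse.
rewrite -[_.+1]addn0 -[_.+1]add1n -addnA.
eapply spec_bind; first exact: (@spec_tab2 _ _ _ _ _ (fun _ _ _ => True) 0).
move=> N0 _.
apply: (@spec_bind _ _ _ _ _ (fun r => r.1 = rev S /\ isinv M (rev S) r.2)); last first.
  move=> r [_ Hr]; apply: spec_ret0; apply: isinv_perm Hr.
  by rewrite perm_rev.
apply: spec_le.
  apply: (@spec_foldM_prefix _ _ _ _ _ _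
    (fun t r => r.1 = rev t /\ isinv M (rev t) r.2)
    (fun=> 9 * (size S * size S))%N).
    by split=> //; exact: isinv_nil.
  move=> t i s' [a N] ES /= [-> iN].
  have sub : {subset i :: rev t <= S}.
    move=> j; rewrite ES mem_cat !in_cons mem_rev => /orP[->|->] //.
    by rewrite orbT.
  have u : uniq (i :: rev t).
    rewrite -rev_rcons rev_uniq -cats1; move: uS.
    by rewrite ES -cat1s catA cat_uniq => /andP[].
  rewrite -[(9 * _)%N]addn0; eapply spec_bind.
    apply: spec_le; first apply: (spec_border u (symm_sub sub sM) iN).
      exact: posdef_sub pM.
    by rewrite leq_mul2l /= size_rev ES size_cat /=; apply: leq_mul; lia.
  by move=> N' HN'; apply: spec_ret; rewrite rev_rcons.
by rewrite big_const_seq count_predT iter_addn_0 /=; lia.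
Qed.

End LinearPrograms.


(** * Decomposition into irreducible diagonal blocks *)

Section Blocks.
Variables (R : realType) (n : nat).
Implicit Types (M N : 'I_n -> 'I_n -> R) (a S B : seq 'I_n) (x d p : 'I_n -> R).

Definition is_blocks M S (Bs : seq (seq 'I_n)) := perm_eq (flatten Bs) S /\
  {in Bs, forall B, [/\ B != [::], uniq B, {subset B <= S}, irred M B &
    forall i j, i \in B -> j \in S -> j \notin B -> M i j = 0]}.

Lemma uniq_flatten (T : eqType) (ss : seq (seq T)) : uniq ss ->
  {in ss, forall s, uniq s} ->
  (forall s t (x : T), s \in ss -> t \in ss -> x \in s -> x \in t -> s = t) -> uniq (flatten ss).
Proof.
elim: ss => //= s ss IH /andP[sss uss] us dis.
rewrite cat_uniq us ?mem_head //= IH //; last 2 first.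
- by move=> t tss; apply: us; rewrite in_cons tss orbT.
- by move=> t t' x tss tss'; apply: dis; rewrite in_cons ?tss ?tss' orbT.
rewrite andbT; apply/hasPn => x /flattenP[t tss xt]; apply/negP => xs.
have st : s = t by apply: (dis s t x); rewrite ?mem_head // in_cons tss orbT.
by rewrite st tss in sss.
Qed.

(** The blocks are the connected components of the graph of nonzero entries; a set that no nonzero
    entry leaves is followed along a path to any other index of its component. *)
Lemma blocksP M S (e : rel 'I_n) : uniq S -> symm M S ->
  (forall i j, e i j = [&& i \in S, j \in S & M i j != 0]) ->
  is_blocks M S (undup [seq [seq j <- S | fingraph.connect e i j] | i <- S]).
Proof.
move=> uS sM He; have csym : fingraph.connect_sym e.
  apply: fingraph.sym_connect_sym => i j; rewrite !He.
  case iS: (i \in S); case jS: (j \in S) => //=.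
  by rewrite sM.
set Bs := undup _.
have BsP B : B \in Bs -> exists2 i, i \in S & B = [seq j <- S | fingraph.connect e i j].
  by rewrite mem_undup => /mapP.
have same i j : fingraph.connect e i j ->
    [seq k <- S | fingraph.connect e i k] = [seq k <- S | fingraph.connect e j k].
  by move=> ij; apply: eq_filter => k; rewrite (fingraph.same_connect csym ij).
split.
  apply: uniq_perm => //.
    apply: uniq_flatten; first exact: undup_uniq.
      by move=> B /BsP[i _ ->]; exact: filter_uniq.
    move=> _ _ k /BsP[i _ ->] /BsP[j _ ->].
    rewrite !mem_filter => /andP[ik _] /andP[jk _].
    by rewrite (same i k ik) (same j k jk).
  move=> i; apply/flattenP/idP => [[B /BsP[j _ ->]]|iS].
    by rewrite mem_filter => /andP[].
  exists [seq k <- S | fingraph.connect e i k].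
    by rewrite mem_undup; apply/mapP; exists i.
  by rewrite mem_filter iS fingraph.connect0.
move=> B /BsP[i iS EB].
have memB j : (j \in B) = fingraph.connect e i j && (j \in S) by rewrite EB mem_filter.
have iB : i \in B by rewrite memB iS fingraph.connect0.
split.
- by apply/eqP => B0; rewrite B0 in iB.
- by rewrite EB filter_uniq.
- by move=> j; rewrite memB => /andP[].
- move=> T /hasP[k kB Tk] sep; apply/allP => j jB.
  have : fingraph.connect e k j.
    by move: kB jB; rewrite !memB csym => /andP[ki _] /andP[ij _]; exact: fingraph.connect_trans ij.
  case/fingraph.connectP => p; elim: p k kB Tk => [|y p IH] k kB Tk /= => [_ -> //|].
  move=> /andP[eky pp] Ej.
  have yB : y \in B.
    move: kB eky; rewrite !memB He => /andP[ik kS] /and3P[_ yS Mky]; rewrite yS andbT.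
    by apply: fingraph.connect_trans ik _; apply: fingraph.connect1; rewrite He kS yS.
  apply: IH pp Ej => //; apply/negPn/negP => nTy.
  by move: eky; rewrite He (sep k y) // eqxx !andbF.
- move=> k j; rewrite !memB => /andP[ik kS] jS; rewrite jS andbT.
  apply: contraNeq => Mkj; apply: fingraph.connect_trans ik _.
  by apply: fingraph.connect1; rewrite He kS jS.
Qed.

Lemma spec_blocks M S : uniq S -> symm M S ->
  spec (blocks M S) (is_blocks M S) (4 * (size S * size S)).
Proof.
move=> uS sM; rewrite /blocks.
pose prs := [seq (i, j) | i <- S, j <- S].
apply: spec_le.
  apply: (@spec_bind _ _ _ _ _ (fun e => forall i j, e i j =
    ((i, j) \in prs) && (M i j != 0)) _ (size prs * 3)).
    apply: (@spec_foldM_const _ _ _ _ _ _ (fun t e => forall i j : 'I_n, e i j =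
      ((i, j) \in t) && (M i j != 0))) => // t [i j] e _ He.
    apply: (@spec_bind _ _ _ _ _ _ _ 3 0); first exact: spec_is0.
    move=> _ ->; apply: spec_ret0 => k l; rewrite mem_rcons in_cons.
    rewrite /=; have [Mij|Mij] := eqVneq (M i j) 0.
      rewrite He; case: ((k, l) =P (i, j)) => // -[-> ->].
      by rewrite Mij eqxx !andbF.
    by rewrite He; case: ((k, l) =P (i, j)) => // -[-> ->]; rewrite Mij.
  move=> e He; apply: spec_idx; apply: spec_ret0; apply: blocksP => // i j.
  by rewrite He andbA; congr (_ && _); apply/allpairsP/andP => [[[k l] /= [kS lS [-> ->]]]|[iS jS]] //; exists (i, j).
by rewrite /prs size_allpairs expnS expn1 /=; move: (size S) => s; nia.
Qed.

End Blocks.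


(** * The vectors [d] and [p] of the preparation *)

Section FindD.
Variables (R : realType) (n : nat).
Implicit Types (M N : 'I_n -> 'I_n -> R) (a S B : seq 'I_n) (x d p : 'I_n -> R).

Lemma spec_comparison M S : spec (comparison M S)
  (fun Mb => {in S &, forall i j, Mb i j = cmp M i j})
  (8 * (size S * size S)).+1.
Proof.
apply: spec_le.
  apply: (@spec_tab2 _ _ _ _ _ (fun i j v => v = cmp M i j) 6) => i j _ _.
  rewrite /cmp; case: eqVneq => [->|_]; first exact: spec_ret.
  apply: (@spec_bind _ _ _ _ _ _ _ 4 2); first exact: spec_abs.
  by move=> _ ->; exact: spec_opp.
by move: (size S) => s; nia.
Qed.

Lemma spec_find_d M B : uniq B -> B != [::] -> symm M B -> irred M B ->
  psd (cmp M) B ->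
  spec (find_d M B) (gdd M B) (40 * (size B * size B * size B)).
Proof.
case: B => // i0 B0 uB _ sM iM pM; rewrite /find_d.
set l := last i0 B0; set B' := belast i0 B0; set B := i0 :: B0 in uB sM iM pM *.
have ElB : perm_eq (l :: B') B by rewrite [B in perm_eq _ B]lastI perm_sym perm_rcons.
have sB : size B = (size B').+1 by rewrite /B' size_belast.
have ulB : uniq (l :: B') by rewrite (perm_uniq ElB).
have [/= lB' uB'] := andP ulB.
have memB i : (i \in B) = (i == l) || (i \in B') by rewrite -(perm_mem ElB) in_cons.
have lB : l \in B by rewrite memB eqxx.
have B'B : {subset B' <= B} by move=> i iB'; rewrite memB iB' orbT.
have neq i : i \in B' -> (i == l) = false.
  by move=> iB'; apply: contraNF lB' => /eqP <-.
have sumB (F : 'I_n -> R) : \sum_(j <- B) F j = F l + \sum_(j <- B') F j.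
  by rewrite -(perm_big _ ElB) big_cons.
have sC := cmp_sym sM.
apply: spec_le.
  apply: spec_bind; first exact: spec_comparison.
  move=> Mb HMb.
  have sMb : symm Mb B by move=> i j iB jB; rewrite !HMb // sC.
  have HMb' : {in B' &, Mb =2 cmp M} by move=> i j iB jB; rewrite HMb // B'B.
  have pB' : posdef Mb B'.
    apply: (@eq_posdef _ _ (cmp M)).
      by move=> i j iB jB; rewrite HMb'.
    exact: (psd_cmp_posdef uB sM iM pM uB' B'B lB lB').
  have sMb' : symm Mb B' := symm_sub B'B sMb.
  apply: spec_bind; first exact: spec_inverse.
  move=> N iN; apply: spec_bind; first exact: spec_mulmv.
  move=> c Hc; apply: spec_bind.
    apply: (@spec_tab _ _ _ _ (fun i v => v = - c i)) => i _; exact: spec_opp.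
  move=> d' Hd'; apply: spec_bind; first exact: spec_lit.
  move=> _ ->.
  set d := upd d' l 1%:R.
  have dl : d l = 1 by rewrite /d /upd eqxx.
  have dB' i : i \in B' -> d i = - c i by move=> iB'; rewrite /d /upd neq // Hd'.
  have Mdi i : i \in B -> mv (cmp M) B d i = Mb i l - mv Mb B' c i.
    move=> iB; rewrite /mv sumB dl mulr1 HMb // -sumrN; congr (_ + _).
    by apply: eq_big_seq => j jB'; rewrite HMb ?dB' ?mulrN // B'B.
  have Md0 i : i \in B' -> mv (cmp M) B d i = 0.
    move=> iB'; rewrite Mdi ?B'B // (@eq_mv _ _ Mb Mb B' c (mv N B' (Mb^~ l)) i) //.
    by rewrite isinv_r // subrr.
  apply: spec_bind; first exact: spec_dot.
  move=> t Et; have {}Et : t = mv (cmp M) B d l.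
    by rewrite Et; apply: eq_big_seq => j jB; rewrite HMb.
  apply: spec_bind; first exact: spec_is0.
  move=> _ ->; apply: (@spec_if _ _ _ _ _ _ 0).
    move=> /eqP t0; apply: spec_ret.
    have Md i : i \in B -> mv (cmp M) B d i = 0.
      by rewrite memB => /predU1P[->|/Md0//]; rewrite -Et.
    have d0 : {in B, forall i, 0 < d i}.
      by apply: (cmp_ker_gt0 uB sM iM pM Md lB); rewrite dl ltr01.
    by move=> i iB; rewrite d0 // Md.
  (* Write C for the comparison matrix. A null vector x of C satisfies
     [0 = d^T C x = x^T C d = x_l t], because [C d] vanishes off [l]; so [x_l = 0], and x is zero by
     [psd_cmp_ker]. *)
  move=> t0; have pMb : posdef Mb B.
    move=> x; rewrite (@eq_qf _ _ Mb (cmp M) B x x) // => qx i iB.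
    have [->//|/(_ l lB)] := psd_cmp_ker uB sM iM pM qx.
    have Mx := psd_ker uB sC pM qx.
    have := ip_mv x d sC; rewrite [X in _ = X]/ip big1_seq; last first.
      by move=> j /andP[_ jB]; rewrite Mx ?mulr0.
    rewrite /ip sumB big1_seq ?addr0 -?Et; last first.
      by move=> j /andP[_ jB]; rewrite Md0 ?mulr0.
    by move=> /eqP; rewrite mulf_eq0 (negPf t0) orbF => ->.
  have slB : {subset l :: B' <= B} by move=> i; rewrite (perm_mem ElB).
  apply: spec_bind.
    apply: spec_border => //; first exact: symm_sub sMb.
    exact: posdef_sub pMb.
  move=> N' /(isinv_perm ElB) iN'; apply: spec_bind.
    apply: (@spec_tab _ _ _ _ (fun _ v => 0 < v)) => i _; exact: spec_AnyPos.
  move=> r Hr; apply: spec_post; first exact: spec_mulmv.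
  move=> d2 Hd2.
  have Md2 i : i \in B -> mv (cmp M) B d2 i = r i.
    move=> iB; rewrite (@eq_mv _ _ (cmp M) Mb B d2 (mv N' B r) i) //; last first.
      by move=> j jB; rewrite HMb.
    by rewrite isinv_r.
  have d20 : {in B, forall i, 0 < d2 i}.
    apply: (cmp_pos_gt0 uB sM); last by move=> i iB; rewrite Md2 // Hr.
    exact: (@eq_posdef _ _ Mb (cmp M)).
  by move=> i iB; rewrite d20 // Md2 // ltW // Hr.
by rewrite sB /B' size_belast; move: (size B0) => s; nia.
Qed.

Lemma spec_find_p M B d : spec (find_p M d B)
  (fun p => {in B, forall i, p i = ppv M B d i})
  (20 * (size B * size B) + 10).
Proof.
apply: spec_le.
  apply: spec_bind; first exact: spec_comparison.
  move=> Mb HMb; apply: spec_bind.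
    apply: (@spec_tab2 _ _ _ _ _ (fun i j v => v = M i j + Mb i j)) => i j _ _.
    exact: spec_add.
  move=> A HA; apply: spec_bind; first exact: spec_mulmv.
  move=> v Hv; apply: spec_bind; first exact: spec_lit.
  move=> _ ->; apply: spec_post.
    apply: (@spec_tab _ _ _ _ (fun i w => w = v i / 2%:R)) => i _.
    by apply: spec_div; rewrite pnatr_eq0.
  move=> p Hp i iB; rewrite Hp // Hv // /ppv /mv -big_split; congr (_ / _).
  by apply: eq_big_seq => j jB; rewrite HA // HMb //= mulrDl.
by move: (size B) => s; nia.
Qed.

Lemma spec_upper (u : 'I_n -> option R) S : {in S, forall i, isSome (u i)} ->
  spec (upper u S) (fun x => {in S, forall i, u i = Some (x i)}) (size S).+1.
Proof.
move=> uS; rewrite -[size S]muln1.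
apply: (@spec_tab _ _ _ _ (fun i w => u i = Some w)) => i /uS.
by case: (u i) => // c _; exact: spec_ret.
Qed.

End FindD.

(** * Pivoting *)


Definition ub_le (R : realType) (b : option R) (v : R) : bool :=
  if b is Some c then v <= c else true.
Definition ub_lt (R : realType) (b : option R) (v : R) : bool :=
  if b is Some c then v < c else true.

Section Pivoting.
Variables (R : realType) (n : nat).
Implicit Types (M N : 'I_n -> 'I_n -> R) (a c S B : seq 'I_n).
Implicit Types (x d p q : 'I_n -> R) (u : 'I_n -> option R).

Definition grad M q S x i := q i + mv M S x i.

(** The multipliers of the two bounds are eliminated: they are the positive and negative parts of
    the gradient. *)
Definition kkt (P : qp R n) S x := {in S, forall i,
  [/\ 0 <= x i, ub_le (ub P i) (x i),
      0 < x i -> grad (mx P) (lin P) S x i <= 0 &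
      ub_lt (ub P i) (x i) -> 0 <= grad (mx P) (lin P) S x i]}.

Section Step.
Variables (M : 'I_n -> 'I_n -> R) (q : 'I_n -> R) (u : 'I_n -> option R).
Variables (B : seq 'I_n) (d p : 'I_n -> R).
Hypothesis uB : uniq B.
Hypothesis sM : symm M B.
Hypothesis iM : irred M B.
Hypothesis gM : gdd M B d.
Hypothesis Hp : {in B, forall i, p i = ppv M B d i}.
Hypothesis u0 : forall i v, u i = Some v -> 0 < v.

Definition pivot_basis a c N := [/\ uniq (a ++ c), {subset a ++ c <= B},
  posdef M a, isinv M a N & {in c, forall i, isSome (u i)}].

(* The point [x] solves the optimality conditions with [q + tau p] in place of
   [q]. *)
Definition pivot_point a c tau x := {in B, forall i,
  let g := grad M (fun j => q j + tau * p j) B x i in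
  if i \in a then [/\ g = 0, 0 <= x i & ub_le (u i) (x i)]
  else if i \in c then u i = Some (x i) /\ g <= 0
  else x i = 0 /\ 0 <= g}.

Section Residuals.
Variables (a c : seq 'I_n) (N : 'I_n -> 'I_n -> R) (ug g qa pa qb pb : 'I_n -> R).
Hypothesis basis : pivot_basis a c N.
Hypothesis Hug : {in c, forall i, u i = Some (ug i)}.
Hypothesis Hg : {in B, forall i, g i = q i + mv M c ug i}.
Hypothesis Hqa : {in a, forall i, qa i = mv N a g i}.
Hypothesis Hpa : {in a, forall i, pa i = mv N a p i}.
Hypothesis Hqb : {in B, forall i, qb i = if i \in a then qa i else g i - mv M a qa i}.
Hypothesis Hpb : {in B, forall i, pb i = if i \in a then pa i else p i - mv M a pa i}.

Definition pivot_x tau i :=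
  if i \in a then - (qb i + tau * pb i) else if i \in c then ug i else 0.

Let ua : uniq a. Proof. by case: basis; rewrite cat_uniq => /andP[]. Qed.
Let aB : {subset a <= B}.
Proof. by case: basis => _ H _ _ _ i ia; apply: H; rewrite mem_cat ia. Qed.
Let cB : {subset c <= B}.
Proof. by case: basis => _ H _ _ _ i ia; apply: H; rewrite mem_cat ia orbT. Qed.
Let c_a i : i \in c -> (i \in a) = false.
Proof.
case: basis => + _ _ _ _ ic; rewrite cat_uniq => /and3P[_ /hasPn /(_ i ic) H _].
exact: negPf.
Qed.

Lemma mv_basis x i : {in B, forall j, j \notin a -> j \notin c -> x j = 0} ->
  mv M B x i = mv M a x i + mv M c x i.
Proof.
case: basis => uac acB _ _ _ Hx; rewrite /mv -big_cat; apply: sum_sub => // j jB.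
by rewrite mem_cat negb_or => /andP[ja jc]; rewrite Hx ?mulr0.
Qed.

Lemma grad_pivot_x tau i : i \in B ->
  grad M (fun j => q j + tau * p j) B (pivot_x tau) i =
  if i \in a then 0 else qb i + tau * pb i.
Proof.
move=> iB; rewrite /grad mv_basis; last first.
  by move=> j jB; rewrite /pivot_x => /negPf -> /negPf ->.
have -> : mv M c (pivot_x tau) i = mv M c ug i.
  by apply: eq_mv => // j jc; rewrite /pivot_x c_a // jc.
have -> : mv M a (pivot_x tau) i = - (mv M a qa i + tau * mv M a pa i).
  rewrite -mvDZ -mulN1r -mvZ; apply: eq_mv => // j ja.
  by rewrite /pivot_x ja Hqb ?aB // Hpb ?aB // ja; ring.
case: ifP => ia; last by rewrite Hqb // Hpb // ia Hg //; ring.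
have [_ _ _ iN _] := basis; have sMa := symm_sub aB sM.
have -> : mv M a qa i = g i.
  by rewrite (@eq_mv _ _ M M a qa (mv N a g) i) // isinv_r.
have -> : mv M a pa i = p i.
  by rewrite (@eq_mv _ _ M M a pa (mv N a p) i) // isinv_r.
by rewrite Hg //; ring.
Qed.

(** As [M_aa] is invertible, the point inherited from the previous pivot may be replaced by the one
    computed from the current basis. *)
Lemma pivot_x_unique tau x : pivot_point a c tau x -> {in B, x =1 pivot_x tau}.
Proof.
move=> Hx i iB; have := Hx i iB; rewrite /= /pivot_x.
case: ifP => ia; last first.
  by case: ifP => ic [] //; rewrite Hug // => -[->].
move=> _; rewrite Hqb // Hpb // ia Hqa // Hpa //.
have [_ _ _ iN _] := basis; rewrite -(isinv_l x ua iN ia).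
rewrite -mvDZ -mulN1r -mvZ; apply: eq_mv => // j ja.
have := Hx j (aB ja); rewrite /= ja => -[+ _ _].
rewrite /grad mv_basis; last first.
  move=> k kB ka kc; have := Hx k kB.
  by rewrite /= (negPf ka) (negPf kc) => -[].
have -> : mv M c x j = mv M c ug j.
  apply: eq_mv => // k kc; have := Hx k (cB kc).
  by rewrite /= c_a // kc => -[+ _]; rewrite Hug // => -[->].
by rewrite Hg ?aB //; lra.
Qed.

(** This is [param_bounds] with [T = a] and [y = pa]. *)
Lemma pb_ge0 : {in B, forall i, 0 <= pb i}.
Proof.
case: basis => _ _ pM iN _ i iB; have sMa := symm_sub aB sM.
have := @param_bounds _ _ M B d a pa uB sM iM gM ua aB pM.
move=> /(_ _ i iB); rewrite Hpb //; case: ifP => ia; rewrite -?Hp //; apply.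
  move=> j ja; rewrite -Hp ?aB // -(isinv_r p ua sMa iN ja).
  by apply: eq_mv => // k /Hpa.
move=> j ja; rewrite -Hp ?aB // -(isinv_r p ua sMa iN ja).
by apply: eq_mv => // k /Hpa.
Qed.

(** Since [pb >= 0], lower bounds on [a] and signs on [c] persist when tau decreases; the ratio
    tests guard upper bounds on [a] and signs elsewhere. An index with [pb i = 0] escapes the tests
    because its value does not depend on tau. *)
Lemma pivot_descend tau tau' x : pivot_point a c tau x -> tau' <= tau ->
  {in B, forall i, i \notin a -> i \notin c -> 0 < pb i -> - (qb i / pb i) <= tau'} ->
  {in a, forall i v, u i = Some v -> 0 < pb i -> - ((v + qb i) / pb i) <= tau'} ->
  pivot_point a c tau' (pivot_x tau').
Proof.
move=> Hx tt' Hb Hu i iB; have p0 := pb_ge0 iB.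
have tp : tau' * pb i <= tau * pb i by rewrite ler_wpM2r.
have /= := Hx i iB; rewrite (grad_pivot_x _ iB).
have Ex := pivot_x_unique Hx iB.
have Eg : grad M (fun j => q j + tau * p j) B x i =
          grad M (fun j => q j + tau * p j) B (pivot_x tau) i.
  by congr (_ + _); apply: eq_mv => // j jB; exact: pivot_x_unique.
rewrite Eg Ex grad_pivot_x // /pivot_x.
case: ifP => ia.
  rewrite ia => -[_ x0 xu]; split=> //; first by lra.
  move: xu; have := Hu i ia; case: (u i) => //= v /(_ v erefl) Hv xv.
  have [p1|pn] := ltrP 0 (pb i).
    have := Hv p1; rewrite lerNl -(ler_pM2r p1) divfK ?gt_eqF // mulNr; lra.
  have pe : pb i = 0 by lra.
  by move: xv; rewrite pe !mulr0.
rewrite ia; case: ifP => ic.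
  by rewrite ic => -[uc H]; split=> //; lra.
rewrite ic => -[_ H]; split=> //; have [p1|pn] := ltrP 0 (pb i); last first.
  have pe : pb i = 0 by lra.
  by move: H; rewrite pe !mulr0.
have := Hb i iB (negbT ia) (negbT ic) p1.
by rewrite lerNl -(ler_pM2r p1) mulNr divfK ?gt_eqF //; lra.
Qed.

End Residuals.

Lemma pivot_point_kkt a c x : pivot_point a c 0 x -> kkt (QP M q u) B x.
Proof.
move=> Hx i iB; have := Hx i iB; rewrite /= /grad mul0r addr0.
case: ifP => _; first by case=> -> x0 xu; split.
case: ifP => _ [].
  move=> Eu g0; rewrite /ub_le /ub_lt Eu lexx ltxx; split=> //.
  by rewrite ltW // (u0 Eu).
move=> -> g0; rewrite ltxx; split=> //.
by case Eu: (u i) => [v|] //=; rewrite ltW // (u0 Eu).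
Qed.

(* If [M_{a+i}] had a null vector [z], then [a + i] would be the whole block and
   [cmp M d = 0], so that [0 = z^T p = z_i pbar_i]. *)
Lemma pivot_posdef a N pa i : uniq (i :: a) -> {subset i :: a <= B} ->
  isinv M a N -> {in a, forall j, pa j = mv N a p j} ->
  0 < p i - mv M a pa i -> posdef M (i :: a).
Proof.
move=> uia sub iN Hpa pi0; have [/= ia ua] := andP uia.
have aB : {subset a <= B} by move=> j ja; apply: sub; rewrite in_cons ja orbT.
have sMa := symm_sub aB sM.
have iB : i \in B by apply: sub; rewrite mem_head.
have [[j jB jia]|full] : (exists2 j, j \in B & j \notin i :: a) \/ {subset B <= i :: a}.
  have [/allP H|/allPn[j jB H]] := boolP (all (mem (i :: a)) B); first by right.
  by left; exists j.
  exact: (gdd_posdef uB sM iM gM uia sub jB jia).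
move=> z; rewrite (qf_sub _ _ uB uia sub) (@eq_qf _ _ M M B _ z) //; last first.
  by move=> j jB; rewrite full.
move=> qz j jia; have [->//|H] := gdd_ker uB sM iM gM qz; first exact: sub.
have pe : perm_eq (i :: a) B.
  by apply: uniq_perm => // k; apply/idP/idP => [/sub|/full].
have zp : ip B z p = 0.
  rewrite (@eq_ip _ _ B z p z (fun k => 2^-1 * mv M B d k + 0 * p k)) //; last first.
    by move=> k kB; rewrite Hp // /ppv; have [_ _ ->] := H k kB; ring.
  rewrite ipDr mul0r addr0 /ip.
  under eq_bigr do rewrite mulrCA.
  rewrite -mulr_sumr -/(ip B z (mv M B d)) ip_mv // /ip big1_seq ?mulr0 //.
  by move=> k /andP[_ kB]; have [_ -> _] := H k kB; rewrite mulr0.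
pose y k := if k \in a then pa k else 0.
have My k : mv M B y k = mv M a pa k.
  rewrite /mv (sum_sub uB ua aB); last by move=> l _ /negPf; rewrite /y => ->; rewrite mulr0.
  by apply: eq_big_seq => l la; rewrite /y la.
have zMy : ip B z (mv M B y) = 0.
  rewrite ip_mv // /ip big1_seq // => k /andP[_ kB].
  by have [_ -> _] := H k kB; rewrite mulr0.
(* The vector [p - M y] vanishes on [a], so that only the term of [i] survives. *)
have : ip B z (fun k => p k + (-1) * mv M B y k) = 0 by rewrite ipDr zp zMy mulr0 addr0.
rewrite /ip -(perm_big _ pe) big_cons big1_seq; last first.
  move=> k /andP[_ ka]; rewrite My (@eq_mv _ _ M M a pa (mv N a p) k) //.
  by rewrite isinv_r // mulN1r subrr mulr0.
rewrite My mulN1r /= addr0 => /eqP; rewrite mulf_eq0 [X in _ || X]gt_eqF // orbF => /eqP zi.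
by have [] := H i iB; rewrite zi eqxx.
Qed.

End Step.
End Pivoting.


Lemma spec_fold_max (R : realType) (T : eqType) (f : T -> R) (z : R) s :
  spec (foldM (fun m r => max m (f r)) z s)
    (fun t => [/\ z <= t, {in s, forall r, f r <= t} &
                  t = z \/ exists2 r, r \in s & t = f r]) (size s).
Proof.
rewrite -[size s]muln1.
apply: (@spec_foldM_const _ _ _ _ _ _ (fun s t => [/\ z <= t,
  {in s, forall r, f r <= t} & t = z \/ exists2 r, r \in s & t = f r])).
  by split=> //; left.
move=> s' a m _ [zm Hm Em]; apply: spec_post (spec_max _ _) _ => _ ->.
have [am|ma] := leP m (f a).
  split; first exact: le_trans am.
    by move=> r; rewrite mem_rcons in_cons => /predU1P[->//|/Hm/le_trans]; apply.
  by right; exists a; rewrite ?mem_rcons ?mem_head.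
split=> //.
  by move=> r; rewrite mem_rcons in_cons => /predU1P[->|/Hm//]; exact: ltW.
case: Em => [->|[r rs ->]]; [by left|right; exists r => //].
by rewrite mem_rcons in_cons rs orbT.
Qed.

(** With weights 2, 1 and 0 for the indices of beta, alpha and gamma, [k] is the total weight; every
    move lowers it by one. *)
Lemma leave_measure k a c b : (0 < a -> k + a + 2 * c = 2 * b -> a + c <= b ->
  k - 1 < k /\ k - 1 + a.-1 + 2 * c.+1 = 2 * b)%N.
Proof. by lia. Qed.

Lemma enter_measure k a c b : (k + a + 2 * c = 2 * b -> (a + c).+1 <= b ->
  k - 1 < k /\ k - 1 + a.+1 + 2 * c = 2 * b)%N.
Proof. by lia. Qed.

Section Pivoting.
Variables (R : realType) (n : nat).
Implicit Types (N : 'I_n -> 'I_n -> R) (a c S : seq 'I_n).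
Variables (M : 'I_n -> 'I_n -> R) (q : 'I_n -> R) (u : 'I_n -> option R).
Variables (B : seq 'I_n) (d p : 'I_n -> R).
Hypothesis uB : uniq B.
Hypothesis sM : symm M B.
Hypothesis iM : irred M B.
Hypothesis gM : gdd M B d.
Hypothesis Hp : {in B, forall i, p i = ppv M B d i}.
Hypothesis u0 : forall i v, u i = Some v -> 0 < v.

Definition pivot_inv k (st : pivot_state R n) := exists tau x,
  [/\ 0 <= tau, pivot_basis M u B (pa st) (pg st) (pinv st),
      pivot_point M q u B p (pa st) (pg st) tau x &
      (k + size (pa st) + 2 * size (pg st) = 2 * size B)%N].

(** At a breakpoint the same [x] satisfies the conditions of the old and of the new basis: here
    [x_i] has reached its upper bound with zero gradient, in [pivot_enter] the gradient has reached
    zero with [x_i = 0]. *)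
Lemma pivot_leave a c N tau x i v N' :
  pivot_basis M u B a c N -> pivot_point M q u B p a c tau x ->
  i \in a -> u i = Some v -> x i = v -> isinv M (rem i a) N' ->
  pivot_basis M u B (rem i a) (i :: c) N' /\
  pivot_point M q u B p (rem i a) (i :: c) tau x.
Proof.
move=> [uac acB pM iN uc] Hx ia ui xi iN'.
have ua : uniq a by move: uac; rewrite cat_uniq => /andP[].
have pe : perm_eq (rem i a ++ i :: c) (a ++ c).
  rewrite -cat_rcons perm_cat2r perm_sym.
  by rewrite (permPl (perm_to_rem ia)) perm_sym perm_rcons.
split.
  split=> //.
  - by rewrite (perm_uniq pe).
  - by move=> j; rewrite (perm_mem pe) => /acB.
  - by apply: (posdef_sub ua _ _ pM); [exact: rem_uniq | exact: mem_rem].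
  - by move=> j; rewrite in_cons => /predU1P[->|/uc//]; rewrite ui.
move=> j jB; have := Hx j jB; rewrite /= mem_rem_uniq // inE in_cons.
have [->|ji] := eqVneq j i; first by rewrite ia /= => -[-> _ _]; rewrite ui xi.
by [].
Qed.

Lemma pivot_enter a c N tau x i N' :
  pivot_basis M u B a c N -> pivot_point M q u B p a c tau x ->
  i \in B -> i \notin a -> i \notin c ->
  grad M (fun j => q j + tau * p j) B x i = 0 ->
  posdef M (i :: a) -> isinv M (i :: a) N' ->
  pivot_basis M u B (i :: a) c N' /\ pivot_point M q u B p (i :: a) c tau x.
Proof.
move=> [uac acB pM iN uc] Hx iB ia ic gi pM' iN'.
split.
  split=> //.
  - by rewrite cat_cons /= mem_cat negb_or ia ic.
  - by move=> j; rewrite cat_cons in_cons => /predU1P[->|/acB].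
move=> j jB; have := Hx j jB; rewrite /= in_cons.
have [->|ji] := eqVneq j i; last by [].
rewrite (negPf ia) (negPf ic) /= => -[xi _]; rewrite xi lexx; split=> //.
by case Eu: (u i) => [v|] //=; rewrite ltW // (u0 Eu).
Qed.

Lemma spec_pivot_step k st : pivot_inv k st ->
  spec (pivot_step (QP M q u) p B st) (fun r => match r with
    | inl st' => exists2 k', (k' < k)%N & pivot_inv k' st'
    | inr y => exists2 x, y = Some x & kkt (QP M q u) B x
    end) (100 * ((size B).+1 * (size B).+1)).
Proof.
case: st => a c N [tau0 [x [/= tau00 basis Hx Ek]]]; rewrite /pivot_step.
set bt := [seq i <- B | _].
have [uac acB pM iN uc] := basis.
have [ua [c_a _]] : uniq a /\ ~~ has (mem a) c /\ uniq c.
  by move: uac; rewrite cat_uniq => /and3P[].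
have aB : {subset a <= B} by move=> i ia; apply: acB; rewrite mem_cat ia.
have cB : {subset c <= B} by move=> i ia; apply: acB; rewrite mem_cat ia orbT.
have c_a' i : i \in c -> i \notin a by move=> ic; exact: (hasPn c_a).
have sMa := symm_sub aB sM.
have size_ac : (size a + size c <= size B)%N.
  by rewrite -size_cat; apply: uniq_leq_size.
have size_bt : (size bt <= size B)%N by rewrite size_filter count_size.
have btP i : (i \in bt) = [&& i \in B, i \notin a & i \notin c].
  by rewrite mem_filter andbC.
have dlB i : i \in B -> i \notin a -> i \in bt ++ c.
  by move=> iB ia; rewrite mem_cat btP iB ia /= orNb.
apply: spec_le.
  apply: spec_bind; first exact: spec_upper uc.
  move=> ug Hug; apply: spec_bind.
    apply: (@spec_tab _ _ _ _ (fun i v => v = q i + mv M c ug i)) => i _.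
    apply: spec_bind; first exact: spec_dot.
    by move=> _ ->; exact: spec_add.
  move=> g Hg; apply: spec_bind; first exact: spec_mulmv.
  move=> qa Hqa; apply: spec_bind; first exact: spec_mulmv.
  move=> pa Hpa; apply: spec_bind.
    apply: (@spec_tab _ _ _ _ (fun i v => v = g i - mv M a qa i)) => i _.
    apply: spec_bind; first exact: spec_dot.
    by move=> _ ->; exact: spec_sub.
  move=> qd Hqd; apply: spec_bind.
    apply: (@spec_tab _ _ _ _ (fun i v => v = p i - mv M a pa i)) => i _.
    apply: spec_bind; first exact: spec_dot.
    by move=> _ ->; exact: spec_sub.
  move=> pd Hpd.
  set qb := glue a qa qd; set pb := glue a pa pd.
  have Hqb : {in B, forall i, qb i = if i \in a then qa i else g i - mv M a qa i}.
    move=> i iB; rewrite /qb /glue; case: ifP => // /negbT ia.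
    by rewrite Hqd // dlB.
  have Hpb : {in B, forall i, pb i = if i \in a then pa i else p i - mv M a pa i}.
    move=> i iB; rewrite /pb /glue; case: ifP => // /negbT ia.
    by rewrite Hpd // dlB.
  apply: spec_bind.
    apply: (@spec_pmap _ _ _ _
      (fun i => if 0 < pb i then Some (i, - (qb i / pb i)) else None) _ 5).
    move=> r i; apply: (@spec_bind _ _ _ _ _ _ _ 2 3); first exact: spec_gt0.
    move=> _ ->; case: ifP => [pbi|_]; last exact: spec_ret.
    apply: (@spec_bind _ _ _ _ _ _ _ 1 2); first by apply: spec_div; rewrite gt_eqF.
    move=> _ ->; apply: (@spec_bind _ _ _ _ _ _ _ 2 0); first exact: spec_opp.
    by move=> _ ->; exact: spec_ret.
  move=> r0 Er0; apply: spec_bind.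
    apply: (@spec_pmap _ _ _ _
      (fun i => if u i is Some v then if 0 < pb i then Some (i, - ((v + qb i) / pb i))
                else None else None) _ 6).
    move=> r i; case: (u i) => [v|]; last exact: spec_ret.
    apply: (@spec_bind _ _ _ _ _ _ _ 2 4); first exact: spec_gt0.
    move=> _ ->; case: ifP => [pbi|_]; last exact: spec_ret.
    apply: (@spec_bind _ _ _ _ _ _ _ 1 3); first exact: spec_add.
    move=> _ ->.
    apply: (@spec_bind _ _ _ _ _ _ _ 1 2); first by apply: spec_div; rewrite gt_eqF.
    move=> _ ->; apply: (@spec_bind _ _ _ _ _ _ _ 2 0); first exact: spec_opp.
    by move=> _ ->; exact: spec_ret.
  move=> ru Eru.
  have size_r : (size (r0 ++ ru) <= size B + size B)%N.
    rewrite size_cat Er0 Eru !size_pmap; apply: leq_add.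
      exact: leq_trans (count_size _ _) size_bt.
    exact: leq_trans (count_size _ _) (leq_trans (leq_addr _ _) size_ac).
  have r0P i v : ((i, v) \in r0) = [&& i \in bt, 0 < pb i & v == - (qb i / pb i)].
    rewrite Er0 mem_pmap; apply/mapP/and3P => [[j jb]|[ib pbi /eqP ->]].
      by case: ifP => // pbj [-> ->].
    by exists i => //; rewrite pbi.
  have ruP i v : ((i, v) \in ru) -> i \in a /\ exists w,
      [/\ u i = Some w, 0 < pb i & v = - ((w + qb i) / pb i)].
    rewrite Eru mem_pmap => /mapP[j ja].
    case Eu: (u j) => [w|//]; case: ifP => // pbj [-> ->].
    by split=> //; exists w.
  have ruI i w : i \in a -> u i = Some w -> 0 < pb i -> (i, - ((w + qb i) / pb i)) \in ru.
    by move=> ia ui pbi; rewrite Eru mem_pmap; apply/mapP; exists i; rewrite // ui pbi.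
  have Ux := pivot_x_unique uB basis Hug Hg Hqa Hpa Hqb Hpb Hx.
  have G := grad_pivot_x uB sM basis Hg Hqa Hpa Hqb Hpb.
  have D := pivot_descend uB sM iM gM Hp basis Hug Hg Hqa Hpa Hqb Hpb Hx.
  apply: spec_bind; first exact: spec_lit.
  move=> _ ->; apply: spec_bind.
    apply: spec_le; first exact: (@spec_fold_max _ _ (fun r : 'I_n * R => r.2)).
    exact: size_r.
  move=> tau [tau_ge0 tau_ub tau_at].
  (* The point at [tau0] satisfies the constraints that the ratios measure, so no ratio exceeds
     [tau0]; the value 0 in the maximum is covered by [0 <= tau0]. *)
  have tau_le : tau <= tau0.
    case: tau_at => [->//|[[i v]]]; rewrite mem_cat => /orP[|].
      rewrite r0P btP => /and3P[/and3P[iB ia ic] pbi /eqP ->] ->.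
      have := Hx i iB; rewrite /= (negPf ia) (negPf ic) => -[_].
      have -> : grad M (fun j => q j + tau0 * p j) B x i =
                grad M (fun j => q j + tau0 * p j) B (pivot_x a c ug qb pb tau0) i.
        by congr (_ + _); apply: eq_mv.
      rewrite G // (negPf ia) /= => H; rewrite lerNl -(ler_pM2r pbi) mulNr divfK ?gt_eqF //; lra.
    move=> /ruP[ia [w [ui pbi ->]]] ->.
    have := Hx i (aB i ia); rewrite /= ia => -[_ _].
    rewrite Ux ?aB // /pivot_x ia ui /= => H; rewrite lerNl -(ler_pM2r pbi) mulNr divfK ?gt_eqF //; lra.
  have Hx' : pivot_point M q u B p a c tau (pivot_x a c ug qb pb tau).
    apply: D => //.
      by move=> i iB ia ic pbi; apply: (tau_ub (i, _)); rewrite mem_cat r0P btP iB ia ic pbi eqxx.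
    by move=> i ia w ui pbi; apply: (tau_ub (i, _)); rewrite mem_cat ruI ?orbT.
  apply: spec_bind; first exact: spec_is0.
  move=> _ ->; apply: spec_if.
    move=> /eqP tau0'; apply: spec_bind.
      apply: (@spec_tab _ _ _ _ (fun i v => v = - qb i)) => i _; exact: spec_opp.
    move=> xa Hxa; apply: spec_ret0.
    set y := glue a xa _; exists y => //.
    have Ey i : y i = pivot_x a c ug qb pb 0 i.
      rewrite /y /glue /pivot_x; case: ifP => ia; last by [].
      by rewrite Hxa // mul0r addr0.
    rewrite tau0' in Hx'; have K := pivot_point_kkt u0 Hx'.
    move=> i iB; have := K i iB; rewrite !Ey /grad.
    by rewrite (@eq_mv _ _ _ M B y (pivot_x a c ug qb pb 0) i).
  move=> tau_n0; apply: spec_bind.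
    apply: spec_le.
      apply: (@spec_filterM _ _ _ (fun r : 'I_n * R => r.2 == tau)) => r.
      exact: spec_eqv.
    exact: leq_mul size_r (leqnn 2).
  move=> best Eb.
  (* The list of maximizers is not empty: a nonzero [tau] is one of the ratios. *)
  case Eb': best => [|r best'].
    case: tau_at => [tz|[r rs Er]]; first by rewrite tz eqxx in tau_n0.
    have : r \in best by rewrite Eb mem_filter rs Er eqxx.
    by rewrite Eb'.
  apply: spec_bind; first exact: spec_any.
  move=> [i v]; rewrite -Eb' Eb mem_filter /= => /andP[/eqP -> ir].
  apply: spec_if => ia.
    have /ruP[_ [w [ui pbi Etau]]] : (i, tau) \in ru.
      by move: ir; rewrite mem_cat r0P btP ia !andbF /=.
    apply: spec_bind; first exact: (spec_unborder ua sMa iN pM ia).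
    move=> N' iN'; apply: spec_ret0.
    have xi : pivot_x a c ug qb pb tau i = w.
      rewrite /pivot_x ia Etau mulNr divfK ?gt_eqF //; ring.
    have [basis' Hx''] := pivot_leave basis Hx' ia ui xi iN'.
    have a1 : (0 < size a)%N by case: (a) ia.
    have [k1 Ek1] := leave_measure a1 Ek size_ac.
    exists (k - 1)%N => //; exists tau, (pivot_x a c ug qb pb tau).
    by split=> //=; rewrite size_rem.
  have {ir} : (i, tau) \in r0.
    move: ir; rewrite mem_cat => /orP[//|/ruP[ia']]; by rewrite ia' in ia.
  rewrite r0P btP => /and3P[/and3P[iB _ ic] pbi /eqP Etau].
  have uia : uniq (i :: a) by rewrite /= ia ua.
  have sub : {subset i :: a <= B} by move=> j; rewrite in_cons => /predU1P[->|/aB].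
  have pM' : posdef M (i :: a).
    apply: (pivot_posdef uB sM iM gM Hp uia sub iN Hpa).
    by move: pbi; rewrite Hpb // (negPf ia).
  have sM' := symm_sub sub sM.
  apply: spec_bind; first exact: spec_schur.
  move=> [cc s] [/= Hcc Hs]; apply: spec_bind; first exact: spec_gt0.
  (* This discards the singular branch of the program with all its blocking ratios. *)
  move=> _ ->; have -> : 0 < s by rewrite Hs (schur_gt0 uia sM' iN pM' Hcc).
  apply: spec_bind; first exact: (spec_border uia sM' iN pM').
  move=> N' iN'; apply: spec_ret0.
  have gi : grad M (fun j => q j + tau * p j) B (pivot_x a c ug qb pb tau) i = 0.
    rewrite G // (negPf ia) Etau mulNr divfK ?gt_eqF //; ring.
  have [basis' Hx''] := pivot_enter basis Hx' iB ia ic gi pM' iN'.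
  have size_ac' : ((size a + size c).+1 <= size B)%N.
    rewrite -size_cat; apply: (@uniq_leq_size _ (i :: a ++ c)).
      by rewrite /= mem_cat negb_or ia ic.
    by move=> j; rewrite in_cons => /predU1P[->|/acB].
  have [k1 Ek1] := enter_measure Ek size_ac'.
  by exists (k - 1)%N => //; exists tau, (pivot_x a c ug qb pb tau).
rewrite size_cat; clear -size_ac size_bt; move: size_ac size_bt; move: (size a) (size c) (size bt) (size B).
move=> sa sc sb b Ha Hb; nia.
Qed.

End Pivoting.

(** * Reductions and unboundedness *)


Section Reductions.
Variables (R : realType) (n : nat).
Implicit Types (M : 'I_n -> 'I_n -> R) (a S B : seq 'I_n) (x v d p q : 'I_n -> R).
Implicit Types (P : qp R n) (u : 'I_n -> option R).

Lemma spec_pivoting P B d p fuel : uniq B -> symm (mx P) B -> irred (mx P) B ->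
  gdd (mx P) B d -> {in B, forall i, p i = ppv (mx P) B d i} ->
  (forall i c, ub P i = Some c -> 0 < c) ->
  {in B, forall i, p i = 0 -> 0 <= lin P i} -> (2 * size B < fuel)%N ->
  spec (pivoting fuel P p B) (fun y => exists2 x, y = Some x & kkt P B x)
    ((2 * size B).+1 * (100 * ((size B).+1 * (size B).+1))).+1.
Proof.
case: P => M q u /= uB sM iM gM Hp u0 q0 Hf; rewrite /pivoting -add1n.
apply: spec_bind; first exact: (@spec_inverse _ _ M [::]).
move=> N0 _.
apply: (@spec_loop _ _ _ _ (pivot_inv M q u B p) _ _ (2 * size B)) Hf.
  by move=> k st; exact: spec_pivot_step uB sM iM gM Hp u0 k st.
(* The starting tau is the sum of the ratios [|q_i| / p_i] over [p_i > 0]; a sum suits the induction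
   better than a maximum. All indices start in beta, whence the initial weight [2 * size B]. *)
have [tau tau0 Ht] : exists2 tau, 0 <= tau & {in B, forall i, 0 <= q i + tau * p i}.
  have : {in B, forall i, 0 <= p i} by move=> i iB; rewrite Hp // ppv_ge0.
  elim: (B) q0 => [|i S IH] q0 p0; first by exists 0.
  have [j jS|j jS|tau tau0 Ht] := IH.
  - by apply: q0; rewrite in_cons jS orbT.
  - by apply: p0; rewrite in_cons jS orbT.
  have := p0 i (mem_head _ _); rewrite le_eqVlt => /predU1P[/esym pi|pi].
    exists tau => // j; rewrite in_cons => /predU1P[->|/Ht //].
    by rewrite pi mulr0 addr0 q0 ?mem_head.
  exists (tau + `|q i| / p i); first by rewrite addr_ge0 // divr_ge0 // ltW.
  move=> j jS; have pj := p0 j jS.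
  have H1 : 0 <= `|q i| / p i * p j by rewrite mulr_ge0 // divr_ge0 // ltW.
  move: jS; rewrite in_cons mulrDl => /predU1P[->|/Ht]; last by lra.
  rewrite divfK ?gt_eqF //.
  have : 0 <= tau * p i by rewrite mulr_ge0 // ltW.
  by have := ler_norm (- q i); rewrite normrN; lra.
exists tau, (fun=> 0); split=> //=; last by rewrite !addn0.
move=> i iB; rewrite /= /grad /mv big1 ?addr0; first by split=> //; exact: Ht.
by move=> j _; rewrite mulr0.
Qed.

(* what the output [None] certifies: a recession direction of negative slope *)
Definition ray P S v := [/\
  {in S, forall i, 0 <= v i /\ (isSome (ub P i) -> v i = 0)},
  {in S, forall i, mv (mx P) S v i = 0} & ip S (lin P) v < 0].

Definition solved P S (y : option ('I_n -> R)) :=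
  match y with Some x => kkt P S x | None => exists v, ray P S v end.

Lemma eq_kkt P S x y : {in S, x =1 y} -> kkt P S x -> kkt P S y.
Proof.
move=> xy Hx i iS; have := Hx i iS; rewrite /grad xy //.
by rewrite (@eq_mv _ _ _ (mx P) S x y i).
Qed.

Section Elimination.
Variables (M : 'I_n -> 'I_n -> R) (q : 'I_n -> R) (u : 'I_n -> option R).
Variables (B : seq 'I_n) (i : 'I_n).
Hypothesis uB : uniq B.
Hypothesis sM : symm M B.
Hypothesis iB : i \in B.
Hypothesis mii : 0 < M i i.
Hypothesis qi : q i < 0.
Hypothesis Mi : {in B, forall j, j != i -> M i j <= 0}.

Let inB j : j \in rem i B -> j \in B. Proof. exact: mem_rem. Qed.
Let neq j : j \in rem i B -> (j == i) = false.
Proof. by rewrite mem_rem_uniq // inE => /andP[/negPf]. Qed.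
Let Mi' j : j \in rem i B -> M i j <= 0.
Proof. by move=> jB; rewrite Mi ?inB ?neq. Qed.
Let memB j : j \in B -> j = i \/ j \in rem i B.
Proof. by rewrite mem_rem_uniq // inE; case: eqVneq => [->|_ ->]; [left|right]. Qed.
Let mv_upd x c j : mv M B (upd x i c) j = M j i * c + mv M (rem i B) x j.
Proof.
rewrite /mv (sum_rem _ uB iB) /upd eqxx; congr (_ + _).
by apply: eq_big_seq => k kB; rewrite neq.
Qed.
Let mvi_le0 x : {in rem i B, forall j, 0 <= x j} -> mv M (rem i B) x i <= 0.
Proof.
move=> x0; rewrite /mv big_seq sumr_le0 // => j jB.
by rewrite mulr_le0_ge0 ?Mi' ?x0.
Qed.

Section Eliminate.
Variables (M' : 'I_n -> 'I_n -> R) (q' : 'I_n -> R).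
Hypothesis HM' : {in rem i B &, forall j k, M' j k = M j k - M j i * M i k / M i i}.
Hypothesis Hq' : {in rem i B, forall j, q' j = q j - M j i / M i i * q i}.

Let mv' x j : j \in rem i B -> mv M' (rem i B) x j =
  mv M (rem i B) x j - M j i / M i i * mv M (rem i B) x i.
Proof.
move=> jB; rewrite /mv mulr_sumr -sumrB; apply: eq_big_seq => k kB.
by rewrite HM' //; ring.
Qed.

(** The recovered [x_i] makes its own gradient zero, and the other gradients are then those of the
    reduced problem. It is positive because [q_i < 0] and row i is nonpositive off the diagonal. *)
Lemma eliminate_kkt x : ub (QP M q u) i = None -> kkt (QP M' q' u) (rem i B) x ->
  kkt (QP M q u) B (upd x i (- ((q i + mv M (rem i B) x i) / M i i))).
Proof.
move=> ui Hx; set c := - _.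
have x0 : {in rem i B, forall j, 0 <= x j} by move=> j /Hx[].
have c0 : 0 < c.
  rewrite /c oppr_gt0 pmulr_llt0 ?invr_gt0 //.
  by have := mvi_le0 x0; have := qi; lra.
have gi : grad M q B (upd x i c) i = 0.
  by rewrite /grad mv_upd /c; field; rewrite gt_eqF.
move=> j /memB[->|jB] /=.
  by rewrite gi /upd eqxx; rewrite /= in ui; rewrite ui; split=> //; exact: ltW.
have -> : grad M q B (upd x i c) j = grad M' q' (rem i B) x j.
  by rewrite /grad mv_upd mv' // Hq' // /c; field; rewrite gt_eqF.
by rewrite /upd neq //; exact: Hx.
Qed.

(** The component at [i] solves row i of [M v = 0]; it is nonnegative by the signs of that row, and
    allowed since [u_i] is infinite. *)
Lemma eliminate_ray v : ub (QP M q u) i = None -> ray (QP M' q' u) (rem i B) v ->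
  ray (QP M q u) B (upd v i (- (mv M (rem i B) v i / M i i))).
Proof.
move=> /= ui [v0 Mv qv]; set c := - _.
split=> /=.
- move=> j /memB[->|jB]; last by rewrite /upd neq //; exact: v0.
  rewrite ui /upd eqxx; split=> //; rewrite /c -mulNr divr_ge0 ?(ltW mii) //.
  by rewrite oppr_ge0 mvi_le0 // => k /v0[].
- move=> j /memB[->|jB]; rewrite mv_upd /c; first by field; rewrite gt_eqF.
  by have := Mv j jB; rewrite /= mv' // => E; rewrite -[RHS]E; ring.
- rewrite /ip (sum_rem _ uB iB) /upd eqxx.
  have -> : \sum_(j <- rem i B) q j * (if j == i then c else v j) =
            \sum_(j <- rem i B) (q' j * v j + q i / M i i * (M i j * v j)).
    apply: eq_big_seq => j jB; rewrite neq // Hq' // (sM iB (inB jB)); ring.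
  rewrite big_split -mulr_sumr /= -/(mv M (rem i B) v i) -/(ip (rem i B) q' v).
  suff -> : q i * c = - (q i / M i i * mv M (rem i B) v i).
    by rewrite addrCA addNr addr0.
  by rewrite /c; ring.
Qed.

Lemma eliminate_sym : symm M' (rem i B).
Proof.
move=> j k jB kB; rewrite !HM' // (sM (inB jB) (inB kB)).
by rewrite (sM (inB jB) iB) (sM iB (inB kB)); ring.
Qed.

(** Adding [t = |M_ji| / M_ii] times row i of [cmp M d] to row j cancels [d_i], and by the triangle
    inequality the result is at most row j for the Schur complement. *)
Lemma eliminate_gdd d : gdd M B d -> gdd M' (rem i B) d.
Proof.
move=> gM j jB; have [di Di] := gM i iB; have [dj Dj] := gM j (inB jB).
split=> //; set t := `|M j i| / M i i.
have t0 : 0 <= t by rewrite divr_ge0 // ltW.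
suff : mv (cmp M) B d j + t * mv (cmp M) B d i <= mv (cmp M') (rem i B) d j.
  by apply: le_trans; rewrite addr_ge0 // mulr_ge0.
rewrite {1 2}/mv !(sum_rem _ uB iB) {1 3}/cmp eqxx (neq jB).
have -> (s s' : R) : - `|M j i| * d i + s + t * (M i i * d i + s') = s + t * s'.
  by rewrite /t; field; rewrite gt_eqF.
rewrite /mv mulr_sumr -big_split /= big_seq [leRHS]big_seq; apply: ler_sum => k kB.
have [dk _] := gM k (inB kB).
rewrite mulrA -mulrDl ler_wpM2r ?(ltW dk) //.
rewrite /cmp (eq_sym i k) (neq kB) HM' //; case: (eqVneq j k) => [<-|_].
  by rewrite (sM (inB jB) iB) /t (sM (inB jB) iB) mulrN mulrAC -normrM -expr2 ger0_norm ?sqr_ge0.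
rewrite HM' // mulrN -opprD lerN2 /t; apply: le_trans (ler_normB _ _) _.
by rewrite lerD2l !normrM normfV (gtr0_norm mii) mulrAC.
Qed.

End Eliminate.

Section Reflect.
Variables (c : R) (M' : 'I_n -> 'I_n -> R) (q' : 'I_n -> R).
Hypothesis ui : u i = Some c.
Hypothesis c0 : 0 < c.
Hypothesis HM' : {in B &, forall j k, M' j k =
  if (j == i) (+) (k == i) then - M j k else M j k}.
Hypothesis Hq' : {in B, forall j, q' j =
  if j == i then - (q j + M j i * c) else q j + M j i * c}.

Let mvB_rem x j : mv M B x j = M j i * x i + mv M (rem i B) x j.
Proof. by rewrite /mv (sum_rem _ uB iB). Qed.
Let mv'_i x : mv M' B x i = M i i * x i - mv M (rem i B) x i.
Proof.
rewrite /mv (sum_rem _ uB iB) HM' // eqxx -sumrN; congr (_ + _).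
by apply: eq_big_seq => k kB; rewrite (HM' iB (inB kB)) eqxx neq //= mulNr.
Qed.
Let mv'_j x j : j \in rem i B -> mv M' B x j = - M j i * x i + mv M (rem i B) x j.
Proof.
move=> jB; rewrite /mv (sum_rem _ uB iB) (HM' (inB jB) iB) eqxx neq //=.
congr (_ + _); apply: eq_big_seq => k kB.
by rewrite (HM' (inB jB) (inB kB)) !neq.
Qed.

Lemma reflect_kkt z : kkt (QP M' q' (upd u i None)) B z ->
  kkt (QP M q u) B (upd z i (c - z i)).
Proof.
move=> Hz.
have z0 : {in rem i B, forall j, 0 <= z j} by move=> j /inB /Hz[].
have Gi : grad M q B (upd z i (c - z i)) i = - grad M' q' B z i.
  by rewrite /grad mv_upd mv'_i Hq' // eqxx; ring.
have := Hz i iB; rewrite /= {1 2}/upd eqxx /= => -[zi0 _ H1 /(_ isT) H2].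
(* The dropped constraint [0 <= x_i] holds by itself: if [z_i >= c], then [x_i <= 0] and the
   gradient at [i] is negative, contradicting the conditions for [z_i > 0]. *)
have zc : z i < c.
  rewrite ltNge; apply/negP => cz; have := H1 (lt_le_trans c0 cz).
  rewrite -oppr_ge0 -Gi leNgt => /negP; apply; rewrite /grad mv_upd.
  have : M i i * (c - z i) <= 0 by rewrite mulr_ge0_le0 ?(ltW mii) // subr_le0.
  by have := mvi_le0 z0; have := qi; lra.
move=> j /memB[->|jB] /=.
  rewrite Gi /upd eqxx ui /=; split.
  - by rewrite subr_ge0 ltW.
  - by rewrite gerBl.
  - by rewrite oppr_le0.
  - by rewrite gtrBl oppr_ge0.
have -> : grad M q B (upd z i (c - z i)) j = grad M' q' B z j.
  by rewrite /grad mv_upd mv'_j // Hq' ?inB // neq //; ring.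
by have := Hz j (inB jB); rewrite /= /upd neq.
Qed.

(** Having lost its bound, [i] might occur in [v]; but row i of [M' v = 0] is a sum of nonnegative
    terms, so [v_i = 0] and the reflection does not affect [v]. *)
Lemma reflect_ray v : ray (QP M' q' (upd u i None)) B v -> ray (QP M q u) B v.
Proof.
move=> [/= v0 Mv qv].
have vge0 : {in rem i B, forall j, 0 <= v j} by move=> j /inB /v0[].
have := Mv i iB; rewrite mv'_i => E.
have [vi _] := v0 i iB.
have M0 : 0 <= M i i * v i by rewrite mulr_ge0 // ltW.
have mle := mvi_le0 vge0.
have vi0 : v i = 0.
  have /eqP : M i i * v i = 0 by lra.
  by rewrite mulf_eq0 gt_eqF //= => /eqP.
have mi0 : mv M (rem i B) v i = 0 by lra.
split=> /=.
- move=> j /memB[->|jB]; first by rewrite vi0.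
  by have := v0 j (inB jB); rewrite /upd neq.
- move=> j /memB[->|jB]; rewrite mvB_rem vi0 mulr0 add0r //.
  by have := Mv j (inB jB); rewrite mv'_j // vi0 mulr0 add0r.
- suff <- : ip B q' v = ip B q v by [].
  rewrite /ip !(sum_rem _ uB iB) vi0 !mulr0 !add0r.
  transitivity (\sum_(j <- rem i B) (q j * v j + c * (M i j * v j))).
    apply: eq_big_seq => j jB; rewrite Hq' ?inB // neq // (sM (inB jB) iB); ring.
  by rewrite big_split -mulr_sumr /= -/(mv M (rem i B) v i) mi0 mulr0 addr0.
Qed.

Lemma reflect_sym : symm M' B.
Proof. by move=> j k jB kB; rewrite !HM' // addbC sM. Qed.

Lemma reflect_gdd d : gdd M B d -> gdd M' B d.
Proof.
move=> gM j jB; have [dj Dj] := gM j jB; split=> //.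
rewrite (@eq_mv _ _ (cmp M') (cmp M) B d d j) // => k kB; rewrite /cmp !HM' //.
case: eqVneq => [->|_]; first by rewrite addbb.
by case: ifP; rewrite ?normrN.
Qed.

End Reflect.
End Elimination.
End Reductions.

(** * The PPPA *)


Section BlockLoop.
Variables (R : realType) (n : nat).
Implicit Types (M : 'I_n -> 'I_n -> R) (S B : seq 'I_n) (x v d : 'I_n -> R).
Implicit Types (P : qp R n) (Bs : seq (seq 'I_n)).

(** Shared by the PPPA and step (3). Disjointness keeps later blocks from overwriting earlier
    solutions, and budgets proportional to the block sizes add up to [size * W]. *)
Lemma spec_fold_blocks (solve : seq 'I_n -> prog R (option ('I_n -> R)))
    (ok : seq 'I_n -> ('I_n -> R) -> Prop) (bad : Prop) W z Bs :
  uniq (flatten Bs) ->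
  (forall B, B \in Bs -> spec (solve B)
     (fun y => match y with Some x => ok B x | None => bad end) (size B * W)) ->
  (forall B x y, {in B, x =1 y} -> ok B x -> ok B y) ->
  spec (foldM (fun acc B =>
      if acc isn't Some x then Ret None else
      let* y := solve B in
      Ret (if y is Some y' then Some (glue B y' x) else None)) (Some z) Bs)
    (fun y => match y with Some x => {in Bs, forall B, ok B x} | None => bad end)
    (size (flatten Bs) * W).
Proof.
move=> uBs Hs ok_ext; apply: spec_le.
  apply: (@spec_foldM_prefix _ _ _ _ _ _ (fun t y => match y with
    Some x => {in t, forall B, ok B x} | None => bad end) (fun B => size B * W)%N) => //.
  move=> t B s' [x|] E Hx; last exact: spec_ret.
  have BBs : B \in Bs by rewrite E mem_cat mem_head orbT.
  rewrite -[(_ * W)%N]addn0; apply: spec_bind (Hs B BBs) _ => -[y|] Hy; last first.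
    exact: spec_ret.
  apply: spec_ret0 => B'; rewrite mem_rcons in_cons => /predU1P[->|B't].
    by apply: ok_ext Hy => i iB; rewrite /glue iB.
  apply: ok_ext (Hx _ B't) => i iB'; rewrite /glue.
  case: ifP => // iB; move: uBs; rewrite E flatten_cat cat_uniq /= => /and3P[_ /hasPn H _].
  have := H i; rewrite mem_cat iB => /(_ isT) /negP[].
  by apply/flattenP; exists B'.
rewrite size_flatten /shape sumnE big_map big_distrl /=.
exact: leqnn.
Qed.

Lemma mv_block M S B x i : uniq S -> uniq B -> {subset B <= S} ->
  (forall j, j \in S -> j \notin B -> M i j = 0) -> mv M S x i = mv M B x i.
Proof.
move=> uS uB BS H; apply: sum_sub => // j jS jB.
by rewrite H ?mul0r.
Qed.

Lemma kkt_blocks P S Bs x : uniq S -> is_blocks (mx P) S Bs ->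
  {in Bs, forall B, kkt P B x} -> kkt P S x.
Proof.
move=> uS [pB HB] Hx i iS; have : i \in flatten Bs by rewrite (perm_mem pB).
case/flattenP => B BBs iB; have [_ uB BS _ off] := HB B BBs.
have := Hx B BBs i iB; rewrite /grad (@mv_block _ S B) // => j jS jB.
exact: off jB.
Qed.

Lemma ray_block P S Bs B v : uniq S -> symm (mx P) S -> is_blocks (mx P) S Bs ->
  B \in Bs -> ray P B v -> ray P S (fun i => if i \in B then v i else 0).
Proof.
move=> uS sM [_ HB] BBs [v0 Mv qv]; have [_ uB BS _ off] := HB B BBs.
split.
- by move=> i iS; case: ifP => [/v0|].
- move=> i iS; rewrite /mv (sum_sub uS uB BS); last first.
    by move=> j _ /negPf ->; rewrite mulr0.
  have [iB|iB] := boolP (i \in B).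
    by rewrite -[RHS](Mv i iB); apply: eq_big_seq => j ->.
  rewrite big1_seq // => j /andP[_ jB].
  by rewrite (sM i j iS (BS j jB)) (off j i) ?mul0r.
- rewrite /ip (sum_sub uS uB BS); last by move=> j _ /negPf ->; rewrite mulr0.
  by under eq_big_seq => j jB do rewrite jB.
Qed.

Lemma gdd_block M S B d : uniq S -> uniq B -> {subset B <= S} ->
  (forall i j, i \in B -> j \in S -> j \notin B -> M i j = 0) ->
  gdd M S d -> gdd M B d.
Proof.
move=> uS uB BS off gM i iB; have [di Di] := gM i (BS i iB); split=> //.
rewrite -(@mv_block _ S B) // => j jS jB; rewrite /cmp.
case: (eqVneq i j) => [E|_]; first by rewrite -E iB in jB.
by rewrite off // normr0 oppr0.
Qed.

(** The measure of the recursion: an elimination removes an index, a reflection removes a finite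
    bound. *)
Definition mu P S := (size S + count (fun i => isSome (ub P i)) S)%N.

(** At most [m] nested reductions at quadratic cost, then cubic pivoting. The search for [d] is
    accounted for separately, as it happens only at the outermost level. *)
Definition pppa_cost K s m := (K * (s * s * m.+1 + s * s * s)).+1.

Lemma spec_inspect1 P i : mx P i i = 0 ->
  (forall i c, ub P i = Some c -> 0 < c) ->
  spec (inspect1 P i) (solved P [:: i]) 3.
Proof.
move=> m0 u0; rewrite /inspect1.
have mv0 x : mv (mx P) [:: i] x i = 0 by rewrite /mv big_seq1 m0 mul0r.
apply: (@spec_bind _ _ _ _ _ _ _ 1 2); first exact: spec_lit.
move=> z ->; apply: (@spec_bind _ _ _ _ _ _ _ 2 0); first exact: spec_ge0.
move=> _ ->; case: (lerP 0 (lin P i)) => [q0|q0].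
  apply: spec_ret0 => j; rewrite mem_seq1 => /eqP ->.
  rewrite /grad mv0 addr0 lexx ltxx; split=> //.
  by case E: (ub P i) => [c|//] /=; rewrite ltW // (u0 _ _ E).
case E: (ub P i) => [c|]; apply: spec_ret0.
  move=> j; rewrite mem_seq1 => /eqP ->; rewrite /grad mv0 addr0 E /= lexx ltxx.
  by split=> //; [rewrite ltW // (u0 _ _ E) | rewrite ltW].
exists (fun=> 1); split.
- by move=> j; rewrite mem_seq1 => /eqP ->; rewrite E.
- by move=> j; rewrite mem_seq1 => /eqP ->.
- by rewrite /ip big_seq1 mulr1.
Qed.

Lemma spec_eliminate P B i : mx P i i != 0 ->
  spec (eliminate P B i) (fun P' => [/\
    {in B &, forall j k, mx P' j k = mx P j k - mx P j i * mx P i k / mx P i i},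
    {in B, forall j, lin P' j = lin P j - mx P j i / mx P i i * lin P i} &
    ub P' = ub P]) (10 * ((size B).+1 * (size B).+1)).
Proof.
case: P => M q u /= m0; rewrite /eliminate; apply: spec_le.
  apply: spec_bind.
    apply: (@spec_tab2 _ _ _ _ _ (fun j k w => w = M j k - M j i * M i k / M i i) 3).
    move=> j k _ _; apply: (@spec_bind _ _ _ _ _ _ _ 1 2); first exact: spec_mul.
    move=> _ ->; apply: (@spec_bind _ _ _ _ _ _ _ 1 1); first exact: spec_div.
    by move=> _ ->; exact: spec_sub.
  move=> M' HM'; apply: spec_bind.
    apply: (@spec_tab _ _ _ _ (fun j w => w = q j - M j i / M i i * q i) 3).
    move=> j _; apply: (@spec_bind _ _ _ _ _ _ _ 1 2); first exact: spec_div.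
    move=> _ ->; apply: (@spec_bind _ _ _ _ _ _ _ 1 1); first exact: spec_mul.
    by move=> _ ->; exact: spec_sub.
  by move=> q' Hq'; apply: spec_ret0.
by move: (size B) => b; nia.
Qed.

Lemma spec_uneliminate P B i x : mx P i i != 0 ->
  spec (uneliminate P B i x)
    (fun y => y = upd x i (- ((lin P i + mv (mx P) B x i) / mx P i i)))
    (2 * size B + 5).
Proof.
case: P => M q u /= m0; rewrite /uneliminate; apply: spec_le.
  apply: spec_bind; first exact: spec_dot.
  move=> _ ->; apply: spec_bind; first exact: spec_add.
  move=> _ ->; apply: spec_bind; first exact: spec_div.
  move=> _ ->; apply: spec_bind; first exact: spec_opp.
  by move=> _ ->; exact: spec_ret0.
by move: (size B) => b; lia.
Qed.

Lemma spec_reflect P B i c :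
  spec (reflect P B i c) (fun P' => [/\
    {in B &, forall j k, mx P' j k = if (j == i) (+) (k == i) then - mx P j k else mx P j k},
    {in B, forall j, lin P' j = if j == i then - (lin P j + mx P j i * c)
                                else lin P j + mx P j i * c} &
    ub P' = upd (ub P) i None]) (10 * ((size B).+1 * (size B).+1)).
Proof.
case: P => M q u; rewrite /reflect; apply: spec_le.
  apply: spec_bind.
    apply: (@spec_tab2 _ _ _ _ _ (fun j k w =>
      w = if (j == i) (+) (k == i) then - M j k else M j k) 2).
    move=> j k _ _; case: ifP => _; [exact: spec_opp | exact: spec_ret].
  move=> M' HM'; apply: spec_bind.
    apply: (@spec_tab _ _ _ _ (fun j w => w = if j == i then - (q j + M j i * c)
                                              else q j + M j i * c) 4).
    move=> j _; apply: (@spec_bind _ _ _ _ _ _ _ 1 3); first exact: spec_mul.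
    move=> _ ->; apply: (@spec_bind _ _ _ _ _ _ _ 1 2); first exact: spec_add.
    move=> _ ->; case: ifP => _; [exact: spec_opp | exact: spec_ret].
  by move=> q' Hq'; apply: spec_ret0.
by move: (size B) => b; nia.
Qed.

End BlockLoop.


(** The factor [m] in place of [m.+1] is what a strictly smaller measure leaves to the recursive
    call; the [K s^2] saved pays for the decomposition and the other quadratic work. The last term,
    with [e = 40] or [0], is the search for [d]. *)
Definition block_cost K e b m := (100 * (b * b) + K * (b * b * m + b * b * b) + e * (b * b * b))%N.

Lemma pppa_cost_mono K s s' m m' : (s <= s' -> m < m' ->
  pppa_cost K s m <= (K * (s' * s' * m' + s' * s' * s')).+1)%N.
Proof. by move=> ss mm; rewrite /pppa_cost ltnS leq_mul2l leq_add ?orbT // !leq_mul. Qed.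

(** The origin of 1300: [2 b + 1 <= 3 b] rounds of cost [100 (b + 1)^2 <= 400 b^2] take [1200 b^3],
    rounded up. *)
Lemma block_cost_pivot K e b m : (1300 <= K -> 0 < b ->
  3 + (e * (b * b * b) + (20 * (b * b) + 10 + (b * 5 +
    ((2 * b).+1 * (100 * (b.+1 * b.+1))).+1))) <= block_cost K e b m)%N.
Proof.
move=> HK b0; rewrite /block_cost mulnDr.
have : (1300 * (b * b * b) <= K * (b * b * b))%N by rewrite leq_mul2r HK orbT.
have : (b <= b * b)%N by rewrite leq_pmulr.
have : (b * b <= b * b * b)%N by rewrite leq_pmulr.
nia.
Qed.

Lemma block_cost_rec K e b m : (0 < b ->
  3 + (e * (b * b * b) + (20 * (b * b) + 10 + (b * 5 +
    (1 + (10 * (b.+1 * b.+1) + ((K * (b * b * m + b * b * b)).+1 + (2 * b + 5))))))) <=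
  block_cost K e b m)%N.
Proof.
move=> b0; rewrite /block_cost.
have : (b <= b * b)%N by rewrite leq_pmulr.
by move: (K * _)%N (e * _)%N => x y; nia.
Qed.

Lemma block_cost_sub K e b s m m' : (b <= s -> m <= m' ->
  block_cost K e b m <=
  b * (100 * s + K * (s * m' + s * s) + e * (s * s)))%N.
Proof.
move=> bs mm; rewrite /block_cost.
have -> : (100 * (b * b) + K * (b * b * m + b * b * b) + e * (b * b * b) =
  b * (100 * b + K * (b * m + b * b) + e * (b * b)))%N by lia.
rewrite leq_mul2l; apply/orP; right; rewrite !leq_add //.
- by rewrite leq_mul2l leq_add ?orbT // leq_mul.
- by rewrite leq_mul2l leq_mul ?orbT.
Qed.

Lemma pppa_cost_sum K e s m : (1300 <= K ->
  4 * (s * s) + (1 + s * (100 * s + K * (s * m + s * s) + e * (s * s))) <=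
  pppa_cost K s m + e * (s * s * s))%N.
Proof.
move=> HK; rewrite /pppa_cost.
have : (1300 * (s * s) <= K * (s * s))%N by rewrite leq_mul2r HK orbT.
by clear; lia.
Qed.

Section PPPA.
Variables (R : realType) (n : nat).
Implicit Types (M : 'I_n -> 'I_n -> R) (S B : seq 'I_n) (x d : 'I_n -> R).
Implicit Types (P : qp R n) (Bs : seq (seq 'I_n)).

Lemma mu_sub P S B : uniq B -> {subset B <= S} -> (mu P B <= mu P S)%N.
Proof.
move=> uB BS; apply: leq_add; first exact: uniq_leq_size.
rewrite -!size_filter; apply: uniq_leq_size; first exact: filter_uniq.
by move=> i; rewrite !mem_filter => /andP[-> /BS].
Qed.

Lemma mu_eliminate P P' B i : i \in B -> ub P i = None -> ub P' = ub P ->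
  (mu P' (rem i B) < mu P B)%N.
Proof.
move=> iB ui E; rewrite /mu E (permP (perm_to_rem iB)) /= ui add0n.
by rewrite (perm_size (perm_to_rem iB)).
Qed.

Lemma mu_reflect P P' B i c : uniq B -> i \in B -> ub P i = Some c ->
  ub P' = upd (ub P) i None -> (mu P' B < mu P B)%N.
Proof.
move=> uB iB ui E; rewrite /mu ltn_add2l E !(permP (perm_to_rem iB)) /= ui.
rewrite /upd eqxx add0n add1n ltnS leq_eqVlt; apply/orP; left; apply/eqP.
by apply: eq_in_count => j; rewrite mem_rem_uniq // inE => /andP[/negPf ->].
Qed.

Section Reduction.
Variables (P P' : qp R n) (B : seq 'I_n) (i : 'I_n).
Hypothesis uB : uniq B.
Hypothesis sM : symm (mx P) B.
Hypothesis iB : i \in B.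
Hypothesis mii : 0 < mx P i i.
Hypothesis qi : lin P i < 0.
Hypothesis Mi : {in B, forall j, j != i -> mx P i j <= 0}.

Lemma eliminate_solved y : ub P i = None ->
  {in rem i B &, forall j k, mx P' j k = mx P j k - mx P j i * mx P i k / mx P i i} ->
  {in rem i B, forall j, lin P' j = lin P j - mx P j i / mx P i i * lin P i} ->
  ub P' = ub P -> solved P' (rem i B) y ->
  solved P B (omap (fun x =>
    upd x i (- ((lin P i + mv (mx P) (rem i B) x i) / mx P i i))) y).
Proof.
case: P sM mii qi Mi => M q u /= sM' mii' qi' Mi'; case: P' => M' q' _ /= ui HM Hq ->.
case: y => [x|[v Hv]] /=; first exact: eliminate_kkt.
exists (upd v i (- (mv M (rem i B) v i / M i i))); exact: (eliminate_ray uB sM' iB mii' Mi' HM Hq ui Hv).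
Qed.

Lemma reflect_solved c y : ub P i = Some c -> 0 < c ->
  {in B &, forall j k, mx P' j k = if (j == i) (+) (k == i) then - mx P j k else mx P j k} ->
  {in B, forall j, lin P' j = if j == i then - (lin P j + mx P j i * c)
                              else lin P j + mx P j i * c} ->
  ub P' = upd (ub P) i None -> solved P' B y ->
  solved P B (omap (fun x => upd x i (c - x i)) y).
Proof.
case: P sM mii qi Mi => M q u /= sM' mii' qi' Mi'; case: P' => M' q' _ /= ui c0 HM Hq ->.
case: y => [x|[v Hv]] /=; first exact: reflect_kkt.
by exists v; apply: (reflect_ray _ _ _ _ _ _ _ Hv) => //; eauto.
Qed.

End Reduction.

(** The fuel covers at most [mu] nested reductions followed by at most [2 * size S] pivots;
    [pivoting] runs on what the recursion has left. *)
Lemma spec_pppa_aux K fuel od P S : (1300 <= K)%N -> uniq S -> symm (mx P) S ->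
  (forall i c, ub P i = Some c -> 0 < c) ->
  (if od is Some d then gdd (mx P) S d else psd (cmp (mx P)) S) ->
  ((mu P S + 2 * size S).+1 < fuel)%N ->
  spec (pppa_aux fuel od P S) (solved P S)
    (pppa_cost K (size S) (mu P S) +
     (if od is Some _ then 0 else 40) * (size S * size S * size S)).
Proof.
move=> HK; elim: fuel od P S => // fuel IH od P S uS sM u0 Hod Hfuel.
cbn [pppa_aux]; set e := (if od is Some _ then 0 else 40)%N.
set s := size S; set m := mu P S.
apply: spec_le _ (pppa_cost_sum _ _ _ HK).
apply: spec_bind; first exact: spec_blocks.
move=> Bs HBs; apply: spec_bind; first exact: spec_lit.
move=> z _; have [pe HB] := HBs.
set W := (100 * s + K * (s * m + s * s) + e * (s * s))%N.
have -> : s = size (flatten Bs) by rewrite (perm_size pe).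
apply: (@spec_post _ _ _ (fun y => match y with
    Some x => {in Bs, forall B, kkt P B x} | None => exists v, ray P S v end)); last first.
  by case=> [x|//]; exact: kkt_blocks.
apply: spec_fold_blocks; first by rewrite (perm_uniq pe).
  2: by move=> B x y; exact: eq_kkt.
move=> B BBs; have [B0 uB BS iM off] := HB B BBs.
have sMB := symm_sub BS sM; have mBS := mu_sub P uB BS.
have bs : (size B <= s)%N by exact: uniq_leq_size.
have b0 : (0 < size B)%N by case: (B) B0.
apply: spec_le _ (block_cost_sub K e bs mBS).
apply: (@spec_post _ _ _ (solved P B)); last first.
  by case=> // -[v Hv]; exists (fun i => if i \in B then v i else 0); exact: ray_block HBs _ Hv.
have fB : (2 * size B < fuel)%N by rewrite /s in bs; clear -Hfuel bs; lia.
have fB' (P' : qp R n) (B' : seq 'I_n) : (mu P' B' < mu P B)%N -> (size B' <= size B)%N ->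
    ((mu P' B' + 2 * size B').+1 < fuel)%N.
  by rewrite /s in bs; clear -Hfuel bs mBS; lia.
apply: spec_le.
  apply: (@spec_bind _ _ _ _ _ (fun b : bool => if b
    then exists2 i, B = [:: i] & mx P i i = 0
    else forall i, ~ (B = [:: i] /\ mx P i i = 0)) _ 3).
    case: (B) => [|i [|j B1]]; try by apply: spec_ret => i' -[].
    apply: spec_post (spec_is0 _) _ => _ ->.
    by case: eqP => [m0|m0]; [exists i | move=> j [[<-]]].
  move=> zero Hzero.
  (* What remains after the first test. The truncated subtraction is exact, because
     [block_cost_pivot] bounds [block_cost] below by 3. *)
  apply: (@spec_le _ _ _ _ (block_cost K e (size B) (mu P B) - 3)); last exact: leqnn.
  case: zero Hzero => [[i EB m0]|nz].
    rewrite EB; apply: spec_le (spec_inspect1 m0 u0) _.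
    by clear; rewrite /block_cost /=; lia.
  apply: (@spec_le _ _ _ _ (e * (size B * size B * size B) +
     (20 * (size B * size B) + 10 + (size B * 5 +
       (block_cost K e (size B) (mu P B) - 3 - e * (size B * size B * size B) -
         (20 * (size B * size B) + 10) - size B * 5))))%N); last first.
    have := block_cost_pivot e (mu P B) HK b0.
    by move: (block_cost _ _ _ _) (e * _)%N (20 * _)%N => x y t; clear; lia.
  apply: (@spec_bind _ _ _ _ _ (gdd (mx P) B)).
    move: Hod; rewrite /e; case: (od) => [d|] Hod.
      by apply: spec_ret; exact: gdd_block off Hod.
    by apply: spec_find_d => //; exact: psd_sub Hod.
  move=> d gM; apply: spec_bind; first exact: spec_find_p.
  move=> p Hp; apply: spec_bind.
    apply: (@spec_filterM _ _ _ (fun i => (p i == 0) && (lin P i < 0))) => i.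
    apply: (@spec_bind _ _ _ _ _ _ _ 3 2); first exact: spec_is0.
    move=> _ ->; case: (p i == 0) => /=; [exact: spec_lt0 | exact: spec_ret].
  move=> bad Ebad; case Eb: bad => [|i0 bad'].
    apply: (@spec_le _ _ _ _ ((2 * size B).+1 * (100 * ((size B).+1 * (size B).+1))).+1); last first.
      have := block_cost_pivot e (mu P B) HK b0.
      by move: (block_cost _ _ _ _) (e * _)%N (20 * _)%N (_ * (100 * _))%N => x y t w; clear; lia.
    apply: spec_post; first apply: (spec_pivoting uB sMB iM gM Hp u0 _ fB).
      move=> i iB pi; rewrite leNgt; apply/negP => qi.
      have : i \in bad by rewrite Ebad mem_filter pi eqxx qi.
      by rewrite Eb.
    by move=> _ [x -> Hx].
  apply: (@spec_le _ _ _ _ (1 + (10 * ((size B).+1 * (size B).+1) +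
    ((K * (size B * size B * mu P B + size B * size B * size B)).+1 + (2 * size B + 5))))); last first.
    have := block_cost_rec K e (mu P B) b0.
    by move: (block_cost _ _ _ _) (e * _)%N (20 * _)%N (10 * _)%N (K * _)%N => x y t w r;
      clear; lia.
  apply: spec_bind; first exact: spec_any.
  move=> i; rewrite -Eb Ebad mem_filter => /andP[/andP[/eqP pi qi] iB].
  have mii : 0 < mx P i i by apply: (gdd_diag_gt0 uB iM gM iB); exact: nz.
  have mi0 : mx P i i != 0 by rewrite gt_eqF.
  have Mi : {in B, forall j, j != i -> mx P i j <= 0}.
    by apply: (ppv_eq0 uB gM iB); rewrite -Hp // pi.
  case Eu: (ub P i) => [c|].
    apply: spec_bind; first exact: spec_reflect.
    move=> P' [HM' Hq' Hu'].
    have mlt := mu_reflect uB iB Eu Hu'.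
    apply: spec_bind.
      apply: spec_le; first apply: IH => //.
      - exact: (reflect_sym sMB HM').
      - move=> j w; rewrite Hu' /upd; case: eqP => // _; exact: u0.
      - exact: (reflect_gdd HM' gM).
      - exact: fB'.
      by rewrite mul0n addn0; exact: pppa_cost_mono mlt.
    move=> y /(reflect_solved uB sMB iB mii qi Mi Eu (u0 _ _ Eu) HM' Hq' Hu').
    case: y => [z'|] Hy; last exact: spec_ret.
    apply: (@spec_le _ _ _ _ 1); last by rewrite addnS.
    apply: (@spec_bind _ _ _ _ _ _ _ 1 0); first exact: spec_sub.
    by move=> _ ->; exact: spec_ret0.
  apply: spec_bind.
    apply: spec_le; first exact: spec_eliminate.
    rewrite leq_mul2l /= size_rem // prednK //.
    exact: (leq_mul (leqnSn _) (leqnSn _)).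
  move=> P' [HM' Hq' Hu'].
  have mlt := mu_eliminate iB Eu Hu'.
  have szB : (size (rem i B) <= size B)%N by rewrite size_rem // leq_pred.
  apply: spec_bind.
    apply: spec_le; first apply: IH => //.
    - exact: rem_uniq.
    - exact: (eliminate_sym sMB iB HM').
    - by move=> j w; rewrite Hu'; exact: u0.
    - exact: (eliminate_gdd uB sMB iB mii HM' gM).
    - exact: fB'.
    by rewrite mul0n addn0; exact: pppa_cost_mono mlt.
  move=> y /(eliminate_solved uB sMB iB mii qi Mi Eu HM' Hq' Hu').
  case: y => [x|] Hy; last exact: spec_ret.
  rewrite -[(_ + 5)%N]addn0; apply: spec_bind.
    apply: spec_le; first exact: spec_uneliminate.
    by rewrite leq_add2r leq_mul2l szB.
  by move=> _ ->; exact: spec_ret0.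
by rewrite subnKC ?leqnn // (leq_trans _ (block_cost_pivot e (mu P B) HK b0)) ?leq_addr.
Qed.

End PPPA.

(** * Fourier-Motzkin elimination *)


Section FourierMotzkin.
Variables (R : realType) (n : nat).
Notation ineq := (('I_n -> R) * R)%type.
Implicit Types (vars : seq 'I_n) (x : 'I_n -> R) (e f : ineq) (es : seq ineq).

Definition holds_ineq vars x e := ip vars e.1 x <= e.2.
Definition sat vars es x := all (holds_ineq vars x) es.

Fixpoint fm_cost v L : nat :=
  if v is v'.+1 then
    (1 + (L * 2 + (L * 2 + (L * 3 + (L * L * (6 + 3 * v') +
       (fm_cost v' (L + L * L) + ((2 * v' + 3) + L * (2 * v' + 4))))))))%N
  else (1 + L * 2)%N.

Lemma fm_cost_mono v L L' : (L <= L' -> fm_cost v L <= fm_cost v L')%N.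
Proof.
elim: v L L' => [|v IH] L L' LL /=; first by rewrite leq_add2l leq_mul2r LL orbT.
by rewrite !leq_add // ?leq_mul2r ?LL ?orbT // ?leq_mul // IH // leq_add // leq_mul.
Qed.

(** For [v = 2] the cost is [11 + 26 L + 30 L^2 + 16 L^3 + 8 L^4], whose coefficients add up to
    91. *)
Lemma fm_cost_le2 v L : (v <= 2 -> 0 < L -> fm_cost v L <= 91 * (L * L * L * L))%N.
Proof.
move=> v2 L0; have H1 : (L <= L * L)%N by rewrite leq_pmulr.
have H2 : (L * L <= L * L * L)%N by rewrite leq_pmulr.
have H3 : (L * L * L <= L * L * L * L)%N by rewrite leq_pmulr.
by case: v v2 => [|[|[|//]]] _ /=; nia.
Qed.

Definition bound_of vars k x e := (e.2 - ip vars e.1 x) / e.1 k.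

Lemma spec_fm_bound vars k x e : e.1 k != 0 ->
  spec (fm_bound vars k x e) (fun b => b = bound_of vars k x e) (2 * size vars + 3).
Proof.
move=> ek; apply: spec_le.
  apply: spec_bind; first exact: spec_dot.
  move=> _ ->; apply: spec_bind; first exact: spec_sub.
  by move=> _ ->; exact: spec_div.
by move: (size vars) => s; lia.
Qed.

Lemma spec_fm_extremum (op : R -> R -> prog R R) (opE : R -> R -> R) vars k x e es :
  (forall a b, spec (op a b) (fun c => c = opE a b) 1) ->
  e.1 k != 0 -> all (fun f => f.1 k != 0) es ->
  spec (let* b := fm_bound vars k x e in
        foldM (fun m f => let* b' := fm_bound vars k x f in op m b') b es)
    (fun m => m = foldl opE (bound_of vars k x e) (map (bound_of vars k x) es))
    (2 * size vars + 3 + size es * (2 * size vars + 4)).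
Proof.
move=> Hop ek esk; apply: spec_bind; first exact: spec_fm_bound.
move=> _ ->; apply: spec_le.
  apply: (@spec_foldM_prefix _ _ _ _ _ _ (fun t m => m = foldl opE
    (bound_of vars k x e) (map (bound_of vars k x) t))
    (fun=> 2 * size vars + 3 + 1)%N) => //.
  move=> t f s' _ E ->; apply: spec_bind.
    by apply: spec_fm_bound; move: esk; rewrite E all_cat /= => /and3P[].
  by move=> _ ->; rewrite map_rcons foldl_rcons; exact: Hop.
by rewrite big_const_seq count_predT iter_addn_0 mulnC -addnA.
Qed.

Lemma foldl_max_ge (m : R) s : m <= foldl Num.max m s /\ all (<=%R^~ (foldl Num.max m s)) s.
Proof.
elim: s m => //= a s IH m; have [H1 H2] := IH (Num.max m a).
rewrite H2 andbT; split; first by apply: le_trans H1; rewrite le_max lexx.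
by apply: le_trans H1; rewrite le_max lexx orbT.
Qed.

Lemma foldl_min_le (m : R) s : foldl Num.min m s <= m /\ all (>=%R^~ (foldl Num.min m s)) s.
Proof.
elim: s m => //= a s IH m; have [H1 H2] := IH (Num.min m a).
rewrite H2 andbT; split; first by apply: le_trans H1 _; rewrite ge_min lexx.
by apply: le_trans H1 _; rewrite ge_min lexx orbT.
Qed.

Lemma foldl_max_ind (p : pred R) m s : p m -> all p s -> p (foldl Num.max m s).
Proof.
elim: s m => //= a s IH m pm /andP[pa ps]; apply: IH => //.
by rewrite maxEle; case: ifP.
Qed.

Definition combined vars k e f x :=
  - f.1 k * ip vars e.1 x + e.1 k * ip vars f.1 x <= - f.1 k * e.2 + e.1 k * f.2.

Lemma spec_fm_combine vars k e f :
  spec (fm_combine vars k e f) (fun g => forall x, holds_ineq vars x g = combined vars k e f x)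
    (6 + 3 * size vars).
Proof.
apply: spec_le.
  apply: spec_bind; first exact: spec_opp.
  move=> m ->; apply: spec_bind.
    apply: (@spec_tab _ _ _ _ (fun j w => w = - f.1 k * e.1 j + e.1 k * f.1 j) 3).
    move=> j _; apply: (@spec_bind _ _ _ _ _ _ _ 1 2); first exact: spec_mul.
    move=> _ ->; apply: (@spec_bind _ _ _ _ _ _ _ 1 1); first exact: spec_mul.
    by move=> _ ->; exact: spec_add.
  move=> a Ha; apply: (@spec_bind _ _ _ _ _ (fun c => c = - f.1 k * e.2 + e.1 k * f.2) _ 3 0).
    apply: (@spec_bind _ _ _ _ _ _ _ 1 2); first exact: spec_mul.
    move=> _ ->; apply: (@spec_bind _ _ _ _ _ _ _ 1 1); first exact: spec_mul.
    by move=> _ ->; exact: spec_add.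
  move=> _ ->; apply: spec_ret0 => x; rewrite /holds_ineq /combined /=; congr (_ <= _).
  rewrite /ip !mulr_sumr -big_split; apply: eq_big_seq => j jv.
  by rewrite Ha //=; ring.
by move: (size vars) => s; lia.
Qed.

Lemma all_pairs (p : ineq -> ineq -> bool) es fs :
  all (fun ef => p ef.1 ef.2) [seq (e, f) | e <- es, f <- fs] =
  all (fun e => all (p e) fs) es.
Proof. by elim: es => //= e es IH; rewrite all_cat all_map IH. Qed.

Lemma sign_split (p a b c : pred ineq) es : (forall e, [|| a e, b e | c e]) ->
  all p (filter a es) -> all p (filter b es) -> all p (filter c es) -> all p es.
Proof.
move=> H; rewrite !all_filter; elim: es => //= e es IH.
move=> /andP[pa /IH{}IH] /andP[pb /IH{}IH] /andP[pc /IH ->]; rewrite andbT.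
by have /or3P[h|h|h] := H e; rewrite h in pa pb pc.
Qed.

Lemma all_predC_nilp T (p : pred T) s : all (predC p) s = nilp (filter p s).
Proof. by elim: s => //= a s ->; case: (p a). Qed.

Section Eliminate.
Variables (vars : seq 'I_n) (k : 'I_n).
Hypothesis kv : k \notin vars.

Lemma ip_upd (w x : 'I_n -> R) c : ip (k :: vars) w (upd x k c) = w k * c + ip vars w x.
Proof.
rewrite /ip big_cons /upd eqxx; congr (_ + _); apply: eq_big_seq => j jv.
by case: eqP => // jk; move: kv; rewrite -jk jv.
Qed.

Lemma holds_pos x c e : 0 < e.1 k ->
  holds_ineq (k :: vars) (upd x k c) e = (c <= bound_of vars k x e).
Proof.
move=> ek; rewrite /holds_ineq ip_upd /bound_of ler_pdivlMr // mulrC.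
by rewrite -lerBrDr.
Qed.

Lemma holds_neg x c e : e.1 k < 0 ->
  holds_ineq (k :: vars) (upd x k c) e = (bound_of vars k x e <= c).
Proof.
move=> ek; rewrite /holds_ineq ip_upd /bound_of ler_ndivrMr // mulrC.
by rewrite -lerBrDr.
Qed.

(** Comparing the lower bound from [f] with the upper bound from [e] and multiplying by
    [- e_k f_k > 0] gives the combined inequality. *)
Lemma combined_bounds e f x : 0 < e.1 k -> f.1 k < 0 ->
  combined vars k e f x = (bound_of vars k x f <= bound_of vars k x e).
Proof.
move=> ek fk; rewrite /bound_of ler_pdivlMr // mulrAC ler_ndivrMr //.
rewrite /combined; apply/idP/idP; lra.
Qed.

Lemma combined_holds e f x : 0 < e.1 k -> f.1 k < 0 ->
  holds_ineq (k :: vars) x e -> holds_ineq (k :: vars) x f -> combined vars k e f x.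
Proof.
move=> ek fk He Hf; rewrite combined_bounds //.
have E g : holds_ineq (k :: vars) x g = holds_ineq (k :: vars) (upd x k (x k)) g.
  by rewrite /holds_ineq; congr (_ <= _); apply: eq_ip => // j _; rewrite /upd; case: eqP => [->|].
by rewrite (le_trans (y := x k)) // -?holds_neg -?holds_pos // -E.
Qed.

End Eliminate.

Lemma spec_fm vars es : uniq vars -> spec (fm vars es)
  (fun y => match y with Some x => sat vars es x | None => forall x, ~~ sat vars es x end)
  (fm_cost (size vars) (size es)).
Proof.
elim: vars es => [|k vars IH] es.
  move=> _; apply: spec_bind; first exact: spec_lit.
  move=> z _; rewrite -[(size es * 2)%N]addn0; apply: spec_bind.
    by apply: (@spec_filterM _ _ _ (fun e => e.2 < 0)) => e; exact: spec_lt0.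
  move=> bad Ebad; have E x : sat [::] es x = nilp bad.
    rewrite Ebad /sat -all_predC_nilp; apply: eq_all => e.
    by rewrite /holds_ineq /ip big_nil /= leNgt.
  by apply: spec_ret0; case: bad {Ebad} E => [E|e s E] => [|x]; rewrite E.
move=> /= /andP[kv uv].
apply: spec_bind; first exact: spec_lit.
move=> z Ez; apply: spec_bind.
  by apply: (@spec_filterM _ _ _ (fun e => 0 < e.1 k)) => e; exact: spec_gt0.
move=> pos Epos; apply: spec_bind.
  by apply: (@spec_filterM _ _ _ (fun e => e.1 k < 0)) => e; exact: spec_lt0.
move=> neg Eneg; apply: spec_bind.
  by apply: (@spec_filterM _ _ _ (fun e => e.1 k == 0)) => e; exact: spec_is0.
move=> nul Enul.
have spos : (size pos <= size es)%N by rewrite Epos size_filter count_size.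
have sneg : (size neg <= size es)%N by rewrite Eneg size_filter count_size.
have snul : (size nul <= size es)%N by rewrite Enul size_filter count_size.
have apos : all (fun e => 0 < e.1 k) pos by rewrite Epos filter_all.
have aneg : all (fun e => e.1 k < 0) neg by rewrite Eneg filter_all.
apply: (@spec_bind _ _ _ _ _ (fun new : seq ineq =>
   (size new <= size es + size es * size es)%N /\
   forall x, sat vars new x = sat vars nul x &&
     all (fun e => all (fun f => combined vars k e f x) neg) pos)).
  apply: spec_le.
    apply: spec_post.
      apply: (@spec_foldM_prefix _ _ _ _ _ _ (fun t new =>
        (size new = size nul + size t)%N /\
        forall x, sat vars new x =
          sat vars nul x && all (fun ef => combined vars k ef.1 ef.2 x) t)
        (fun=> 6 + 3 * size vars + 0)%N).
        by split=> [|x]; rewrite ?addn0 ?andbT.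
      move=> t [e f] s' r _ [Hs Hr]; apply: spec_bind; first exact: spec_fm_combine.
      move=> g Hg; apply: spec_ret0; split=> [|x]; first by rewrite /= Hs size_rcons addnS.
      by rewrite /sat /= Hg -/(sat vars r x) Hr all_rcons andbCA.
    move=> new [-> Hnew]; split=> [|x]; last by rewrite Hnew (all_pairs (fun e f => combined vars k e f x)).
    by rewrite size_allpairs leq_add // leq_mul.
  rewrite big_const_seq count_predT iter_addn_0 size_allpairs addn0 mulnC.
  by rewrite leq_mul2r leq_mul ?orbT.
move=> new [snew Hnew]; apply: spec_bind.
  by apply: spec_le (IH new uv) _; exact: fm_cost_mono.
case=> [x|] Hx; last first.
  apply: spec_ret => x; apply: contra (Hx x) => Hsat; rewrite Hnew.
  have [sp sn] : sat (k :: vars) pos x /\ sat (k :: vars) neg x.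
    by rewrite /sat Epos Eneg !all_filter; split; apply: sub_all Hsat => e He; apply/implyP.
  apply/andP; split.
    rewrite /sat Enul all_filter; apply: sub_all Hsat => e He; apply/implyP => /eqP ek.
    by move: He; rewrite /holds_ineq /ip big_cons ek mul0r add0r.
  move: sp apos; rewrite /sat; elim: (pos) => //= e s IHs /andP[He /IHs{}IHs] /andP[ek /IHs ->].
  rewrite andbT; move: sn aneg; rewrite /sat.
  elim: (neg) => //= f s' IHs' /andP[Hf /IHs'{}IHs'] /andP[fk /IHs' ->].
  by rewrite andbT; exact: combined_holds.
move: Hx; rewrite Hnew => /andP[Hnul Hall].
have nz_neg : all (fun f => f.1 k != 0) neg by apply: sub_all aneg => e /lt_eqF ->.
have nz_pos : all (fun f => f.1 k != 0) pos by apply: sub_all apos => e /gt_eqF ->.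
(* Every lower bound for [x_k] lies below every upper bound; so the largest lower bound is
   admissible or, if there is none, the smallest upper bound. *)
have bounds : all (fun e => all (fun f => bound_of vars k x f <= bound_of vars k x e) neg) pos.
  move: Hall apos; elim: (pos) => //= e s IHs /andP[He /IHs{}IHs] /andP[ek /IHs ->].
  rewrite andbT; move: He aneg.
  elim: (neg) => //= f s' IHs' /andP[Hf /IHs'{}IHs'] /andP[fk /IHs' ->].
  by rewrite andbT -combined_bounds.
rewrite -[(2 * _ + 3 + _)%N]addn0.
apply: (@spec_bind _ _ _ _ _ (fun c => all (fun f => bound_of vars k x f <= c) neg /\
    all (fun e => c <= bound_of vars k x e) pos)).
  case: neg Eneg sneg aneg nz_neg bounds {Hnew Hall} => [|f s'] _ sneg aneg nz_neg bounds.
    case: pos Epos spos apos nz_pos bounds => [|e s] _ spos apos nz_pos bounds.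
      exact: spec_ret.
    have /andP[ek esk] := nz_pos.
    apply: spec_mono; first exact: (spec_fm_extremum _ _ (@spec_min R) ek esk).
      by rewrite leq_add2l leq_mul2r (leq_trans (leqnSn _) spos) orbT.
    move=> _ ->; split=> //; set b := bound_of vars k x e.
    have [H1 H2] := foldl_min_le b (map (bound_of vars k x) s).
    by rewrite /= H1; move: H2; rewrite all_map.
  have /andP[fk fsk] := nz_neg.
  apply: spec_mono; first exact: (spec_fm_extremum _ _ (@spec_max R) fk fsk).
    by rewrite leq_add2l leq_mul2r (leq_trans (leqnSn _) sneg) orbT.
  move=> _ ->; set b := bound_of vars k x f.
  have [H1 H2] := foldl_max_ge b (map (bound_of vars k x) s').
  split; first by rewrite /= H1; move: H2; rewrite all_map.
  apply: sub_all bounds => e /= /andP[He Hes].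
  by apply: (foldl_max_ind (p := fun c => c <= bound_of vars k x e)); rewrite ?all_map.
move=> c [Hneg Hpos]; apply: spec_ret0.
apply: (@sign_split _ (fun e => 0 < e.1 k) (fun e => e.1 k < 0) (fun e => e.1 k == 0)).
- by move=> e; rewrite orbA; case: ltgtP.
- rewrite -Epos; move: Hpos apos; elim: (pos) => //= e s IHs /andP[He /IHs{}IHs] /andP[ek /IHs ->].
  by rewrite andbT holds_pos.
- rewrite -Eneg; move: Hneg aneg; elim: (neg) => //= e s IHs /andP[He /IHs{}IHs] /andP[ek /IHs ->].
  by rewrite andbT holds_neg.
- rewrite -Enul; move: Hnul; have : all (fun e => e.1 k == 0) nul by rewrite Enul filter_all.
  rewrite /sat; elim: (nul) => //= e s IHs /andP[/eqP ek /IHs{}IHs] /andP[He /IHs ->].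
  by rewrite andbT /holds_ineq ip_upd // ek mul0r add0r.
Qed.

End FourierMotzkin.

(** * Algorithm III *)


Section Step3.
Variables (R : realType) (n : nat).
Notation ineq := (('I_n -> R) * R)%type.
Implicit Types (M : 'I_n -> 'I_n -> R) (B beta : seq 'I_n) (x w : 'I_n -> R).

Definition box_ok beta (a : R) w b x :=
  (0 <= a + ip beta w x) && ub_le b (a + ip beta w x).

Lemma spec_box beta a w b : spec (box beta a w b)
  (fun es => (size es <= 2)%N /\ forall x, sat beta es x = box_ok beta a w b x)
  (2 * size beta + 2).
Proof.
rewrite /box; apply: spec_le.
  apply: spec_bind.
    apply: (@spec_tab _ _ _ _ (fun k v => v = - w k) 2) => k _; exact: spec_opp.
  move=> w' Hw'; have E x : ip beta w' x = - ip beta w x.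
    by rewrite /ip -sumrN; apply: eq_big_seq => j jb; rewrite Hw' // mulNr.
  apply: (@spec_le _ _ _ _ 1); last exact: leqnn.
  case: b => [c|]; last first.
    apply: spec_ret; split=> // x; rewrite /sat /box_ok /= /holds_ineq /= E !andbT.
    by rewrite -subr_ge0 opprK.
  apply: (@spec_bind _ _ _ _ _ _ _ 1 0); first exact: spec_sub.
  move=> _ ->; apply: spec_ret0; split=> // x.
  rewrite /sat /box_ok /= /holds_ineq /= E !andbT; congr (_ && _).
    by rewrite -subr_ge0 opprK.
  by rewrite lerBrDl.
by move: (size beta) => s; lia.
Qed.

Lemma spec_boxes beta (a : 'I_n -> R) (w : 'I_n -> 'I_n -> R) b (es : seq ineq) s :
  spec (foldM (fun r i => let* e := box beta (a i) (w i) (b i) in Ret (e ++ r)) es s)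
    (fun r => (size r <= 2 * size s + size es)%N /\ forall x, sat beta r x =
       all (fun i => box_ok beta (a i) (w i) (b i) x) s && sat beta es x)
    (size s * (2 * size beta + 2)).
Proof.
apply: (@spec_foldM_const _ _ _ _ _ _ (fun t r => (size r <= 2 * size t + size es)%N /\
  forall x, sat beta r x =
    all (fun i => box_ok beta (a i) (w i) (b i) x) t && sat beta es x)) => //.
move=> t i r _ [Hs Hr]; rewrite -[(_ + 2)%N]addn0; apply: spec_bind; first exact: spec_box.
move=> e [es2 He]; apply: spec_ret0; split=> [|x].
  by rewrite size_cat size_rcons; clear -Hs es2; lia.
by rewrite /sat all_cat -!/(sat _ _ _) He Hr all_rcons andbA.
Qed.

Lemma spec_any_pair B : uniq B -> spec (any_pair R B)
  (fun beta => [/\ uniq beta, {subset beta <= B}, (size beta <= 2)%N &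
     {subset B <= beta} \/ exists i j, [/\ i \in beta, j \in beta & i != j]]) 2.
Proof.
case: B => [|i0 B0] uB; first by apply: spec_ret; split=> //; left.
rewrite /any_pair; apply: (@spec_bind _ _ _ _ _ _ _ 1 1); first exact: spec_any.
move=> i iB; case E: (rem i (i0 :: B0)) => [|j0 B1].
  apply: spec_ret; split=> //; first by move=> j; rewrite mem_seq1 => /eqP ->.
  left=> j jB; rewrite mem_seq1; apply/negPn/negP => ji.
  have : j \in rem i (i0 :: B0) by rewrite mem_rem_uniq // inE ji.
  by rewrite E.
apply: (@spec_bind _ _ _ _ _ _ _ 1 0); first exact: spec_any.
move=> j; rewrite -E mem_rem_uniq // inE => /andP[ji jB].
apply: spec_ret0; split=> //.
- by rewrite /= mem_seq1 eq_sym ji.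
- by move=> k; rewrite !in_cons in_nil orbF => /orP[/eqP ->|/eqP ->].
- by right; exists i, j; rewrite !in_cons !eqxx orbT eq_sym.
Qed.

Definition stationary (P : qp R n) B x := {in B, forall i,
  [/\ 0 <= x i, ub_le (ub P i) (x i) & grad (mx P) (lin P) B x i = 0]}.

Definition step3_cost b := (91 * (10 * b * (10 * b) * (10 * b) * (10 * b)) + 100 * (b * b * b))%N.

Lemma spec_step3_block P B : uniq B -> B != [::] -> symm (mx P) B ->
  (forall a i j, uniq a -> {subset a <= B} -> i \in B -> j \in B -> i != j ->
     i \notin a -> j \notin a -> posdef (mx P) a) ->
  spec (step3_block P B) (fun y => match y with
    | Some x => stationary P B x
    | None => forall x, ~ stationary P B x end) (step3_cost (size B)).
Proof.
case: P => M q u /= uB B0 sM Hpd.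
have b0 : (0 < size B)%N by case: (B) B0.
rewrite /step3_block; apply: spec_le.
  apply: spec_bind; first exact: spec_any_pair.
  move=> bt [ubt btB sbt Hbt]; set al := [seq k <- B | k \notin bt].
  have ual : uniq al by exact: filter_uniq.
  have alB : {subset al <= B} by move=> k; rewrite mem_filter => /andP[].
  have albt k : k \in al -> k \notin bt by rewrite mem_filter => /andP[].
  have sal : (size al <= size B)%N by rewrite size_filter count_size.
  have memB k : k \in B -> (k \in al) = (k \notin bt) by move=> kB; rewrite mem_filter kB andbT.
  have sumB (F : 'I_n -> R) : \sum_(k <- B) F k = \sum_(k <- al) F k + \sum_(k <- bt) F k.
    rewrite -big_cat; apply: perm_big; apply: uniq_perm => //.
      rewrite cat_uniq ual ubt andbT; apply/hasPn => k kb /=.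
      by rewrite mem_filter kb.
    move=> k; rewrite mem_cat mem_filter; case kb: (k \in bt) => /=; last by rewrite orbF.
    by rewrite btB.
  (* Either two indices are left out of [al] and [Hpd] applies, or the pair exhausts [B] and [al] is
     empty. *)
  have pM : posdef M al.
    case: Hbt => [full|[i [j [ib jb ij]]]].
      by move=> x _ k /[dup] /albt /negP kb /alB /full.
    apply: (Hpd al i j) => //; try exact: btB.
      by rewrite mem_filter ib.
    by rewrite mem_filter jb.
  have sMa := symm_sub alB sM.
  apply: (@spec_le _ _ _ _ (step3_cost (size B) - 2)); last exact: leqnn.
  apply: spec_le.
    apply: spec_bind; first exact: spec_inverse.
    move=> N iN; apply: spec_bind; first exact: spec_mulmv.
    move=> Nq HNq; apply: spec_bind.
      apply: (@spec_tab _ _ _ _ (fun i c => c = - Nq i)) => i _; exact: spec_opp.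
    move=> h Hh; apply: spec_bind.
      apply: (@spec_tab2 _ _ _ _ _ (fun i l c => c = - mv N al (M^~ l) i)) => i l _ _.
      apply: spec_bind; first exact: spec_dot.
      by move=> _ ->; exact: spec_opp.
    move=> G HG; apply: spec_bind.
      apply: (@spec_tab _ _ _ _ (fun i c => c = q i + mv M al h i)) => i _.
      apply: spec_bind; first exact: spec_dot.
      by move=> _ ->; exact: spec_add.
    move=> e He; apply: spec_bind.
      apply: (@spec_tab2 _ _ _ _ _ (fun i l c => c = M i l + mv M al (G^~ l) i)) => i l _ _.
      apply: spec_bind; first exact: spec_dot.
      by move=> _ ->; exact: spec_add.
    move=> T HT; apply: spec_bind; first exact: spec_lit.
    move=> _ ->; apply: spec_bind; first exact: spec_lit.
    move=> _ ->; apply: spec_bind; first exact: spec_boxes.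
    move=> E [sE HE]; apply: spec_bind; first exact: (@spec_boxes bt (fun=> 0%:R)).
    move=> E' [sE' HE']; apply: spec_bind; first exact: spec_boxes.
    move=> E'' [sE'' HE''].
    (* The unique extension of [x_beta] whose gradient vanishes on [al]; on [bt] its gradient is
       [e + T x]. *)
    pose X x i := if i \in al then h i + ip bt (G i) x else x i.
    have MGx x i : mv M al (fun j => ip bt (G j) x) i = ip bt (fun l => mv M al (G^~ l) i) x.
      rewrite /mv /ip; under eq_bigr do rewrite mulr_sumr.
      rewrite exchange_big; apply: eq_bigr => l _ /=.
      by rewrite mulr_suml; apply: eq_bigr => j _; rewrite mulrA.
    have gradX x i : i \in B -> grad M q B (X x) i =
        if i \in al then 0 else e i + ip bt (T i) x.
      move=> iB; rewrite /grad /mv sumB -/(mv M al (X x) i) -/(mv M bt (X x) i).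
      have -> : mv M al (X x) i = mv M al h i + 1 * ip bt (fun l => mv M al (G^~ l) i) x.
        rewrite -MGx -mvDZ; apply: eq_mv => // j ja.
        by rewrite /X ja mul1r.
      have -> : mv M bt (X x) i = ip bt (M i) x.
        apply: eq_big_seq => j jb; rewrite /X; case: ifP => // /albt.
        by rewrite jb.
      case: ifP => ia.
        have -> : mv M al h i = - q i.
          rewrite (@eq_mv _ _ M M al h (fun j => (-1) * mv N al q j) i) //; last first.
            by move=> j ja; rewrite Hh // HNq // mulN1r.
          by rewrite mvZ isinv_r // mulN1r.
        have -> : ip bt (fun l => mv M al (G^~ l) i) x = ip bt (fun l => - M i l) x.
          apply: eq_ip => // l lb.
          rewrite (@eq_mv _ _ M M al (G^~ l) (fun j => (-1) * mv N al (M^~ l) j) i) //.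
            by rewrite mvZ isinv_r // mulN1r.
          by move=> j ja; rewrite HG // mulN1r.
        rewrite mul1r; have -> : ip bt (fun l => - M i l) x = - ip bt (M i) x.
          by rewrite /ip -sumrN; apply: eq_bigr => l _; rewrite mulNr.
        ring.
      have ib : i \in bt by move: ia; rewrite memB // => /negbFE.
      have -> : ip bt (T i) x = ip bt (M i) x + ip bt (fun l => mv M al (G^~ l) i) x.
        rewrite /ip -big_split; apply: eq_big_seq => l lb.
        by rewrite HT //= mulrDl.
      by rewrite He //; ring.
    have satE x : sat bt E'' x <-> stationary (QP M q u) B (X x).
      rewrite HE'' HE' HE andbT; split.
        move=> /and3P[/allP Ha /allP Hb /allP Hc] i iB; rewrite gradX //=.
        rewrite /X; case: ifP => ia.
          by have := Ha i ia; rewrite /box_ok => /andP[].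
        have ib : i \in bt by move: ia; rewrite memB // => /negbFE.
        have := Hb i ib; rewrite /box_ok.
        have -> : ip bt (upd (fun=> 0%:R) i 1%:R) x = x i.
          rewrite -[RHS](sum_delta x ubt ib); apply: eq_bigr => j _.
          by rewrite /upd mulrC; case: eqP.
        rewrite mulr0n add0r => /andP[-> ->]; split=> //.
        by have := Hc i ib; rewrite /box_ok /= => /andP[H1 H2]; apply/eqP; rewrite eq_le H1 H2.
      move=> Hst; apply/and3P; split; apply/allP => i iS.
      - by have := Hst i (alB _ iS); rewrite /= /X iS /box_ok => -[-> ->].
      - have := Hst i (btB _ iS); rewrite /= /X; case: ifP => [/albt|_]; first by rewrite iS.
        rewrite /box_ok.
        have -> : ip bt (upd (fun=> 0%:R) i 1%:R) x = x i.
          rewrite -[RHS](sum_delta x ubt iS); apply: eq_bigr => j _.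
          by rewrite /upd mulrC; case: eqP.
        by rewrite mulr0n add0r => -[-> ->].
      - have := Hst i (btB _ iS); rewrite /= gradX ?btB //.
        case: ifP => [/albt|_]; first by rewrite iS.
        by rewrite /box_ok => -[_ _ ->]; rewrite /= mulr0n lexx.
    have solX x : stationary (QP M q u) B x -> {in B, x =1 X x}.
      move=> Hst i iB; rewrite /X; case: ifP => // ia.
      rewrite -(isinv_l x ual iN ia).
      have -> : mv N al (mv M al x) i =
          mv N al (fun j => - q j + (-1) * ip bt (M j) x) i.
        apply: eq_mv => // j ja; have [_ _ /=] := Hst j (alB j ja).
        rewrite /grad /mv sumB -/(mv M al x j) -/(ip bt (M j) x) => H; lra.
      rewrite mvDZ Hh // HNq //; congr (_ + _).
        by rewrite -mulN1r -mvZ; apply: eq_mv => // j _; rewrite mulN1r.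
      rewrite mulN1r /mv /ip; under eq_bigr do rewrite mulr_sumr.
      rewrite exchange_big -sumrN; apply: eq_big_seq => l lb /=.
      rewrite HG // mulNr /mv mulr_suml; congr (- _); apply: eq_bigr => j _.
      by rewrite mulrA.
    (* Each equation enters as a box with upper bound 0, so the two indices of [bt] give at most 4
       inequalities for equations and 4 for bounds, and [al] gives at most [2 * size B]; finally
       [8 + 2 b <= 10 b]. *)
    set L := (10 * size B)%N.
    apply: (@spec_bind _ _ _ _ _ _ _ (91 * (L * L * L * L))).
      apply: spec_le; first exact: spec_fm.
      apply: leq_trans (fm_cost_le2 sbt _); last by rewrite muln_gt0.
      apply: fm_cost_mono; rewrite /L; move: sE sE' sE'' sal sbt b0.
      move: (size E) (size E') (size E'') (size al) (size bt) (size B).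
      by clear; move=> a1 a2 a3 a4 a5 a6 /=; lia.
    case=> [xb|] Hxb; last first.
      apply: spec_ret => x Hx; have : sat bt E'' x; last by apply/negP.
      apply/satE => i iB; have := Hx i iB; rewrite /grad /= -(solX x Hx i iB).
      by rewrite (@eq_mv _ _ M M B (X x) x i) // => j jB; rewrite -solX.
    rewrite -[X in spec _ _ X]addn0; apply: spec_bind.
      apply: (@spec_tab _ _ _ _ (fun i c => c = h i + ip bt (G i) xb)) => i _.
      apply: spec_bind; first exact: spec_dot.
      by move=> _ ->; exact: spec_add.
    move=> xa Hxa; apply: spec_ret0.
    have /satE Hst := Hxb; move=> i iB; have := Hst i iB.
    have E1 : {in B, X xb =1 glue al xa xb}.
      by move=> j jB; rewrite /X /glue; case: ifP => // ja; rewrite Hxa.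
    by rewrite /grad E1 // (@eq_mv _ _ M M B (X xb) (glue al xa xb) i).
  rewrite /step3_cost; move: sal sbt b0; clear.
  move: (size al) (size bt) (size B) => a b s Ha Hb s0.
  move: (91 * _)%N => F.
  have H1 : (a * a <= s * s)%N by exact: leq_mul.
  have H2 : (a * a * a <= s * s * s)%N by exact: leq_mul.
  have H3 : (a * b <= a * 2)%N by rewrite leq_mul2l Hb orbT.
  have H4 : (b * b <= 4)%N by exact: (leq_mul Hb Hb).
  have H5 : (a * a * b <= a * a * 2)%N by rewrite leq_mul2l Hb orbT.
  have H6 : (a * (b * b) <= a * 4)%N by rewrite leq_mul2l H4 orbT.
  have H7 : (s <= s * s)%N by rewrite leq_pmulr.
  have H8 : (s * s <= s * s * s)%N by rewrite leq_pmulr.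
  lia.
rewrite subnKC //.
by rewrite /step3_cost; move: b0; clear; case: (size B) => // s _; lia.
Qed.

End Step3.


(** * The loop over the indices and its total cost *)

Definition steps_cost K n k : nat :=
  (k * (2 * (pppa_cost K n (2 * n) + 40 * (n * n * n)) + 6 * n + 20) +
   (4 * (n * n) + 1 + step3_cost n))%N.

Lemma steps_cost_bound K : exists C, forall n, (0 < n)%N ->
  (steps_cost K n n <= C * n ^ 4)%N.
Proof.
(* The first term is Fourier-Motzkin elimination with [L = 10 n]. The second is two runs of the PPPA
   per index, as [n^2 (2 n + 1) + n^3 <= 4 n^3]. The rest fits into 300. *)
exists (91 * (10 * 10 * 10 * 10) + 8 * K + 300)%N => n n0.
have -> : (n ^ 4 = n * n * n * n)%N by rewrite !expnS expn0 muln1 !mulnA.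
have H1 : (n <= n * n)%N by rewrite leq_pmulr.
have H2 : (n * n <= n * n * n)%N by rewrite leq_pmulr.
have H3 : (n * n * n <= n * n * n * n)%N by rewrite leq_pmulr.
have H4 : (K * (n * n * n) <= K * (n * n * n * n))%N by rewrite leq_mul2l H3 orbT.
rewrite /steps_cost /pppa_cost /step3_cost; lia.
Qed.

Section Steps.
Variables (R : realType) (n : nat).
Implicit Types (M : 'I_n -> 'I_n -> R) (S B : seq 'I_n) (x y v q : 'I_n -> R).
Implicit Types (P : qp R n).

Lemma ge0_ub_lt P i : (forall i c, ub P i = Some c -> 0 < c) -> ub_lt (ub P i) 0.
Proof. by move=> u0; case E: (ub P i) => [c|] //=; exact: u0 E. Qed.

Lemma stationary_kkt P S x : stationary P S x -> kkt P S x.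
Proof. by move=> Hx i /Hx[? ? ->]. Qed.

(** Componentwise, the gradients at two solutions differ in the direction opposite to the solutions,
    or one of the differences is zero. *)
Lemma kkt_monotone P S x y : kkt P S x -> kkt P S y ->
  qf (mx P) S (fun j => x j - y j) <= 0.
Proof.
move=> Hx Hy; rewrite /qf /ip big_seq sumr_le0 // => i iS; rewrite mvB.
have [x0 xu Hx1 Hx2] := Hx i iS; have [y0 yu Hy1 Hy2] := Hy i iS.
have -> : mv (mx P) S x i - mv (mx P) S y i =
  grad (mx P) (lin P) S x i - grad (mx P) (lin P) S y i by rewrite /grad; ring.
have [lt|lt|->] := ltgtP (x i) (y i); last by rewrite subrr mul0r.
  apply: mulr_le0_ge0; first by rewrite subr_le0 ltW.
  have H1 := Hy1 (le_lt_trans x0 lt).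
  have H2 : 0 <= grad (mx P) (lin P) S x i.
    by apply: Hx2; move: yu; case: (ub P i) => //= c; exact: lt_le_trans.
  by rewrite subr_ge0 (le_trans H1).
apply: mulr_ge0_le0; first by rewrite subr_ge0 ltW.
have H1 := Hx1 (le_lt_trans y0 lt).
have H2 : 0 <= grad (mx P) (lin P) S y i.
  by apply: Hy2; move: xu; case: (ub P i) => //= c; exact: lt_le_trans.
by rewrite subr_le0 (le_trans H1).
Qed.

Section Extend.
Variables (M : 'I_n -> 'I_n -> R) (S E : seq 'I_n).
Hypothesis uE : uniq E.
Hypothesis uS : uniq S.
Hypothesis SE : {subset S <= E}.
Hypothesis sM : symm M E.
Hypothesis pM : psd M E.

Lemma psd_ker_extend v : qf M S v <= 0 -> {in E, forall i, mv M S v i = 0}.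
Proof.
rewrite (qf_sub _ _ uE uS SE) => /(psd_ker uE sM pM) H i iE.
rewrite -[RHS](H i iE) /mv [RHS](sum_sub uE uS SE); last first.
  by move=> j _ /negPf ->; rewrite mulr0.
by apply: eq_big_seq => j ->.
Qed.

(** The slopes for [q] and [q'] differ by [c] times row i of [M v], which vanishes even though [i]
    may lie outside [S]. *)
Lemma ray_extend q q' u c i v : i \in E ->
  {in S, forall j, q' j = q j + M j i * c} ->
  ray (QP M q' u) S v -> ray (QP M q u) E (fun j => if j \in S then v j else 0).
Proof.
move=> iE Hq [/= v0 Mv qv].
have qv0 : qf M S v <= 0.
  by rewrite /qf /ip big1_seq // => j /andP[_ jS]; rewrite Mv ?mulr0.
have MvE := psd_ker_extend qv0.
split=> /=.
- by move=> j jE; case: ifP => // /v0.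
- move=> j jE; rewrite -[RHS](MvE j jE) /mv (sum_sub uE uS SE); last first.
    by move=> k _ /negPf ->; rewrite mulr0.
  by apply: eq_big_seq => k ->.
- have -> : ip E q (fun j => if j \in S then v j else 0) = ip S q v.
    rewrite /ip (sum_sub uE uS SE); last by move=> k _ /negPf ->; rewrite mulr0.
    by apply: eq_big_seq => k ->.
  suff -> : ip S q v = ip S q' v by [].
  transitivity (ip S q v + c * mv M S v i); first by rewrite MvE // mulr0 addr0.
  rewrite /ip /mv mulr_sumr -big_split; apply: eq_big_seq => j jS /=.
  by rewrite Hq // (sM (SE jS) iE); ring.
Qed.

End Extend.

(** * One coordinate fixed at [c]: 0 in step (1), its upper bound in step (2) *)

Section Coordinate.
Variables (P : qp R n) (q' : 'I_n -> R) (E : seq 'I_n) (i : 'I_n) (c : R).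
Hypothesis uE : uniq E.
Hypothesis sM : symm (mx P) E.
Hypothesis pM : psd (mx P) E.
Hypothesis iE : i \in E.
Hypothesis Hq : {in rem i E, forall j, q' j = lin P j + mx P j i * c}.

Let P' := QP (mx P) q' (ub P).
Let uS : uniq (rem i E). Proof. exact: rem_uniq. Qed.
Let SE : {subset rem i E <= E}. Proof. exact: mem_rem. Qed.
Let neq j : j \in rem i E -> (j == i) = false.
Proof. by rewrite mem_rem_uniq // inE => /andP[/negPf]. Qed.
Let memE j : j \in E -> j = i \/ j \in rem i E.
Proof. by rewrite mem_rem_uniq // inE; case: eqVneq => [->|_ ->]; [left|right]. Qed.

Lemma grad_fix x j : x i = c -> j \in rem i E ->
  grad (mx P) (lin P) E x j = grad (mx P) q' (rem i E) x j.
Proof. by move=> xi jS; rewrite /grad /mv (sum_rem _ uE iE) xi Hq // addrA. Qed.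

Lemma grad_upd x : grad (mx P) (lin P) E (upd x i c) i =
  lin P i + mx P i i * c + mv (mx P) (rem i E) x i.
Proof.
rewrite /grad /mv (sum_rem _ uE iE) {1}/upd eqxx addrA; congr (_ + _).
by apply: eq_big_seq => j jS; rewrite /upd neq.
Qed.

Lemma kkt_insert x : kkt P' (rem i E) x -> 0 <= c -> ub_le (ub P i) c ->
  let g := lin P i + mx P i i * c + mv (mx P) (rem i E) x i in
  (0 < c -> g <= 0) -> (ub_lt (ub P i) c -> 0 <= g) -> kkt P E (upd x i c).
Proof.
move=> Hx c0 cu g g1 g2 j /memE[->|jS]; first by rewrite grad_upd /upd eqxx.
rewrite grad_fix ?/upd ?eqxx // neq //.
have -> : grad (mx P) q' (rem i E) (upd x i c) j = grad (mx P) q' (rem i E) x j.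
  congr (_ + _); apply: eq_mv => // k kS.
  by rewrite /upd neq.
exact: Hx.
Qed.

(** A solution [y] of the whole problem with [y_i = c] also solves the subproblem, so it differs
    from [x] there by a null vector. A failed test thus excludes [y_i = c]. *)
Lemma kkt_fixed_grad x y : kkt P' (rem i E) x -> kkt P E y -> y i = c ->
  grad (mx P) (lin P) E y i = lin P i + mx P i i * c + mv (mx P) (rem i E) x i.
Proof.
move=> Hx Hy yi; have Hy' : kkt P' (rem i E) y.
  by move=> j jS; rewrite -grad_fix //; exact: Hy (SE jS).
have := psd_ker_extend uE uS SE sM pM (kkt_monotone Hx Hy') iE.
rewrite mvB => /eqP; rewrite subr_eq0 => /eqP ->.
by rewrite /grad /mv (sum_rem _ uE iE) yi addrA.
Qed.

End Coordinate.

Lemma spec_step3 P : symm (mx P) (enum 'I_n) ->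
  (forall a i j, uniq a -> i != j -> i \notin a -> j \notin a ->
     forall B, uniq B -> irred (mx P) B -> {subset a <= B} -> i \in B ->
     posdef (mx P) a) ->
  spec (step3 P) (fun r => match r with
    | Some x => stationary P (enum 'I_n) x
    | None => forall x, ~ stationary P (enum 'I_n) x end)
    (4 * (n * n) + 1 + step3_cost n).
Proof.
move=> sM Hpd; have uE := enum_uniq 'I_n; rewrite /step3.
have En : size (enum 'I_n) = n by rewrite size_enum_ord.
rewrite -addnA; apply: spec_bind.
  by apply: spec_le; first exact: spec_blocks; rewrite En.
move=> Bs HBs; have [pe HB] := HBs; apply: spec_bind; first exact: spec_lit.
(* [W] is [step3_cost n] with one factor [n] taken out, in the form that [spec_fold_blocks] sums
   over the blocks. *)
move=> z _; pose W := (91 * (10 * (10 * n) * (10 * n) * (10 * n)) + 100 * (n * n))%N.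
have gradB x B i : B \in Bs -> i \in B ->
    grad (mx P) (lin P) (enum 'I_n) x i = grad (mx P) (lin P) B x i.
  move=> BBs iB; have [_ uB BS _ off] := HB B BBs.
  by rewrite /grad (@mv_block _ _ _ _ B) // => j jE jB; exact: off.
have -> : step3_cost n = (size (flatten Bs) * W)%N.
  by rewrite (perm_size pe) En /W /step3_cost; clear; lia.
apply: (@spec_post _ _ _ (fun r => match r with
    | Some x => {in Bs, forall B, stationary P B x}
    | None => forall x, ~ stationary P (enum 'I_n) x end)); last first.
  case=> [x|//] Hx i iE; have : i \in flatten Bs by rewrite (perm_mem pe).
  by case/flattenP => B BBs iB; rewrite (gradB x B) //; exact: Hx.
apply: spec_fold_blocks; first by rewrite (perm_uniq pe).
  move=> B BBs; have [B0 uB BS iM _] := HB B BBs.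
  have bn : (size B <= n)%N by have := uniq_leq_size uB BS; rewrite En.
  apply: spec_mono.
  - apply: spec_step3_block => //; first exact: symm_sub sM.
    move=> a i j ua aB iB jB ij ia ja; exact: (Hpd a i j ua ij ia ja B).
  - have -> : step3_cost (size B) = (size B * (91 * (10 * (10 * size B) *
      (10 * size B) * (10 * size B)) + 100 * (size B * size B)))%N.
      by rewrite /step3_cost; clear; lia.
    by rewrite leq_mul2l /W; apply/orP; right; rewrite leq_add ?leq_mul.
  - case=> // H x Hx; apply: (H x) => i iB; rewrite -(gradB x B) //.
    exact: Hx (BS i iB).
move=> B x y xy Hx i iB; have := Hx i iB; rewrite xy // /grad.
by rewrite (@eq_mv _ _ (mx P) (mx P) B x y i).
Qed.

(** The last hypothesis is the loop invariant, the indices outside [s] being those already tested.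
    It speaks of all KKT points, so it also serves when there are none and step (3) is
    infeasible. *)
Lemma spec_steps K fuel P s : (1300 <= K)%N -> (4 * n + 5 <= fuel)%N ->
  symm (mx P) (enum 'I_n) -> psd (mx P) (enum 'I_n) ->
  (forall i, psd (cmp (mx P)) (rem i (enum 'I_n))) ->
  (forall i c, ub P i = Some c -> 0 < c) ->
  (forall a i j, uniq a -> i != j -> i \notin a -> j \notin a ->
     forall B, uniq B -> irred (mx P) B -> {subset a <= B} -> i \in B ->
     posdef (mx P) a) ->
  (forall i, i \notin s -> forall x, kkt P (enum 'I_n) x ->
     0 < x i /\ ub_lt (ub P i) (x i)) ->
  spec (steps fuel P s) (fun r => match r with
    | Some x => kkt P (enum 'I_n) x
    | None => (exists v, ray P (enum 'I_n) v) \/ forall x, ~ kkt P (enum 'I_n) x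
    end) (steps_cost K n (size s)).
Proof.
move=> HK Hf sM pM pC u0 Hpd; elim: s => [|i s IH] Hs /=.
  apply: spec_mono; first exact: spec_step3.
    by rewrite /steps_cost mul0n.
  case=> [x|H]; first exact: stationary_kkt.
  right=> x Hx; apply: (H x) => i iE.
  have [x1 x2] := Hs i isT x Hx; have [x0 xu /(_ x1) g1 /(_ x2) g2] := Hx i iE.
  by split=> //; apply/eqP; rewrite eq_le g1.
set E := enum 'I_n in sM pM pC Hpd Hs IH *.
have uE : uniq E := enum_uniq _.
have iE j : j \in E by rewrite mem_enum.
have En : size E = n by rewrite size_enum_ord.
have uS : uniq (rem i E) := rem_uniq _ uE.
have SE : {subset rem i E <= E} := @mem_rem _ _ _.
have sS : (size (rem i E) <= n)%N by rewrite size_rem // En leq_pred.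
have next : (forall x, kkt P E x -> 0 < x i /\ ub_lt (ub P i) (x i)) ->
    forall j, j \notin s -> forall x, kkt P E x -> 0 < x j /\ ub_lt (ub P j) (x j).
  move=> Hi j js x Hx; have [->|ji] := eqVneq j i; first exact: Hi.
  by apply: Hs => //; rewrite in_cons negb_or ji.
pose pc := (pppa_cost K n (2 * n) + 40 * (n * n * n))%N.
have solve P' : mx P' = mx P -> ub P' = ub P ->
    spec (pppa fuel P' (rem i E)) (solved P' (rem i E)) pc.
  move=> EM Eu; have mS : (mu P' (rem i E) <= 2 * n)%N.
    rewrite /mu mulSn mul1n leq_add // (leq_trans (count_size _ _)) //.
  apply: spec_le.
    apply: (spec_pppa_aux HK) => //.
    - by rewrite EM; exact: symm_sub sM.
    - by rewrite Eu.
    - by rewrite EM.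
    - move: mS sS Hf; move: (mu _ _) (size _) => a b; clear; lia.
  rewrite /pc leq_add // ?leq_mul //.
  by rewrite /pppa_cost ltnS leq_mul2l leq_add ?leq_mul ?orbT.
have -> : steps_cost K n (size s).+1 = (1 + (pc + (2 * n + 1 + (1 + (2 +
   (2 * n + 1 + (pc + (2 * n + 1 + (1 + (1 + (1 + (2 + (steps_cost K n (size s) + 8)))))))))))))%N.
  by rewrite /steps_cost mulSn -/pc; move: (pc) (_ + step3_cost _)%N (size s) => a b c; clear; lia.
have dotS : ((2 * size (rem i E)).+1 <= 2 * n + 1)%N by rewrite addn1 ltnS leq_mul2l sS.
have EP : P = QP (mx P) (lin P) (ub P) by case: (P).
rewrite {1}EP /=.
apply: (@spec_bind _ _ _ _ _ (fun z => z = 0) _ 1); first exact: spec_lit.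
move=> _ ->; apply: spec_bind.
  exact: (solve P erefl erefl).
case=> [x|[v Hv]]; last first.
  apply: spec_ret; left; exists (fun j => if j \in rem i E then v j else 0).
  have q0 : {in rem i E, forall j, lin P j = lin P j + mx P j i * 0}.
    by move=> j _; rewrite mulr0 addr0.
  exact: (ray_extend uE uS SE sM pM (iE i) q0 Hv).
move=> Hx; have q0 : {in rem i E, forall j, lin P j = lin P j + mx P j i * 0}.
  by move=> j _; rewrite mulr0 addr0.
apply: spec_bind; first by apply: spec_le dotS; exact: spec_dot.
move=> _ ->; apply: spec_bind; first exact: spec_add.
move=> _ ->; apply: spec_bind; first exact: spec_ge0.
move=> _ ->; case: (lerP 0 _) => [t0|t0].
  apply: spec_ret; apply: (kkt_insert uE (iE i) q0 Hx) => //=.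
  - by case Eu: (ub P i) => [c|] //=; rewrite ltW // (u0 _ _ Eu).
  - by rewrite ltxx.
  - by rewrite mulr0 addr0.
have y0 y : kkt P E y -> 0 < y i.
  move=> Hy; have [yi0 _ _ g2] := Hy i (iE i); rewrite lt0r yi0 andbT.
  apply/eqP => yi; rewrite yi (kkt_fixed_grad uE sM pM (iE i) q0 Hx Hy yi) in g2.
  have := g2 (ge0_ub_lt i u0); rewrite mulr0 addr0 leNgt.
  by rewrite t0.
case Eu: (ub P i) => [c|]; last first.
  apply: spec_le (IH (next _)) _; last by move: (steps_cost _ _ _) (pc) => a b; clear; lia.
  by move=> y Hy; split; [exact: y0 | rewrite Eu].
have c0 := u0 _ _ Eu.
apply: spec_bind.
  apply: spec_le.
    apply: (@spec_tab _ _ _ _ (fun j a => a = lin P j + mx P j i * c) 2) => j _.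
    apply: (@spec_bind _ _ _ _ _ _ _ 1 1); first exact: spec_mul.
    by move=> _ ->; exact: spec_add.
  by rewrite mulnC.
move=> q' Hq'; apply: spec_bind.
  exact: (solve (QP (mx P) q' (ub P)) erefl erefl).
case=> [x'|[v Hv]]; last first.
  apply: spec_ret; left; exists (fun j => if j \in rem i E then v j else 0).
  exact: (ray_extend uE uS SE sM pM (iE i) Hq' Hv).
move=> Hx'; apply: spec_bind; first by apply: spec_le dotS; exact: spec_dot.
move=> _ ->; apply: spec_bind; first exact: spec_mul.
move=> _ ->; apply: spec_bind; first exact: spec_add.
move=> _ ->; apply: spec_bind; first exact: spec_add.
move=> _ ->; apply: spec_bind; first exact: spec_le0.
move=> _ ->; case: (lerP _ 0) => [t1|t1].
  apply: spec_ret; apply: (kkt_insert uE (iE i) Hq' Hx') => //=.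
  - exact: ltW.
  - by rewrite Eu /=.
  - by rewrite Eu /= ltxx.
apply: spec_le (IH (next _)) _; last exact: leq_addr.
move=> y Hy; split; first exact: y0.
have [_ yu g1 _] := Hy i (iE i); rewrite Eu /= in yu *.
rewrite lt_neqAle yu andbT; apply/eqP => yi.
rewrite yi (kkt_fixed_grad uE sM pM (iE i) Hq' Hx' Hy yi) in g1.
by have := g1 c0; rewrite leNgt t1.
Qed.

End Steps.

(** * Optimality conditions *)


Section Optimality.
Variables (R : realType) (n : nat).
Implicit Types (S B : seq 'I_n) (x y v : 'I_n -> R) (P : qp R n).

Definition obj P S x := ip S (lin P) x + 2^-1 * qf (mx P) S x.

Definition feas P S x := {in S, forall i, 0 <= x i /\ ub_le (ub P i) (x i)}.

Definition minimizer P S x := feas P S x /\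
  forall y, feas P S y -> obj P S x <= obj P S y.

Lemma objD P S x v t : symm (mx P) S ->
  obj P S (fun j => x j + t * v j) = obj P S x +
    t * ip S v (grad (mx P) (lin P) S x) + 2^-1 * t ^+ 2 * qf (mx P) S v.
Proof.
move=> sM; rewrite /obj qfDZ // ipDr.
have -> : ip S v (grad (mx P) (lin P) S x) = ip S (lin P) v + ip S v (mv (mx P) S x).
  by rewrite (ipC S (lin P)) /ip -big_split; apply: eq_bigr => i _; rewrite /grad mulrDr.
by field.
Qed.

Lemma kkt_minimizer P S x : symm (mx P) S -> psd (mx P) S -> kkt P S x ->
  minimizer P S x.
Proof.
move=> sM pM Hx; split; first by move=> i /Hx[].
move=> y Hy; pose v i := y i - x i.
have -> : obj P S y = obj P S (fun j => x j + 1 * v j).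
  by congr (_ + _ * _); [apply: eq_ip|apply: eq_qf] => // i _; rewrite /v; ring.
rewrite objD // -addrA lerDl; apply: addr_ge0; last first.
  by rewrite mulr_ge0 ?pM // mulr_ge0 ?sqr_ge0 // invr_ge0.
rewrite mul1r /ip big_seq sumr_ge0 // => i iS; rewrite /v.
have [x0 xu g1 g2] := Hx i iS; have [y0 yu] := Hy i iS.
have [lt|lt|->] := ltgtP (x i) (y i); last by rewrite subrr mul0r.
  apply: mulr_ge0; first by rewrite subr_ge0 ltW.
  by apply: g2; move: yu; case: (ub P i) => //= c; exact: lt_le_trans.
apply: mulr_le0; first by rewrite subr_le0 ltW.
by apply: g1; exact: le_lt_trans lt.
Qed.

Lemma ray_not_minimizer P S v x : symm (mx P) S -> ray P S v -> ~ minimizer P S x.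
Proof.
move=> sM [v0 Mv qv] [Fx /(_ (fun j => x j + 1 * v j)) H].
have : obj P S x <= obj P S (fun j => x j + 1 * v j).
  apply: H => i iS; have [xi0 xu] := Fx i iS; have [vi0 vu] := v0 i iS.
  rewrite mul1r; split; first exact: addr_ge0.
  by move: xu vu; case: (ub P i) => //= c xc /(_ isT) ->; rewrite addr0.
have Mv0 z : ip S z (mv (mx P) S v) = 0.
  by rewrite /ip big1_seq // => j /andP[_ jS]; rewrite Mv ?mulr0.
rewrite objD // /qf Mv0 mulr0 addr0 mul1r lerDl.
have -> : ip S v (grad (mx P) (lin P) S x) = ip S (lin P) v + ip S v (mv (mx P) S x).
  by rewrite (ipC S (lin P)) /ip -big_split; apply: eq_bigr => i _; rewrite /grad mulrDr.
by rewrite ip_mv // Mv0 addr0 leNgt qv.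
Qed.

(* [g] is the slope at the current point and [m] the curvature. *)
Lemma step_contradiction (g m b : R) : 0 < g -> 0 <= m -> 0 < b ->
  (forall s, 0 <= s -> s <= b -> s * g <= 2^-1 * s ^+ 2 * m) -> False.
Proof.
move=> g0 m0 b0 H; pose t := Num.min b (g / (m + 1)).
have m1 : 0 < m + 1 by lra.
have t0 : 0 < t by rewrite /t lt_min b0 divr_gt0.
have tm : t * (m + 1) <= g by rewrite -ler_pdivlMr // /t ge_min lexx orbT.
have := H t (ltW t0); rewrite /t ge_min lexx -/t => /(_ isT).
have -> : 2^-1 * t ^+ 2 * m = t * (2^-1 * (t * m)) by ring.
rewrite ler_pM2l //; lra.
Qed.

Lemma minimizer_kkt P S x : uniq S -> symm (mx P) S -> psd (mx P) S ->
  minimizer P S x -> kkt P S x.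
Proof.
move=> uS sM pM [Fx Hx] i iS; have [x0 xu] := Fx i iS.
pose e j : R := (j == i)%:R.
have ipe y : ip S e y = y i by rewrite ipC /ip sum_delta.
have qe : qf (mx P) S e = mx P i i by rewrite /qf ipe mv_delta.
have m0 : 0 <= mx P i i by rewrite -qe.
set g := grad _ _ _ _ _.
have step t : 0 <= x i + t -> ub_le (ub P i) (x i + t) ->
    0 <= t * g + 2^-1 * t ^+ 2 * mx P i i.
  move=> t0 tu; have : obj P S x <= obj P S (fun j => x j + t * e j).
    apply: Hx => j jS; rewrite /e; case: eqVneq => [->|_]; first by rewrite mulr1.
    by rewrite mulr0 addr0; exact: Fx.
  by rewrite objD // ipe qe -/g; lra.
split=> //.
  move=> xi; rewrite leNgt; apply/negP => g0.
  apply: (step_contradiction g0 m0 xi) => s s0 sx.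
  have := step (- s); rewrite subr_ge0 => /(_ sx); rewrite sqrrN.
  have -> : ub_le (ub P i) (x i + - s).
    by move: xu; case: (ub P i) => //= c; lra.
  by move=> /(_ isT); lra.
move=> xlt; rewrite leNgt; apply/negP => g0.
have g0' : 0 < - g by rewrite oppr_gt0.
(* The room above [x_i]; without an upper bound any positive length will do. *)
pose b := if ub P i is Some c then c - x i else 1.
have b0 : 0 < b by rewrite /b; move: xlt; case: (ub P i) => //= c; rewrite subr_gt0.
apply: (step_contradiction g0' m0 b0) => s s0 sb.
have := step s (addr_ge0 x0 s0).
have -> : ub_le (ub P i) (x i + s).
  by move: sb; rewrite /b; case: (ub P i) => //= c; lra.
by move=> /(_ isT); lra.
Qed.

Lemma cmp_qf_le (M : 'I_n -> 'I_n -> R) S x :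
  qf (cmp M) S (fun i => `|x i|) <= qf M S x.
Proof.
rewrite /qf /ip; apply: ler_sum => i _; rewrite /mv !mulr_sumr; apply: ler_sum => j _.
rewrite /cmp; case: eqVneq => [<-|_].
  rewrite (mulrC `|x i|) (mulrC (x i)) -!mulrA -!expr2.
  by rewrite real_normK ?num_real.
have := ler_norm (- (x i * (M i j * x j))); rewrite normrN !normrM; lra.
Qed.

(* A null vector of [M_aa] is a null vector of the comparison matrix of [M^{-i}]
   and of [M^{-j}], so that its support is separated from all other indices. *)
Lemma posdef_minus2 (M : 'I_n -> 'I_n -> R) E a i j B :
  uniq E -> symm M E -> (forall k, psd (cmp M) (rem k E)) -> (forall k, k \in E) ->
  uniq a -> i != j -> i \notin a -> j \notin a ->
  uniq B -> irred M B -> {subset a <= B} -> i \in B -> posdef M a.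
Proof.
move=> uE sM pC allE ua ij ia ja uB iM aB iB x qx t ta.
apply/eqP/negPn/negP => xt.
pose z k := if k \in a then `|x k| else 0.
have sep k p r : k \notin a -> p != k -> r != k -> z p = 0 -> z r != 0 -> M p r = 0.
  move=> ka pk rk zp zr.
  have aS : {subset a <= rem k E}.
    move=> l la; rewrite mem_rem_uniq // inE allE andbT.
    by apply: contraNneq ka => <-.
  have qz : qf (cmp M) (rem k E) z <= 0.
    have -> : qf (cmp M) (rem k E) z = qf (cmp M) a (fun k => `|x k|).
      by rewrite (qf_sub (cmp M) (fun k => `|x k|) (rem_uniq k uE) ua aS).
    exact: le_trans (cmp_qf_le M a x) qx.
  have sMk : symm M (rem k E) by move=> l l' _ _; exact: sM.
  apply: (psd_cmp_supp (rem_uniq _ uE) sMk (pC k) qz) => //.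
    by rewrite mem_rem_uniq // inE pk allE.
  by rewrite mem_rem_uniq // inE rk allE.
have aT : all (fun k => z k != 0) B.
  apply: iM; first by apply/hasP; exists t; [exact: aB | rewrite /z ta normr_eq0].
  move=> p r pB rB zp; rewrite negbK => /eqP zr; rewrite sM ?allE //.
  have pa : p \in a by apply: contraNT zp => /negPf pa; rewrite /z pa.
  (* Separation needs an omitted index different from both [p] and [r]: [j] if [r = i], and [i]
     otherwise. *)
  have [ri|ri] := eqVneq r i.
    apply: (sep j) => //; first by rewrite ri.
    by apply: contraNneq ja => <-.
  by apply: (sep i) => //; apply: contraNneq ia => <-.
by have := allP aT i iB; rewrite /z (negPf ia) eqxx.
Qed.

End Optimality.

(** * Transfer to matrices and extended real bounds *)

Section Matrices.
Variables (R : realType) (n : nat) (M : 'M[R]_n) (q : 'cV[R]_n) (u : 'I_n -> \bar R).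
Hypothesis M_Sbar1 : Sbar1 M.
Hypothesis u_gt0 : forall i, (0 < u i)%E.

Let P := qp_of M q u.

Lemma sum_enum (F : 'I_n -> R) : \sum_(i <- enum 'I_n) F i = \sum_i F i.
Proof. by rewrite big_enum. Qed.

Lemma qf_enum (x : 'cV[R]_n) : (x^T *m M *m x) 0 0 = qf (mx P) (enum 'I_n) (x^~ 0).
Proof.
rewrite -mulmxA mxE /qf /ip sum_enum; apply: eq_bigr => i _; rewrite !mxE.
by rewrite /mv sum_enum.
Qed.

Lemma objective_obj (x : 'cV[R]_n) : objective M q x = obj P (enum 'I_n) (x^~ 0).
Proof.
rewrite /objective /obj qf_enum; congr (_ + _).
by rewrite mxE /ip sum_enum; apply: eq_bigr => i _; rewrite mxE.
Qed.

Lemma feasible_feas (x : 'cV[R]_n) : feasible u x <-> feas P (enum 'I_n) (x^~ 0).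
Proof.
have E i : ((x i 0)%:E <= u i)%E = ub_le (ub P i) (x i 0).
  (* Positivity excludes the bound [-oo], which [qp_of] would read as no bound at all. *)
  by rewrite /= ; case: (u i) (u_gt0 i) => [r| |] //= _; rewrite ?lee_fin ?leey.
split=> H i; first by move=> _; rewrite -E; exact: H.
by have := H i; rewrite mem_enum E; exact.
Qed.

Lemma optimal_minimizer (x : 'cV[R]_n) :
  optimal M q u x <-> minimizer P (enum 'I_n) (x^~ 0).
Proof.
split=> -[/feasible_feas Fx Hx]; split=> //.
  move=> y Fy; pose y' : 'cV[R]_n := \col_i y i.
  have Ey : y'^~ 0 =1 y by move=> i; rewrite mxE.
  have -> : obj P (enum 'I_n) y = obj P (enum 'I_n) (y'^~ 0).
    by congr (_ + _ * _); [apply: eq_ip|apply: eq_qf] => // i _; rewrite Ey.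
  rewrite -!objective_obj; apply: Hx; apply/feasible_feas => i iE.
  by rewrite Ey; exact: Fy.
by move=> y /feasible_feas Fy; rewrite !objective_obj; exact: Hx.
Qed.

Lemma mx_symm : symm (mx P) (enum 'I_n).
Proof. by case: M_Sbar1 => -[H _] _ i j _ _; rewrite /= -{1}H mxE. Qed.

Lemma mx_psd : psd (mx P) (enum 'I_n).
Proof.
case: M_Sbar1 => -[_ H] _ x; have := H (\col_i x i); rewrite qf_enum.
by rewrite (@eq_qf _ _ (mx P) (mx P) _ _ x) // => i _; rewrite mxE.
Qed.

(** The reindexing by [lift i] identifies the submatrix of order [n - 1] with the index set that
    omits [i]. *)
Lemma mx_cmp_psd i : psd (cmp (mx P)) (rem i (enum 'I_n)).
Proof.
case: M_Sbar1 => _ /(_ i) [_ [_ H]] x; have := H (\col_k x (lift i k)).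
suff -> : ((\col_k x (lift i k))^T *m cmpmx (row' i (col' i M)) *m
    (\col_k x (lift i k))) 0 0 = qf (cmp (mx P)) (rem i (enum 'I_n)) x by [].
have sumE (F : 'I_n -> R) : \sum_(j <- rem i (enum 'I_n)) F j = \sum_k F (lift i k).
  apply: (addrI (F i)); rewrite -sum_rem ?enum_uniq ?mem_enum // sum_enum.
  by rewrite (bigD1_ord i).
rewrite -mulmxA mxE /qf /ip sumE; apply: eq_bigr => k _; rewrite !mxE; congr (_ * _).
rewrite /mv sumE; apply: eq_bigr => l _; rewrite !mxE /cmp /=.
by rewrite (inj_eq (@lift_inj _ i)).
Qed.

Lemma ub_gt0 i c : ub P i = Some c -> 0 < c.
Proof.
by rewrite /=; case: (u i) (u_gt0 i) => [r| |] //; rewrite lte_fin => r0 [<-].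
Qed.

Lemma spec_algorithmIII fuel : (4 * n + 5 <= fuel)%N ->
  spec (algorithmIII fuel P) (fun out => match out with
    | Some x => optimal M q u (\col_i x i)
    | None => ~ exists x, optimal M q u x end)
    (steps_cost 1300 n n).
Proof.
move=> Hf; have uE := enum_uniq 'I_n.
have pM a i j : uniq a -> i != j -> i \notin a -> j \notin a ->
     forall B, uniq B -> irred (mx P) B -> {subset a <= B} -> i \in B ->
     posdef (mx P) a.
  move=> ua ij ia ja B uB iM aB iB.
  apply: (posdef_minus2 uE mx_symm mx_cmp_psd _ ua ij ia ja uB iM aB iB).
  by move=> k; rewrite mem_enum.
have := spec_steps (s := enum 'I_n) (leqnn 1300) Hf mx_symm mx_psd mx_cmp_psd ub_gt0 pM.
rewrite size_enum_ord => H; apply: spec_post (H _) _; first by move=> i; rewrite mem_enum.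
case=> [x Hx|[[v Hv]|Hno] [x /optimal_minimizer Hx]].
- apply/optimal_minimizer/(kkt_minimizer mx_symm mx_psd).
  by apply: eq_kkt Hx => i _; rewrite mxE.
- exact: ray_not_minimizer mx_symm Hv Hx.
- exact: Hno (minimizer_kkt uE mx_symm mx_psd Hx).
Qed.

End Matrices.

Theorem theorem7p2 (R : realType) :
  exists C : nat,
    forall (n : nat) (M : 'M[R]_n) (q : 'cV[R]_n) (u : 'I_n -> \bar R),
      (0 < n)%N ->
      Sbar1 M ->
      (forall i, (0 < u i)%E) ->
      exists fuel : nat,
        all_runs (algorithmIII fuel (qp_of M q u))
          (fun (out : option ('I_n -> R)) (cost : nat) =>
             (cost <= C * n ^ 4)%N /\
             match out with
             | Some x => optimal M q u (\col_i x i)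
             | None => ~ exists x : 'cV[R]_n, optimal M q u x
             end).
Proof.
have [C HC] := steps_cost_bound 1300.
(* In every subproblem [mu] is at most [2 n], and there are at most [2 n] pivots. *)
exists C => n M q u n0 HM Hu; exists (4 * n + 5)%N.
exact: spec_le (spec_algorithmIII q HM Hu (leqnn _)) (HC n n0).
Qed.
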